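(* Let $N\ge 1$, let $L_k,C_k>0$ for $1\le k\le N$, and let $\mathbf{A}:[0,\infty)\to\mathbb{R}^{2N\times 2N}$ be measurable and essentially bounded. Assume there exists a real number $\alpha>0$, independent of $t$, such that $\mathbf{A}(t)+\mathbf{A}^*(t)\ge \alpha\,Id$ for a.e. $t\ge 0$. Then the time-varying network of telegrapher's equations $$C_k\frac{\partial v_k}{\partial t}=-\frac{\partial i_k}{\partial x},\qquad L_k\frac{\partial i_k}{\partial t}=-\frac{\partial v_k}{\partial x}\quad (0<x<1,\ t>0,\ 1\le k\le N),$$ $$\begin{pmatrix} v(t,0)\\ v(t,1)\end{pmatrix}=\mathbf{A}(t)\begin{pmatrix}-i(t,0)\\ i(t,1)\end{pmatrix},\qquad v=(v_1,\dots,v_N)^*,\ i=(i_1,\dots,i_N)^*,$$ is $L^p$ exponentially stable for every $p$ with $1\le p\le\infty$, and it is also $C^0$ exponentially stable if $t\mapsto\mathbf{A}(t)$ is continuous.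
   Context: Notation. $^*$ denotes transpose; matrix inequalities are between symmetric matrices. $\Omega=\{(t,x)\in\mathbb{R}^2: 0<x<1,\ t>0\}$, $\overline\Omega=[0,\infty)\times[0,1]$. Put $\tau_k=\sqrt{L_kC_k}$, $K_k=\sqrt{C_k/L_k}$, with edges ordered so that $0<\tau_1\le\dots\le\tau_N$. $L^p([0,1],\mathbb{R}^{2N})$ and $C^0([0,1],\mathbb{R}^{2N})$ (sup norm) are taken with the Euclidean norm on $\mathbb{R}^{2N}$. For a Banach space $F$, $L^1_{loc}([0,\infty),F)$ is the space of $F$-valued measurable functions whose $F$-norm is locally integrable on $[0,\infty)$; elements of $L^1_{loc}([0,\infty),L^p([0,1]))$ are identified with elements of $L^1_{loc}(\overline\Omega)$. Network origin. The system encodes $N$ lossless lines (the edges of a directed graph), coupled at the nodes $p$ by linear relations $V_p(t)=A_p(t)I_p(t)$ between the boundary voltages and the boundary currents (with a minus sign on currents at $x=0$) of the adjacent edges; all these relations are aggregated in the single matrix $\mathbf{A}(t)$, which, up to a permutation, is block diagonal with blocks $A_p(t)$. Solutions. The differential equations are understood in the distributional sense on $\Omega$: for all $\varphi\in C^\infty_c(\Omega)$, $\iint_\Omega (L_k i_k\,\partial_t\varphi+v_k\,\partial_x\varphi)\,dt\,dx=0$ and $\iint_\Omega (C_k v_k\,\partial_t\varphi+i_k\,\partial_x\varphi)\,dt\,dx=0$. For $h\in L^1_{loc}(\overline\Omega)$ set, whenever the limits exist (as $\varepsilon\to0^+$), $\widehat h(t,0)=\lim\frac1\varepsilon\int_0^\varepsilon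 h(t,s)ds$, $\widehat h(t,1)=\lim\frac1\varepsilon\int_{1-\varepsilon}^1 h(t,s)ds$, $\widehat h(0,x)=\lim\frac1\varepsilon\int_0^\varepsilon h(s,x)ds$; $h$ has a strict extension to $\partial\Omega$ if these limits exist for a.e. $t\in(0,\infty)$ and a.e. $x\in(0,1)$. The boundary conditions and initial conditions are understood with the strict extensions $\widehat v_k,\widehat\imath_k$, a.e. in $t$, resp. a.e. in $x$. For $1\le p\le\infty$, under the stated hypotheses on $\mathbf{A}$ and for every initial data $v_k^0,i_k^0\in L^p([0,1])$, $1\le k\le N$, there is a unique solution $(v_1,\dots,v_N,i_1,\dots,i_N)\in L^1_{loc}([0,\infty),L^p([0,1])^{2N})$ having a strict extension to $\partial\Omega$ and satisfying $\widehat v_k(0,\cdot)=v_k^0$, $\widehat\imath_k(0,\cdot)=i_k^0$. If $\mathbf{A}$ is continuous and the initial data are continuous on $[0,1]$ and satisfy the compatibility condition $\begin{pmatrix} v^0(0)\\ v^0(1)\end{pmatrix}=\mathbf{A}(0)\begin{pmatrix}-i^0(0)\\ i^0(1)\end{pmatrix}$, this solution is continuous on $\overline\Omega$. Time slices. Every such solution has the form $v_k(t,x)=f_k(x-t/\tau_k)+g_k(x+t/\tau_k)$, $i_k(t,x)=K_k(f_k(x-t/\tau_k)-g_k(x+t/\tau_k))$ for locally integrable $f_k$ on $(-\infty,1]$ and $g_k$ on $[0,\infty)$; this formula defines $\widehat v(t,\cdot),\widehat\imath(t,\cdot)$ (up to a.e. equality in $x$) for every $t\ge0$. Exponential stability.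 The system is $L^p$ exponentially stable if there exist $\gamma,K>0$ such that for all solutions $(v_1,\dots,v_N,i_1,\dots,i_N)\in L^1_{loc}([0,\infty),L^p([0,1])^{2N})$ having a strict extension to $\partial\Omega$ and satisfying $\widehat v_k(0,\cdot)=v_k^0$, $\widehat\imath_k(0,\cdot)=i_k^0$ for some initial data $v_k^0,i_k^0\in L^p([0,1])$, $1\le k\le N$, and all $t\ge0$, $\|(\widehat\imath(t,\cdot),\widehat v(t,\cdot))\|_{L^p([0,1],\mathbb{R}^{2N})}\le Ke^{-\gamma t}\|(\widehat\imath(0,\cdot),\widehat v(0,\cdot))\|_{L^p([0,1],\mathbb{R}^{2N})}$. For $\mathbf{A}$ continuous, it is $C^0$ exponentially stable if there exist $\gamma,K>0$ such that for all continuous solutions (continuous compatible initial data) and all $t\ge0$, $\|(i(t,\cdot),v(t,\cdot))\|_{C^0([0,1],\mathbb{R}^{2N})}\le Ke^{-\gamma t}\|(i(0,\cdot),v(0,\cdot))\|_{C^0([0,1],\mathbb{R}^{2N})}$. *)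

(* Defs.v *)
From HB Require Import structures.
From mathcomp Require Import all_boot all_order all_algebra.
From mathcomp Require Import all_classical all_reals all_analysis.
From mathcomp Require Import ess_sup_inf measurable_realfun.

Set Implicit Arguments.
Unset Strict Implicit.
Unset Printing Implicit Defensive.
Import Order.TTheory GRing.Theory Num.Theory.
Import numFieldNormedType.Exports.

Local Open Scope classical_set_scope.
Local Open Scope ring_scope.

Section Telegrapher.
Context {R : realType}.

Local Notation mu := (@lebesgue_measure R).
Local Notation I01 := (`[0, 1]%classic : set R).

(* Points of the plane are written (t, x). *)
Definition Omega : set (R * R) := `]0, +oo[ `*` `]0, 1[.
Definition Omega_bar : set (R * R) := `[0, +oo[ `*` `[0, 1].

Definition enorm n (u : 'cV[R]_n) : R := Num.sqrt (\sum_j u j ord0 ^+ 2).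

Definition psd n (M : 'M[R]_n) : Prop :=
  M^T = M /\ forall x : 'cV[R]_n, 0 <= (x^T *m M *m x) ord0 ord0.

Definition loewner_ge n (M1 M2 : 'M[R]_n) : Prop := psd (M1 - M2).

(* [measurable] on [R] denotes the Borel sigma-algebra; the preimages below are
   only required to lie in its completion for the Lebesgue measure. *)
Definition lebesgue_measurable_fun (D : set R) (f : R -> R) : Prop :=
  forall Y : set R, measurable Y -> completed_algebra_gen mu (D `&` f @^-1` Y).

Definition measurable_mx n (A : R -> 'M[R]_n) : Prop :=
  forall j k, lebesgue_measurable_fun `[0, +oo[ (fun t => A t j k).

Definition ess_bounded_mx n (A : R -> 'M[R]_n) : Prop :=
  exists M : R, {ae mu, forall t, 0 <= t -> forall j k, `|A t j k| <= M}.

(* Elements of L^p([0,1]) and of L^1_loc([0,oo), L^p([0,1])) are classes for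
   a.e. equality; they are represented by Borel functions. *)
Definition Lp_norm (p : \bar R) n (u : R -> 'cV[R]_n) : \bar R :=
  'N[mu]_p[(fun x => (enorm (u x))%:E) \_ I01].

Definition in_Lp (p : \bar R) n (u : R -> 'cV[R]_n) : Prop :=
  (forall j, measurable_fun I01 (fun x : R => u x j ord0)) /\
  (Lp_norm p u < +oo)%E.

(* Measurability of [h] as an L^p-valued function is joint measurability in
   (t, x): Bochner measurability would be too restrictive for p = oo, since
   translation is not continuous in L^oo. *)
Definition in_L1loc_Lp (p : \bar R) n (h : R -> R -> 'cV[R]_n) : Prop :=
  (forall j, measurable_fun Omega_bar (fun z : R * R => h z.1 z.2 j ord0)) /\
  (forall T : R, 0 < T -> mu.-integrable `[0, T] (fun t => Lp_norm p (h t))).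

Definition C0_norm n (u : R -> 'cV[R]_n) : R :=
  sup [set enorm (u x) | x in I01].

Definition continuous_Omega_bar n (h : R -> R -> 'cV[R]_n) : Prop :=
  forall j, {within Omega_bar, continuous (fun z : R * R => h z.1 z.2 j ord0)}.

Definition dt (phi : R * R -> R) : R * R -> R := 'D_(1, 0) phi.
Definition dx (phi : R * R -> R) : R * R -> R := 'D_(0, 1) phi.

Fixpoint iterated_partial (s : seq bool) (phi : R * R -> R) : R * R -> R :=
  if s is b :: s' then
    (if b then dx else dt) (iterated_partial s' phi)
  else phi.

Definition smooth (phi : R * R -> R) : Prop :=
  forall s : seq bool,
    continuous (iterated_partial s phi) /\
    forall z : R * R, derivable (iterated_partial s phi) z (1, 0) /\
                      derivable (iterated_partial s phi) z (0, 1).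

Definition test_function (phi : R * R -> R) : Prop :=
  [/\ smooth phi, compact (closure [set z | phi z != 0])
    & closure [set z | phi z != 0] `<=` Omega].

Definition mean_x0 (h : R -> R -> R) (t e : R) : R :=
  e^-1 * \int[mu]_(s in `[0, e]) h t s.
Definition mean_x1 (h : R -> R -> R) (t e : R) : R :=
  e^-1 * \int[mu]_(s in `[1 - e, 1]) h t s.
Definition mean_t0 (h : R -> R -> R) (x e : R) : R :=
  e^-1 * \int[mu]_(s in `[0, e]) h s x.

Definition has_strict_extension (h : R -> R -> R) : Prop :=
  {ae mu, forall t, 0 < t -> cvg (mean_x0 h t e @[e --> 0^'+]) /\
                             cvg (mean_x1 h t e @[e --> 0^'+])} /\
  {ae mu, forall x, 0 < x < 1 -> cvg (mean_t0 h x e @[e --> 0^'+])}.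

Definition trace_x0 n (h : R -> R -> 'cV[R]_n) (t : R) : 'cV[R]_n :=
  \col_k lim (mean_x0 (fun t x => h t x k ord0) t e @[e --> 0^'+]).
Definition trace_x1 n (h : R -> R -> 'cV[R]_n) (t : R) : 'cV[R]_n :=
  \col_k lim (mean_x1 (fun t x => h t x k ord0) t e @[e --> 0^'+]).
Definition trace_t0 n (h : R -> R -> 'cV[R]_n) (x : R) : 'cV[R]_n :=
  \col_k lim (mean_t0 (fun t x => h t x k ord0) x e @[e --> 0^'+]).

Section Network.
Context {N : nat}.
Variables (L C : 'I_N -> R) (A : R -> 'M[R]_(N + N)).
Local Notation field := (R -> R -> 'cV[R]_N).
Local Notation data := (R -> 'cV[R]_N).

Definition telegrapher_distr (v i : field) : Prop :=
  forall (k : 'I_N) (phi : R * R -> R), test_function phi ->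
    \int[(mu \x mu)%E]_(z in Omega)
      (L k * i z.1 z.2 k ord0 * dt phi z + v z.1 z.2 k ord0 * dx phi z) = 0 /\
    \int[(mu \x mu)%E]_(z in Omega)
      (C k * v z.1 z.2 k ord0 * dt phi z + i z.1 z.2 k ord0 * dx phi z) = 0.

Record network_solution (v i : field) (v0 i0 : data) : Prop := {
  sol_distr : telegrapher_distr v i;
  sol_strict_v : forall k, has_strict_extension (fun t x => v t x k ord0);
  sol_strict_i : forall k, has_strict_extension (fun t x => i t x k ord0);
  sol_boundary : {ae mu, forall t, 0 < t ->
    col_mx (trace_x0 v t) (trace_x1 v t) =
      A t *m col_mx (- trace_x0 i t) (trace_x1 i t)};
  sol_initial : {ae mu, forall x, 0 < x < 1 ->
    trace_t0 v x = v0 x /\ trace_t0 i x = i0 x}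
}.

Definition Lp_solution (p : \bar R) (v i : field) (v0 i0 : data) : Prop :=
  [/\ in_L1loc_Lp p (fun t x => col_mx (i t x) (v t x)), in_Lp p v0, in_Lp p i0
    & network_solution v i v0 i0].

Definition compatible (v0 i0 : data) : Prop :=
  col_mx (v0 0) (v0 1) = A 0 *m col_mx (- i0 0) (i0 1).

Definition C0_data (v0 i0 : data) : Prop :=
  [/\ forall k, {within I01, continuous (fun x : R => v0 x k ord0)},
      forall k, {within I01, continuous (fun x : R => i0 x k ord0)}
    & compatible v0 i0].

Definition C0_solution (v i : field) (v0 i0 : data) : Prop :=
  [/\ continuous_Omega_bar v, continuous_Omega_bar i, C0_data v0 i0
    & network_solution v i v0 i0].

Definition tau (k : 'I_N) : R := Num.sqrt (L k * C k).
Definition Kadm (k : 'I_N) : R := Num.sqrt (C k / L k).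

Definition slice_v (f g : 'I_N -> R -> R) (t x : R) : 'cV[R]_N :=
  \col_k (f k (x - t / tau k) + g k (x + t / tau k)).
Definition slice_i (f g : 'I_N -> R -> R) (t x : R) : 'cV[R]_N :=
  \col_k (Kadm k * (f k (x - t / tau k) - g k (x + t / tau k))).

(* [f] and [g] are determined by [v] and [i] up to a.e. equality. *)
Record wave_form (v i : field) (f g : 'I_N -> R -> R) : Prop := {
  wave_f_meas : forall k, measurable_fun (`]-oo, 1] : set R) (f k);
  wave_g_meas : forall k, measurable_fun (`[0, +oo[ : set R) (g k);
  wave_f_loc : forall k a, mu.-integrable `[a, 1] (EFin \o f k);
  wave_g_loc : forall k b, mu.-integrable `[0, b] (EFin \o g k);
  wave_eq : {ae (mu \x mu)%E, forall z : R * R, Omega z ->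
    v z.1 z.2 = slice_v f g z.1 z.2 /\ i z.1 z.2 = slice_i f g z.1 z.2}
}.

(* The slices at time t are given by the wave form of the solution for every
   t >= 0. Every solution has a wave form, and it is unique up to a.e. equality,
   so that the bound does not depend on which [f] and [g] are chosen. *)
Definition Lp_exp_stable (p : \bar R) : Prop :=
  exists gamma K : R, [/\ 0 < gamma, 0 < K &
    forall (v i : field) (v0 i0 : data), Lp_solution p v i v0 i0 ->
    exists f g : 'I_N -> R -> R, wave_form v i f g /\
    forall t : R, 0 <= t ->
      (Lp_norm p (fun x => col_mx (slice_i f g t x) (slice_v f g t x)) <=
       (K * expR (- gamma * t))%:E *
       Lp_norm p (fun x => col_mx (slice_i f g 0 x) (slice_v f g 0 x)))%E].

Definition C0_exp_stable : Prop :=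
  exists gamma K : R, [/\ 0 < gamma, 0 < K &
    forall (v i : field) (v0 i0 : data), C0_solution v i v0 i0 ->
    forall t : R, 0 <= t ->
      C0_norm (fun x => col_mx (i t x) (v t x)) <=
      K * expR (- gamma * t) * C0_norm (fun x => col_mx (i 0 x) (v 0 x))].

End Network.
End Telegrapher.

(* Main.v *)
Require Import Defs.
From mathcomp Require Import all_boot all_order all_algebra.
From mathcomp Require Import all_classical all_reals all_analysis.
From mathcomp Require Import ess_sup_inf measurable_realfun.
From mathcomp Require Import ring lra.

(** The idea of the proof.

    On each line the combinations v + i/K and v - i/K, with K = sqrt (C/L),
    are transported at the speeds 1/tau and -1/tau.  A weak solution is
    therefore a superposition of two travelling waves,
    v = f (x - t/tau) + g (x + t/tau) and
    i = K (f (x - t/tau) - g (x + t/tau)); this is [transport_constant] and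
    [line_decomposition].  The limits of one-sided means that define the
    traces are values of f and g at Lebesgue points, so the boundary and
    initial conditions become almost everywhere identities between f and g
    ([network_decomposition]).

    Let a_k(t)^2 = K_k (g_k(t/tau_k)^2 + f_k(1 - t/tau_k)^2) be the energy
    that reaches the two ends of line k at time t.  The waves that leave the
    ends at time t reach the opposite ends, unchanged, at time t + tau_k.  At
    the nodes, the incoming minus the outgoing energy is the power w^T A w of
    the boundary currents w.  Since A is bounded and A + A^T >= alpha, this
    power is at least a fixed proportion of the incoming energy
    ([boundary_contraction]).  Hence for some rho < 1 and almost every t > 0,
        sum_k a_k(t + tau_k)^2 <= rho^2 sum_k a_k(t)^2.

    The delays tau_k differ, so this inequality does not bound the energy at
    one time by the energy at one earlier time.  Applied m times along all
    possible successions of delays, it gives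
        sum_k a_k(t)^2 <= rho^(2m) sum_q sum_k a_k(t - q.tau)^2,
    where q ranges over the multi-indices of N coordinates with sum m
    ([lattice_energy_bound]).  There are at most (m + 1)^N of them, so for m
    large the geometric factor wins over the number of terms.  Square roots
    turn this into a linear inequality for u = sum_k a_k, with coefficients of
    sum at most 1/2, and Minkowski's inequality carries it to the L^p norms of
    u on time windows, for every p in [1, oo].  A scalar recursion then gives
    exponential decay ([energy_contraction_decay]), with constants that depend
    on p, on the lines, on alpha and on the bound of A, but not on the
    solution.

    Finally the slice of a solution at time t is read on the windows
    [t, t + tau_k] of the amplitudes, and these windows at t = 0 are read on
    the initial slice ([slice_le_window], [window_le_slice]).  This proves the
    L^p statement.  A continuous solution satisfies the bound with p = oo
    almost everywhere, hence everywhere by continuity. *)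

Set Implicit Arguments.
Unset Strict Implicit.
Unset Printing Implicit Defensive.
Import Order.TTheory GRing.Theory Num.Theory.
Import numFieldNormedType.Exports.

Local Open Scope classical_set_scope.
Local Open Scope ring_scope.

(** * Almost everywhere properties and affine changes of variable *)

Section almost_everywhere.
Context d {T : measurableType d} {R : realType}.
Variable m : {measure set T -> \bar R}.

Lemma ae_imply (P Q : T -> Prop) : (forall x, P x -> Q x) ->
  {ae m, forall x, P x} -> {ae m, forall x, Q x}.
Proof.
move=> PQ [N [mN N0 hN]]; exists N; split=> // x /= nQ.
by apply: hN => /= Px; apply/nQ/PQ.
Qed.

Lemma ae_and (P Q : T -> Prop) : {ae m, forall x, P x} ->
  {ae m, forall x, Q x} -> {ae m, forall x, P x /\ Q x}.
Proof.
move=> aP aQ; have [N [mN N0 hN]] := negligibleU aP aQ.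
exists N; split=> // x /= /not_andP nPQ.
by apply: hN; case: nPQ => h; [left|right].
Qed.

Lemma ae_countable (I : countType) (P : I -> T -> Prop) :
  (forall i, {ae m, forall x, P i x}) -> {ae m, forall x, forall i, P i x}.
Proof.
move=> aP.
have : {ae m, forall x, forall n, if unpickle n is Some i then P i x else True}.
  apply: ae_foralln => n; case: (unpickle n) => [i|]; first exact: aP.
  exact: nearW.
apply: ae_imply => x h i.
by have := h (pickle i); rewrite pickleK.
Qed.

Lemma ae_all (P : T -> Prop) : (forall x, P x) -> {ae m, forall x, P x}.
Proof. by move=> h; exact: nearW. Qed.

End almost_everywhere.

Section affine.
Context {R : realType}.
Local Notation mu := (@lebesgue_measure R).
Implicit Types (a b c : R) (f g : R -> R).

Lemma ae_neq (b : R) : {ae mu, forall t, t != b}.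
Proof.
exists [set b]; split => //; first by rewrite lebesgue_measure_set1.
by move=> t /= /negP; rewrite negbK => /eqP.
Qed.

Definition affine a b : R -> R := fun x => a * x + b.

Lemma measurable_affine a b (D : set R) : measurable_fun D (affine a b).
Proof. by apply: measurable_funD => //; exact: measurable_funM. Qed.

Lemma preimage_affine_measurable a b (E : set R) :
  measurable E -> measurable (affine a b @^-1` E).
Proof.
by move=> mE; rewrite -[_ @^-1` _]setTI; exact: measurable_affine.
Qed.

(** Both sides are measures in E, and they agree on the intervals ]u, v],
    which determine a measure. For a < 0 the preimage is closed on the left
    and open on the right, with the same length. *)
Lemma lebesgue_measure_affine a b (E : set R) : a != 0 -> measurable E ->
  mu (affine a b @^-1` E) = (`|a|^-1%:E * mu E)%E.
Proof.
move=> a0 mE.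
have na : 0 < `|a| by rewrite normr_gt0.
pose m1 : {measure set (measurableTypeR R) -> \bar R} :=
  measure_function_pushforward__canonical__measure_function_Measure mu
    (@measurable_affine a b setT : measurable_fun setT
      (affine a b : measurableTypeR R -> measurableTypeR R)).
pose r : {nonneg R} := NngNum (ltW na).
pose nu : {measure set (measurableTypeR R) -> \bar R} := mscale r m1.
have H : forall A, measurable A -> mu A = nu A.
  apply: lebesgue_measure_unique => _ [[u v] _ <-] /=.
  rewrite /nu /= /mscale /= /pushforward /=.
  have [{}a0|a1] := ltP 0 a.
    have -> : affine a b @^-1` `]u, v] = `](u - b) / a, (v - b) / a]%classic.
      apply/seteqP; split => x; rewrite /= /affine !in_itv/= ltr_pdivrMr// ler_pdivlMr//; lra.
    rewrite !lebesgue_measure_itv /= !lte_fin ltr_pM2r ?invr_gt0// ltrD2r.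
    case: ifP => _; last by rewrite mule0.
    rewrite -!EFinB -EFinM gtr0_norm//; congr EFin.
    by field; rewrite gt_eqF.
  have {}a1 : a < 0 by rewrite lt_neqAle a0.
  have -> : affine a b @^-1` `]u, v] = `[(v - b) / a, (u - b) / a[%classic.
    apply/seteqP; split => x; rewrite /= /affine !in_itv/= ltr_ndivlMr// ler_ndivrMr//; lra.
  rewrite !lebesgue_measure_itv /= !lte_fin ltr_nM2r ?invr_lt0// ltrD2r.
  case: ifP => _; last by rewrite mule0.
  rewrite -!EFinB -EFinM ltr0_norm//; congr EFin.
  by field; rewrite lt_eqF.
rewrite [in RHS]H// /nu/= /mscale /= /pushforward muleA -EFinM mulVf ?mul1e//.
by rewrite gt_eqF.
Qed.

Lemma ae_affine a b (P : R -> Prop) : a != 0 ->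
  {ae mu, forall x, P x} -> {ae mu, forall x, P (affine a b x)}.
Proof.
move=> a0 [E [mE E0 PE]]; exists (affine a b @^-1` E); split.
- exact: preimage_affine_measurable.
- by apply/eqP; rewrite lebesgue_measure_affine// E0 mule0.
- by move=> x /= nPx; apply: PE.
Qed.

Lemma ge0_integral_affine a b (f : R -> \bar R) : a != 0 ->
  measurable_fun setT f -> (forall x, (0 <= f x)%E) ->
  (\int[mu]_x f (affine a b x) = `|a|^-1%:E * \int[mu]_x f x)%E.
Proof.
move=> a0 mf f0.
have na : 0 < `|a| by rewrite normr_gt0.
have := @ge0_integral_pushforward _ _ (measurableTypeR R) (measurableTypeR R) R
  (affine a b) (@measurable_affine a b setT) mu setT f measurableT mf (fun x _ => f0 x).
rewrite preimage_setT => /= <-.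
have i0 : 0 <= `|a|^-1 by rewrite invr_ge0.
pose r : {nonneg R} := NngNum i0.
rewrite -[RHS](@ge0_integral_mscale _ _ R mu setT measurableT r f)//.
apply: eq_measure_integral => [|? A mA _ /=]; first exact: measurable_affine.
by rewrite /pushforward /mscale /= lebesgue_measure_affine.
Qed.

Lemma integrable_affine a b (f : R -> R) : a != 0 ->
  mu.-integrable setT (EFin \o f) ->
  mu.-integrable setT (EFin \o (f \o affine a b)).
Proof.
move=> a0 /integrableP[/measurable_EFinP mf fi]; apply/integrableP; split.
  by apply/measurable_EFinP; apply: measurableT_comp => //; exact: measurable_affine.
have := @ge0_integral_affine a b (fun y => `|(f y)%:E|%E) a0.
rewrite /= => ->; last 2 first.
- by apply/measurable_EFinP; exact: measurableT_comp.
- by move=> x; rewrite lee_fin.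
rewrite lte_mul_pinfty// ?lee_fin ?invr_ge0.
Qed.

(** The real-valued integral is the difference of the integrals of the
    positive and negative parts, to which [ge0_integral_affine] applies. *)
Lemma integral_affine a b (f : R -> R) : a != 0 ->
  mu.-integrable setT (EFin \o f) ->
  (\int[mu]_x f (affine a b x) = `|a|^-1 * \int[mu]_x f x).
Proof.
move=> a0 fi.
have mf : measurable_fun setT (EFin \o f) by case/integrableP: fi.
have fia := integrable_affine b a0 fi.
rewrite /Rintegral integralE [in RHS]integralE.
have -> : (\int[mu]_x ((EFin \o (fun x0 => f (affine a b x0)))^\+) x =
   `|a|^-1%:E * \int[mu]_x ((EFin \o f)^\+) x)%E.
  rewrite -(@ge0_integral_affine a b (EFin \o f)^\+%E a0)//.
    by apply: eq_integral => x _; rewrite !funeposE.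
  exact: measurable_funepos.
have -> : (\int[mu]_x ((EFin \o (fun x0 => f (affine a b x0)))^\-) x =
   `|a|^-1%:E * \int[mu]_x ((EFin \o f)^\-) x)%E.
  rewrite -(@ge0_integral_affine a b (EFin \o f)^\-%E a0)//.
    by apply: eq_integral => x _; rewrite !funenegE.
  exact: measurable_funeneg.
rewrite -muleBr//; last first.
  by apply: fin_num_adde_defr; exact: integrable_pos_fin_num.
rewrite fineM//.
have := integrable_fin_num measurableT fi.
by rewrite integralE.
Qed.

End affine.

(** * Null sets and measurability in the plane *)

Section plane.
Context {R : realType}.
Local Notation mu := (@lebesgue_measure R).
Local Notation mu2 := (mu \x mu)%E.

(** Tonelli: the measures of the sections of a null set have integral zero. *)
Lemma ae_xsection (P : R * R -> Prop) : {ae mu2, forall z, P z} ->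
  {ae mu, forall t, {ae mu, forall x, P (t, x)}}.
Proof.
move=> [E [mE E0 PE]].
have : (\int[mu]_t `|(mu \o xsection E) t| = 0)%E.
  rewrite -[RHS]E0; apply: eq_integral => t _ /=.
  by rewrite gee0_abs.
have mph := measurable_fun_xsection mu mE.
move=> /(ae_eq_integral_abs mu measurableT mph).1 => h.
apply: filterS h => t /(_ Logic.I) /= ht.
exists (xsection E t); split => //; first exact: measurable_xsection.
by move=> x /= nP; apply/xsectionP; exact: PE.
Qed.

(** The product measure integrates the x-sections; by uniqueness of the
    product measure it is also obtained from the y-sections. *)
Lemma ae_ysection (P : R * R -> Prop) : {ae mu2, forall z, P z} ->
  {ae mu, forall x, {ae mu, forall t, P (t, x)}}.
Proof.
move=> [E [mE E0 PE]].
have E0' : (mu \x^ mu)%E E = 0%E.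
  rewrite -[RHS]E0; apply/esym; apply: product_measure_unique => // A B mA mB.
  exact: product_measure2E.
have : (\int[mu]_t `|(mu \o ysection E) t| = 0)%E.
  rewrite -[RHS]E0'; apply: eq_integral => t _ /=.
  by rewrite gee0_abs.
have mph := measurable_fun_ysection mu mE.
move=> /(ae_eq_integral_abs mu measurableT mph).1 => h.
apply: filterS h => t /(_ Logic.I) /= ht.
exists (ysection E t); split => //; first exact: measurable_ysection.
by move=> x /= nP; apply/ysectionP; exact: PE.
Qed.

Lemma ysection_null (E : set (R * R)) : measurable E ->
  {ae mu, forall x, mu (ysection E x) = 0%E} -> mu2 E = 0%E.
Proof.
move=> mE h.
have -> : mu2 E = (mu \x^ mu)%E E.
  apply: product_measure_unique => // A B mA mB.
  exact: product_measure2E.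
have mph := measurable_fun_ysection mu mE.
have : (\int[mu]_t `|(mu \o ysection E) t| = 0)%E.
  apply/(ae_eq_integral_abs mu measurableT mph).2.
  case: h => N [mN N0 hN]; exists N; split=> // x nP.
  by apply: hN => /= e; apply: nP => _.
by move=> <-; apply: eq_integral => t _ /=; rewrite gee0_abs.
Qed.

(** Characteristic coordinates: the pair (t, xi) stands for the point at time
    t on the characteristic x - c t = xi. *)
Definition shear (c : R) (z : R * R) : R * R := (z.1, z.2 + c * z.1).

Lemma measurable_shear c : measurable_fun setT (shear c).
Proof.
apply/measurable_fun_pairP; split => //=.
  exact: measurable_fst.
by apply: measurable_funD => //; apply: measurable_funM.
Qed.

Lemma shearK c : cancel (shear c) (shear (- c)).
Proof. by case=> t x; rewrite /shear /=; congr pair; ring. Qed.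

(** The section at each time is translated, and Tonelli integrates the
    measures of these sections. *)
Lemma shear_preserving c (E : set (R * R)) : measurable E ->
  mu2 (shear c @^-1` E) = mu2 E.
Proof.
move=> mE; apply: eq_integral => t _ /=.
have := @lebesgue_measure_affine R 1 (c * t) (xsection E t) (oner_neq0 R).
rewrite normr1 invr1 mul1e => <-; last exact: measurable_xsection.
congr (mu _); apply/seteqP; split => x.
  by move/xsectionP => /= h; apply/xsectionP; rewrite /affine mul1r.
by move/xsectionP; rewrite /affine mul1r => h; apply/xsectionP.
Qed.

(** The plane carries the product sigma-algebra; an open set belongs to it as
    a countable union of rational boxes. *)
Lemma open_measurable_plane (U : set (R * R)) : open U -> measurable U.
Proof.
move=> oU.
pose box (q : rat * rat * (rat * rat)) : set (R * R) :=
  `]ratr q.1.1, ratr q.1.2[ `*` `]ratr q.2.1, ratr q.2.2[.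
have -> : U = \bigcup_(q in [set q | box q `<=` U]) box q.
  apply/seteqP; split => [[x y] Uxy|z [q qU]]; last exact: qU.
  have [e /= e0 he] : nbhs_ball (x, y) U by rewrite nbhs_ballE; exact: oU.
  have /rat_in_itvoo[a] : x - e < x by lra.
  rewrite in_itv/= => /andP[a1 a2].
  have /rat_in_itvoo[b] : x < x + e by lra.
  rewrite in_itv/= => /andP[b1 b2].
  have /rat_in_itvoo[c] : y - e < y by lra.
  rewrite in_itv/= => /andP[c1 c2].
  have /rat_in_itvoo[d] : y < y + e by lra.
  rewrite in_itv/= => /andP[d1 d2].
  exists ((a, b), (c, d)); last by rewrite /box/=; split; rewrite /= in_itv/= ?a2 ?c2.
  move=> [x' y'] [] /=; rewrite !in_itv/= => /andP[p1 p2] /andP[p3 p4].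
  by apply: he; split; rewrite /ball/= ltr_norml; lra.
rewrite bigcup_mkcond; apply: countable_bigcupT_measurable => [|q]; last first.
  by case: ifP => _ //; exact: measurableX.
exact: countableP.
Qed.

Lemma continuous_measurable_plane (f : R * R -> R) : continuous f ->
  measurable_fun setT f.
Proof.
move=> /continuousP cf; apply: (measurability _ (RGenOpens.measurableE R)).
move=> _ [_ [a [b ->] <-]]; rewrite setTI; apply: open_measurable_plane.
by apply: cf; exact: interval_open.
Qed.

End plane.

(** * L^p norms on the real line *)

Section size.
Context {R : realType}.
Local Notation mu := (@lebesgue_measure R).
Implicit Types (p : \bar R) (f g : R -> R).

Definition Np p f : \bar R := 'N[mu]_p[EFin \o f].

Lemma muT_gt0 : (0 < mu [set: R])%E.
Proof. by rewrite -set_itvNyy lebesgue_measure_itv/= ltry. Qed.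

Lemma measurable_abs_poweR f (r : R) : measurable_fun setT f ->
  measurable_fun setT (fun x => `|(EFin \o f) x| `^ r)%E.
Proof.
move=> mf; apply/measurable_EFinP.
apply: (@measurableT_comp _ _ _ _ _ _ (@powR R ^~ r)); first exact: measurable_powR.
exact: measurableT_comp.
Qed.

Lemma Np_le p f g : (1 <= p)%E ->
  measurable_fun setT f -> measurable_fun setT g ->
  {ae mu, forall x, `|f x| <= `|g x|} -> (Np p f <= Np p g)%E.
Proof.
move=> p1 mf mg fg; rewrite /Np unlock /Lnorm; case: p p1 => [r|_|//].
- rewrite lee_fin => r1.
  have r0 : 0 < r by lra.
  apply: gt0_ler_poweR.
  + by rewrite invr_ge0 ltW.
  + by rewrite in_itv/= leey andbT integral_ge0// => x _; rewrite poweR_ge0.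
  + by rewrite in_itv/= leey andbT integral_ge0// => x _; rewrite poweR_ge0.
  apply: ae_ge0_le_integral => //.
  + by move=> x _; rewrite poweR_ge0.
  + exact: measurable_abs_poweR.
  + by move=> x _; rewrite poweR_ge0.
  + exact: measurable_abs_poweR.
  apply: ae_imply fg => x fgx _.
  by rewrite /= lee_fin ge0_ler_powR// ?inE// ltW.
- rewrite muT_gt0; apply: le_ess_sup.
  by apply: ae_imply fg => x /=; rewrite lee_fin.
Qed.

Lemma Np_add p f g : (1 <= p)%E ->
  measurable_fun setT f -> measurable_fun setT g ->
  (Np p (f \+ g)%R <= Np p f + Np p g)%E.
Proof. by move=> p1 mf mg; exact: eminkowski. Qed.

Lemma Np_0 p : (1 <= p)%E -> Np p (cst 0) = 0%E.
Proof.
by move=> p1; rewrite /Np Lnorm0// gt_eqF// (lt_le_trans _ p1)// lte_fin.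
Qed.

Lemma Np_ge0 p f : (0 <= Np p f)%E.
Proof. exact: Lnorm_ge0. Qed.

Lemma Np_scale p c f : (1 <= p)%E -> 0 <= c -> measurable_fun setT f ->
  Np p (fun x => c * f x) = (c%:E * Np p f)%E.
Proof.
move=> p1 c0 mf; rewrite /Np unlock /Lnorm; case: p p1 => [r|_|//].
- rewrite lee_fin => r1.
  have r0 : 0 < r by lra.
  transitivity (((c `^ r)%:E * \int[mu]_x (`|(EFin \o f) x| `^ r)) `^ r^-1)%E.
    congr (_ `^ _)%E; rewrite -ge0_integralZl//.
    + by apply: eq_integral => x _ /=; rewrite normrM ger0_norm// powRM// EFinM.
    + exact: measurable_abs_poweR.
    + by move=> x _; rewrite poweR_ge0.
    + by rewrite lee_fin powR_ge0.
  rewrite poweRM ?lee_fin ?powR_ge0//; last first.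
    by rewrite integral_ge0// => x _; rewrite poweR_ge0.
  by rewrite poweR_EFin -powRrM divff ?gt_eqF// powRr1.
- rewrite muT_gt0.
  rewrite -(ess_supZl _ muT_gt0)//; apply: eq_ess_sup; apply: nearW => x /=.
  by rewrite normrM ger0_norm// EFinM.
Qed.

Lemma measurable_sum_cond (I : Type) (s : seq I) (P : pred I) (F : I -> R -> R) :
  (forall i, measurable_fun setT (F i)) ->
  measurable_fun setT (fun x => \sum_(i <- s | P i) F i x).
Proof.
move=> mF; rewrite (_ : (fun _ => _) =
    (fun x => \sum_(i <- s) if P i then F i x else 0)); last first.
  by apply/funext => x; rewrite big_mkcond.
by apply: measurable_sum => i; case: (P i).
Qed.

Lemma Np_sum p (I : Type) (s : seq I) (P : pred I) (F : I -> R -> R) :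
  (1 <= p)%E -> (forall i, measurable_fun setT (F i)) ->
  (Np p (fun x => (\sum_(i <- s | P i) F i x)%R) <=
   \sum_(i <- s | P i) Np p (F i))%E.
Proof.
move=> p1 mF; elim: s => [|i s ih].
  rewrite big_nil (_ : (fun _ => _) = cst 0) ?Np_0//.
  by apply/funext => x; rewrite big_nil.
rewrite big_cons; case: ifPn => Pi; last first.
  by under eq_fun do rewrite big_cons (negbTE Pi).
rewrite (_ : (fun _ => _) = F i \+ (fun x => \sum_(i <- s | P i) F i x)); last first.
  by apply/funext => x; rewrite big_cons Pi.
apply: (le_trans (Np_add p1 _ _)) => //; first exact: measurable_sum_cond.
exact: leeD.
Qed.

(** The number |a|^(-1/p), with the convention that it is 1 for infinite p. *)
Definition dilation_factor p (a : R) : R :=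
  if p is r%:E then (`|a|^-1) `^ r^-1 else 1.

Lemma dilation_factor_ge0 p a : 0 <= dilation_factor p a.
Proof. by case: p => [r| |]//=; exact: powR_ge0. Qed.

Lemma dilation_factor1 p a : `|a| = 1 -> dilation_factor p a = 1.
Proof. by case: p => //= r ->; rewrite invr1 powR1. Qed.

(** For finite p this is the change of variable; for p = oo, an affine map
    pulls back null sets to null sets. *)
Lemma Np_affine p a b f : (1 <= p)%E -> a != 0 -> measurable_fun setT f ->
  (Np p (f \o affine a b) <= (dilation_factor p a)%:E * Np p f)%E.
Proof.
move=> p1 a0 mf; rewrite /Np unlock /Lnorm; case: p p1 => [r|_|//].
- rewrite lee_fin => r1.
  have r0 : 0 < r by lra.
  have i0 : (0 <= \int[mu]_x (`|(EFin \o f) x| `^ r))%E.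
    by rewrite integral_ge0// => x _; rewrite poweR_ge0.
  have := @ge0_integral_affine R a b (fun x => `|(EFin \o f) x| `^ r)%E a0.
  move=> /= -> //.
  + by rewrite poweRM// lee_fin invr_ge0.
  + exact: measurable_abs_poweR.
- rewrite muT_gt0 mul1e; apply/ess_supP.
  have := ess_sup_ge mu (abse \o (EFin \o f)).
  by move=> /(ae_affine b a0).
Qed.

End size.

(** * Geometric decay against polynomial growth *)

Section elementary.
Context {R : realType}.

Lemma sum_sqr_le (I : Type) (s : seq I) (P : pred I) (F : I -> R) :
  (forall i, 0 <= F i) ->
  \sum_(i <- s | P i) F i ^+ 2 <= (\sum_(i <- s | P i) F i) ^+ 2.
Proof.
move=> F0.
suff [] : 0 <= \sum_(i <- s | P i) F i /\
  \sum_(i <- s | P i) F i ^+ 2 <= (\sum_(i <- s | P i) F i) ^+ 2 by [].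
elim/big_ind2 : _ => [|x1 x2 y1 y2 [h1 h2] [h3 h4]|i _].
- by rewrite expr2 mul0r.
- split; first exact: addr_ge0.
  have := mulr_ge0 h1 h3; nra.
- by split.
Qed.

(** This is (m + 1) s^m <= 1 + s + ... + s^m, multiplied by 1 - s. *)
Lemma arith_geometric_bound (s : R) (m : nat) : 0 <= s -> s < 1 ->
  m.+1%:R * s ^+ m * (1 - s) <= 1 - s ^+ m.+1.
Proof.
move=> s0 s1; elim: m => [|m ih]; first by rewrite expr0 expr1 !mul1r.
have h : 0 <= s ^+ m.+1 <= 1 by rewrite exprn_ge0//= exprn_ile1// ltW.
have -> : m.+2%:R * s ^+ m.+1 * (1 - s) =
  s * (m.+1%:R * s ^+ m * (1 - s)) + s ^+ m.+1 * (1 - s).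
  by rewrite -(natr1 m.+1) !exprS; ring.
rewrite [s ^+ m.+2]exprS.
apply: (@le_trans _ _ (s * (1 - s ^+ m.+1) + s ^+ m.+1 * (1 - s))).
  by rewrite lerD2r ler_wpM2l.
case/andP: h => h1 h2; nra.
Qed.

(** Write s^m as the square of (sqrt s)^m: one factor absorbs one power of m +
    1, the other is left for the induction. *)
Lemma poly_geometric_bound (n : nat) (s : R) : 0 <= s -> s < 1 ->
  exists C : R, 0 <= C /\ forall m : nat, m.+1%:R ^+ n * s ^+ m <= C.
Proof.
elim: n s => [|n ih] s s0 s1.
  by exists 1; split=> // m; rewrite expr0 mul1r exprn_ile1// ltW.
have q0 : 0 <= Num.sqrt s by [].
have q1 : Num.sqrt s < 1 by rewrite -sqrtr1 ltr_sqrt.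
have qq : Num.sqrt s * Num.sqrt s = s by rewrite -expr2 sqr_sqrtr.
move: (Num.sqrt s) q0 q1 qq => q q0 q1 qq.
have [C [C0 hC]] := ih q q0 q1.
exists (C * (1 - q)^-1); split=> [|m].
  by rewrite mulr_ge0// invr_ge0; lra.
have -> : m.+1%:R ^+ n.+1 * s ^+ m = (m.+1%:R ^+ n * q ^+ m) * (m.+1%:R * q ^+ m).
  by rewrite -qq exprMn exprS; ring.
apply: ler_pM => //.
- by rewrite mulr_ge0// exprn_ge0.
- by rewrite mulr_ge0// exprn_ge0.
- rewrite -[leRHS]mul1r ler_pdivlMr; last lra.
  apply: le_trans (arith_geometric_bound m q0 q1) _.
  by rewrite gerBl exprn_ge0.
Qed.

(** Chooses the number m of iterations: in the iterated inequality each term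
    has the coefficient N rho^m, and there are at most (m + 1)^N terms. *)
Lemma geometric_beats_poly (N : nat) (rho eps : R) : 0 <= rho -> rho < 1 -> 0 < eps ->
  exists m : nat, (0 < m)%N /\ N%:R * rho ^+ m * m.+1%:R ^+ N <= eps.
Proof.
move=> r0 r1 e0.
have q0 : 0 <= Num.sqrt rho by [].
have q1 : Num.sqrt rho < 1 by rewrite -sqrtr1 ltr_sqrt.
have qq : Num.sqrt rho * Num.sqrt rho = rho by rewrite -expr2 sqr_sqrtr.
move: (Num.sqrt rho) q0 q1 qq => q q0 q1 qq.
have [C [C0 hC]] := poly_geometric_bound N q0 q1.
have NC0 : 0 < N%:R * C + 1 by rewrite ltr_wpDl// mulr_ge0.
have : q ^+ n @[n --> \oo] --> (0 : R) by apply: cvg_expr; rewrite ger0_norm.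
move=> /cvgrPdist_le /(_ (eps / (N%:R * C + 1))) []; first by rewrite divr_gt0.
move=> n0 _ hn; exists (maxn n0 1); split; first by rewrite leq_max orbT.
have := hn (maxn n0 1) (leq_maxl _ _); set m := maxn n0 1.
rewrite sub0r normrN ger0_norm ?exprn_ge0// => hm.
have -> : N%:R * rho ^+ m * m.+1%:R ^+ N = N%:R * (m.+1%:R ^+ N * q ^+ m) * q ^+ m.
  by rewrite -qq exprMn; ring.
apply: (@le_trans _ _ ((N%:R * C + 1) * q ^+ m)).
  rewrite ler_wpM2r ?exprn_ge0//.
  by rewrite ler_wpDr// ler_wpM2l.
by rewrite -ler_pdivlMl// mulrC.
Qed.

End elementary.

(** * Iteration of the delays over a lattice *)

Section lattice.
Context {R : realType} {N M : nat}.
Variables (tau : 'I_N -> R) (P : 'I_N -> R -> R) (r : R).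
Hypothesis P0 : forall k s, 0 <= P k s.

(** A multi-index q says how often each delay has been used; [lattice_weight
    q] counts the steps and [lattice_time q] is the time they take. The
    coordinates are bounded by M so that the multi-indices form a finite type.
    *)
Definition lattice_weight (q : {ffun 'I_N -> 'I_M.+1}) : nat := \sum_k q k.
Definition lattice_time (q : {ffun 'I_N -> 'I_M.+1}) : R := \sum_k (q k)%:R * tau k.
Definition lattice_level (m : nat) : {set {ffun 'I_N -> 'I_M.+1}} :=
  [set q | lattice_weight q == m].

Definition lattice_succ (k : 'I_N) (q : {ffun 'I_N -> 'I_M.+1}) :
  {ffun 'I_N -> 'I_M.+1} := [ffun i => if i == k then inord (q i).+1 else q i].

Lemma lattice_coord_le m q k : q \in lattice_level m -> (q k <= m)%N.
Proof.
rewrite inE /lattice_weight => /eqP <-.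
by rewrite (bigD1 k)//= leq_addr.
Qed.

Lemma lattice_succ_coord m q k : (m < M)%N -> q \in lattice_level m ->
  lattice_succ k q k = (q k).+1 :> nat.
Proof.
move=> mM qm; rewrite ffunE eqxx inordK// !ltnS.
by apply: leq_ltn_trans mM; exact: lattice_coord_le.
Qed.

Lemma lattice_succ_level m q k : (m < M)%N -> q \in lattice_level m ->
  lattice_succ k q \in lattice_level m.+1.
Proof.
move=> mM qm; rewrite inE /lattice_weight (bigD1 k)//= (lattice_succ_coord _ mM)//.
move: (qm); rewrite inE /lattice_weight (bigD1 k)//= => /eqP <-.
rewrite addSn eqSS eqn_add2l; apply/eqP/eq_bigr => i ik.
by rewrite ffunE (negbTE ik).
Qed.

Lemma lattice_succ_time m q k : (m < M)%N -> q \in lattice_level m ->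
  lattice_time (lattice_succ k q) = lattice_time q + tau k.
Proof.
move=> mM qm; rewrite /lattice_time (bigD1 k)//= (lattice_succ_coord _ mM)//.
rewrite [in RHS](bigD1 k)//= -natr1 mulrDl mul1r.
rewrite (eq_bigr (fun i => (q i)%:R * tau i)) => [|i ik]; first by ring.
by rewrite ffunE (negbTE ik).
Qed.

Lemma lattice_succ_inj m k : (m < M)%N ->
  {in lattice_level m &, injective (lattice_succ k)}.
Proof.
move=> mM q q' qm qm' e; apply/ffunP => i; apply: val_inj => /=.
have [->|ik] := eqVneq i k.
  have := congr1 (fun f : {ffun 'I_N -> 'I_M.+1} => val (f k)) e.
  by rewrite /= (lattice_succ_coord _ mM)// (lattice_succ_coord _ mM)// => -[].
have := congr1 (fun f : {ffun 'I_N -> 'I_M.+1} => val (f i)) e.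
by rewrite /= !ffunE (negbTE ik).
Qed.

Definition lattice_energy (t : R) (m : nat) : R :=
  \sum_(q in lattice_level m) \sum_k P k (t - lattice_time q).

(** Adding one step in direction k moves the time by [tau k] and maps level m
    injectively into level m + 1. Each term of the energy of level m is thus a
    term on the left of the one-step inequality at some point of level m + 1,
    and these inequalities are added up. *)
Lemma lattice_energy_step t m : (m < M)%N ->
  (forall q, q \in lattice_level m.+1 ->
    \sum_k P k (t - lattice_time q + tau k) <= r * \sum_k P k (t - lattice_time q)) ->
  lattice_energy t m <= r * lattice_energy t m.+1.
Proof.
move=> mM h; rewrite /lattice_energy mulr_sumr.
apply: (@le_trans _ _ (\sum_(q in lattice_level m.+1) \sum_k P k (t - lattice_time q + tau k))).
  rewrite exchange_big [leRHS]exchange_big /=; apply: ler_sum => k _.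
  have -> : \sum_(q in lattice_level m) P k (t - lattice_time q) =
    \sum_(q in lattice_succ k @: lattice_level m) P k (t - lattice_time q + tau k).
    rewrite big_imset/=; last exact: lattice_succ_inj.
    apply: eq_bigr => q qm; rewrite (lattice_succ_time _ mM)//.
    by congr (P k _); ring.
  rewrite [leRHS](bigID (mem (lattice_succ k @: lattice_level m)))/=.
  rewrite [X in _ <= X + _](_ : _ = \sum_(q in lattice_succ k @: lattice_level m)
    P k (t - lattice_time q + tau k)).
    by rewrite ler_wpDr// sumr_ge0.
  apply: eq_bigl => q; apply/andb_idl => /imsetP[q' qm' ->].
  exact: lattice_succ_level.
exact: ler_sum.
Qed.

(** Iteration of the previous step; level 0 consists of q = 0. Passing to
    whole levels is what makes the iteration possible although the delays
    differ. *)
Lemma lattice_energy_bound t m : 0 <= r -> (m <= M)%N ->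
  (forall q, (0 < lattice_weight q <= m)%N ->
    \sum_k P k (t - lattice_time q + tau k) <= r * \sum_k P k (t - lattice_time q)) ->
  \sum_k P k t <= r ^+ m * lattice_energy t m.
Proof.
move=> r0; elim: m => [|m ih] mM h.
  rewrite expr0 mul1r /lattice_energy (bigD1 [ffun=> ord0])/=; last first.
    by rewrite inE /lattice_weight big1// => i _; rewrite ffunE.
  rewrite (_ : lattice_time _ = 0) ?subr0; last first.
    by rewrite /lattice_time big1// => i _; rewrite ffunE mul0r.
  by rewrite ler_wpDr// sumr_ge0// => q _; rewrite sumr_ge0.
apply: le_trans (ih (ltnW mM) _) _.
  by move=> q /andP[q1 q2]; apply: h; rewrite q1 (leq_trans q2).
rewrite exprSr -mulrA ler_wpM2l ?exprn_ge0//.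
apply: lattice_energy_step => // q; rewrite inE => /eqP qm.
by apply: h; rewrite qm/=.
Qed.

End lattice.

(** * A scalar delay inequality *)

Section delay_recursion.
Context {R : realType}.

Lemma sume_const_ge0 (n : nat) (x : \bar R) : (0 <= x)%E ->
  (\sum_(i < n) x = n%:R%:E * x)%E.
Proof.
move=> x0; elim: n => [|n ih]; first by rewrite big_ord0 mul0e.
by rewrite big_ord_recr/= ih -natr1 EFinD ge0_muleDl ?mul1e ?lee_fin.
Qed.

(** One application of the recursion at b >= dp halves any bound that holds at
    all the times b - d q. All of these are earlier than b by at least dm, so
    the initial bound B on [0, dp] propagates to all times in steps of length
    dm; after that, each interval of length dp brings a factor 1/2. *)
Lemma delay_recursion_le (Q : Type) (s : seq Q) (P : pred Q) (d : Q -> R) (c dm dp B : R)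
    (U : R -> \bar R) : 0 < dm -> 0 <= dp -> 0 <= c -> 0 <= B ->
  (forall q, P q -> dm <= d q <= dp) -> c * (\sum_(q <- s | P q) 1) <= 2^-1 ->
  (forall b, dp <= b -> (U b <= \sum_(q <- s | P q) c%:E * U (b - d q)%R)%E) ->
  (forall b, 0 <= b <= dp -> (U b <= B%:E)%E) ->
  forall j b, j%:R * dp <= b -> 0 <= b -> (U b <= (2^-1 ^+ j * B)%:E)%E.
Proof.
move=> dm0 dp0 c0 B0 dP cs Urec Uinit.
have half X b : 0 <= X -> dp <= b ->
    (forall q, P q -> (U (b - d q)%R <= X%:E)%E) -> (U b <= (2^-1 * X)%:E)%E.
  move=> X0 db UX; apply: le_trans (Urec b db) _.
  apply: (@le_trans _ _ (\sum_(q <- s | P q) (c * X)%:E)%E).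
    by apply: lee_sum => q Pq; rewrite EFinM lee_wpmul2l// UX.
  rewrite sumEFin lee_fin.
  have -> : \sum_(q <- s | P q) c * X = c * (\sum_(q <- s | P q) 1) * X.
    by rewrite mulr_sumr mulr_suml; apply: eq_bigr => q _; rewrite mulr1.
  by rewrite ler_wpM2r.
(* Propagation of the initial bound, by steps of length dm. *)
have base n b : 0 <= b -> b <= dp + n%:R * dm -> (U b <= B%:E)%E.
  elim: n b => [|n ih] b b0 hb.
    by apply: Uinit; rewrite b0/= (le_trans hb)// mul0r addr0.
  have [bdp|/ltW dpb] := leP b dp; first by apply: Uinit; rewrite b0.
  apply: (@le_trans _ _ (2^-1 * B)%:E); last by rewrite lee_fin; lra.
  apply: half => // q /dP /andP[d1 d2]; apply: ih; first lra.
  move: hb; rewrite -natr1 mulrDl mul1r; lra.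
elim=> [|j ih] b jb b0.
  rewrite expr0 mul1r; apply: (base (Num.truncn (b / dm)).+1) => //.
  have := truncnS_gt (b / dm).
  rewrite ltr_pdivrMr// => h.
  by move: dp0; lra.
rewrite exprS -mulrA.
have hj : 0 <= j%:R * dp by rewrite mulr_ge0.
have jb' : j%:R * dp + dp <= b by move: jb; rewrite -natr1 mulrDl mul1r.
apply: half; first by rewrite mulr_ge0// exprn_ge0// invr_ge0.
  by lra.
by move=> q /dP /andP[d1 d2]; apply: ih; lra.
Qed.

Lemma half_power_le_exp (dp b : R) : 0 < dp -> 0 <= b ->
  2^-1 ^+ Num.truncn (b / dp) <= 2 * expR (- (ln 2 / dp) * b).
Proof.
move=> dp0 b0; have := truncnS_gt (b / dp).
set j := Num.truncn _ => hj.
have l2 : 0 < ln 2 :> R by rewrite ln_gt0// ltr1n.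
have -> : 2^-1 ^+ j = 2 * expR (- (j.+1%:R * ln 2)) :> R.
  rewrite expRN expRM_natl lnK ?posrE// exprS exprVn invfM mulrA divff ?mul1r//.
rewrite ler_pM2l// ler_expR mulNr lerN2 (mulrC (ln 2)) mulrAC.
by rewrite (mulrC dp^-1) ler_pM2r// ltW.
Qed.

End delay_recursion.

(** * Exponential decay of energy contractions *)

Section windows.
Context {R : realType} {N : nat}.
Local Notation mu := (@lebesgue_measure R).
Variables (tau : 'I_N -> R) (rho delta h : R) (p : \bar R).
Hypotheses (p1 : (1 <= p)%E) (delta0 : 0 < delta)
  (tau_bounds : forall k, delta <= tau k <= h) (rho01 : 0 <= rho < 1) (h0 : 0 < h).

Definition window (x y : R) (f : R -> R) : \bar R := Np p (f \_ `[x, y]).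

(** Here [a k t] stands for the square root of the energy that reaches the
    ends of line k at time t. The inequality combines the loss at the nodes
    with the travel along the lines; it holds for almost every t only. *)
Record energy_contraction (a : 'I_N -> R -> R) : Prop := {
  contr_meas : forall k, measurable_fun setT (a k);
  contr_ge0 : forall k t, 0 <= a k t;
  contr_step : {ae mu, forall t, 0 < t ->
    \sum_k a k (t + tau k) ^+ 2 <= rho ^+ 2 * \sum_k a k t ^+ 2}
}.

Variable a : 'I_N -> R -> R.
Hypothesis ha : energy_contraction a.

Let u t := \sum_k a k t.

Let u_ge0 t : 0 <= u t.
Proof. by rewrite sumr_ge0// => k _; exact: contr_ge0. Qed.

Let a_le_u k t : a k t <= u t.
Proof.
by rewrite /u (bigD1 k)//= lerDl sumr_ge0// => i _; exact: contr_ge0.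
Qed.

Let energy_le_sqr t : \sum_k a k t ^+ 2 <= u t ^+ 2.
Proof. by apply: sum_sqr_le => k; exact: contr_ge0. Qed.

Let measurable_u : measurable_fun setT u.
Proof. by apply: measurable_sum => k; exact: contr_meas. Qed.

Lemma restrict_measurable (D : set R) (f : R -> R) :
  measurable D -> measurable_fun setT f -> measurable_fun setT (f \_ D).
Proof.
move=> mD mf; apply/(measurable_restrictT _ _).1 => //.
exact: measurable_funTS.
Qed.

Lemma growth_step : {ae mu, forall t, 0 < t -> forall k, a k (t + tau k) <= u t}.
Proof.
apply: ae_imply (contr_step ha) => t ht t0 k.
have {}ht := ht t0.
rewrite -(@ler_pXn2r _ 2)// ?nnegrE//; last exact: (contr_ge0 ha).
apply: (@le_trans _ _ (\sum_k a k (t + tau k) ^+ 2)).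
  by rewrite (bigD1 k)//= lerDl sumr_ge0// => i _; rewrite sqr_ge0.
apply: le_trans ht _; apply: le_trans (energy_le_sqr t).
rewrite ler_piMl ?sumr_ge0// => [i _|]; first by rewrite sqr_ge0.
by case/andP: rho01 => r0 r1; rewrite expr_le1// ltW.
Qed.

Lemma window_le (x y x' y' : R) (f g : R -> R) :
  measurable_fun setT f -> measurable_fun setT g ->
  (forall t, 0 <= f t) -> (forall t, 0 <= g t) ->
  {ae mu, forall t, x <= t <= y -> x' <= t <= y' /\ f t <= g t} ->
  (window x y f <= window x' y' g)%E.
Proof.
move=> mf mg f0 g0 fg; apply: Np_le => //; do ?exact: restrict_measurable.
apply: ae_imply fg => t h1; rewrite !patchE !mem_setE !in_itv /=.
case: ifPn => [/h1[-> fgx]|_]; last by rewrite normr0.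
by rewrite !ger0_norm.
Qed.

(** The initial data control a_k on [0, tau k] only. On longer windows the
    energy inequality, used n times without its factor rho, costs a factor 1 +
    N for each length delta. *)
Lemma window_growth n k :
  (window 0 (tau k + n%:R * delta)%R (a k) <=
   ((1 + N%:R) ^+ n)%:E * \sum_j window 0 (tau j) (a j))%E.
Proof.
have ma := contr_meas ha; have a0 := contr_ge0 ha.
elim: n k => [|n ih] k.
  rewrite mul0r addr0 expr0 mul1e (bigD1 k)//= leeDl// sume_ge0// => i _.
  exact: Np_ge0.
set W0 := (\sum_j _)%E in ih *.
have W00 : (0 <= W0)%E by rewrite sume_ge0// => i _; exact: Np_ge0.
pose F j := (a j \_ `[0, tau j + n%:R * delta]%classic) \o affine 1 (- tau k).
have mr j D : measurable D -> measurable_fun setT (a j \_ D).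
  by move=> mD; exact: restrict_measurable.
have mF j : measurable_fun setT (F j).
  by apply: measurableT_comp; [exact: mr|exact: measurable_affine].
have F0 j x : 0 <= F j x by rewrite /F /= patchE; case: ifP.
apply: (@le_trans _ _ (Np p ((a k \_ `[0, tau k]%classic) \+
    (fun x => \sum_j F j x))%R)).
  apply: Np_le => //; first exact: mr.
    by apply: measurable_funD; [exact: mr|exact: measurable_sum].
  have := ae_affine (- tau k) (oner_neq0 R) growth_step.
  apply: ae_imply => t; rewrite /affine mul1r => gt.
  rewrite [leLHS]ger0_norm; last by rewrite patchE; case: ifP.
  have S0 : 0 <= \sum_j F j t by rewrite sumr_ge0.
  have A0 : 0 <= (a k \_ `[0, tau k]) t by rewrite patchE; case: ifP.
  rewrite /= [leRHS]ger0_norm ?addr_ge0// patchE.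
  case: ifPn => [|_]; last exact: addr_ge0.
  rewrite inE/= in_itv/= => /andP[t0 tt].
  have [ttau|taut] := leP t (tau k).
    by rewrite patchE mem_set ?lerDl//= in_itv/= t0.
  rewrite ler_wpDl//.
  have /gt/(_ k) : 0 < t - tau k by lra.
  rewrite subrK => /le_trans; apply; apply: ler_sum => j _.
  rewrite /F /= patchE /affine mul1r mem_set//= in_itv/=.
  have := tau_bounds j; have := tau_bounds k => /andP[? ?] /andP[? ?].
  move: tt; rewrite -natr1 mulrDl mul1r => tt.
  by apply/andP; split; lra.
apply: le_trans (Np_add p1 _ _) _; [exact: mr|exact: measurable_sum|].
apply: (@le_trans _ _ (W0 + \sum_(j < N) ((1 + N%:R) ^+ n)%:E * W0)%E).
  apply: leeD.
    rewrite /W0 (bigD1 k)//= leeDl// sume_ge0// => i _.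
    exact: Np_ge0.
  apply: le_trans (Np_sum _ _ p1 mF) _; apply: lee_sum => j _.
  apply: le_trans (ih j); apply: le_trans (Np_affine _ p1 (oner_neq0 R) _) _.
    exact: mr.
  by rewrite dilation_factor1 ?normr1// mul1e.
rewrite sume_const_ge0//; last by rewrite mule_ge0// lee_fin exprn_ge0// addr_ge0.
rewrite muleA -EFinM -[X in (X + _)%E]mul1e.
have C1 : 1 <= (1 + N%:R : R) ^+ n by rewrite exprn_ege1// lerDl.
rewrite -ge0_muleDl; first last.
- by rewrite lee_fin mulr_ge0// exprn_ge0// addr_ge0.
- by rewrite lee_fin.
  by rewrite lee_wpmul2r// lee_fin exprS mulrDl mul1r lerD2r.
Qed.

Lemma lattice_time_le m (q : {ffun 'I_N -> 'I_m.+1}) :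
  lattice_time tau q <= (lattice_weight q)%:R * h.
Proof.
rewrite /lattice_time /lattice_weight natr_sum mulr_suml; apply: ler_sum => k _.
by rewrite ler_wpM2l//; case/andP: (tau_bounds k).
Qed.

Lemma lattice_time_ge m (q : {ffun 'I_N -> 'I_m.+1}) :
  (lattice_weight q)%:R * delta <= lattice_time tau q.
Proof.
rewrite /lattice_time /lattice_weight natr_sum mulr_suml; apply: ler_sum => k _.
by rewrite ler_wpM2l//; case/andP: (tau_bounds k).
Qed.

(** The bound over the lattice for the energies a_k^2, followed by square
    roots. It becomes linear in u because a sum of squares of nonnegative
    numbers is at most the square of their sum. The condition on t keeps all
    the times t - lattice_time q positive. *)
Lemma pointwise_recursion m : {ae mu, forall t, m%:R * h < t ->
  u t <= N%:R * rho ^+ m *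
    \sum_(q in @lattice_level N m m) u (t - lattice_time tau q)}.
Proof.
case/andP: rho01 => r0 r1.
have := @ae_countable _ _ _ mu {ffun 'I_N -> 'I_m.+1}
  (fun q t => 0 < t - lattice_time tau q ->
    \sum_k a k (t - lattice_time tau q + tau k) ^+ 2 <=
    rho ^+ 2 * \sum_k a k (t - lattice_time tau q) ^+ 2).
move=> /(_ _)/wrap[q|].
  have := ae_affine (- lattice_time tau q) (oner_neq0 R) (contr_step ha).
  by apply: ae_imply => t; rewrite /affine mul1r.
apply: ae_imply => t ht mt.
set S := \sum_(q in _) _.
have S0 : 0 <= S by rewrite sumr_ge0.
have E : \sum_k a k t ^+ 2 <= (rho ^+ m * S) ^+ 2.
  have := @lattice_energy_bound R N m tau (fun k s => a k s ^+ 2) (rho ^+ 2) _ t m.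
  move=> /(_ _)/wrap[k s|]; first exact: sqr_ge0.
  move=> /(_ _)/wrap[|]; first exact: sqr_ge0.
  move=> /(_ (leqnn m))/(_ _)/wrap[q /andP[_ qm]|/le_trans].
    apply: ht; rewrite subr_gt0; apply: le_lt_trans mt.
    apply: le_trans (lattice_time_le q) _.
    by rewrite ler_wpM2r ?ler_nat// ltW.
  apply.
  have -> : (rho ^+ m * S) ^+ 2 = rho ^+ 2 ^+ m * S ^+ 2.
    by rewrite (exprAC rho 2 m); ring.
  rewrite ler_wpM2l ?exprn_ge0//.
  apply: le_trans (sum_sqr_le _ _ _); last by [].
  exact: ler_sum.
have ak k : a k t <= rho ^+ m * S.
  rewrite -(@ler_pXn2r _ 2)// ?nnegrE ?mulr_ge0 ?exprn_ge0 ?(contr_ge0 ha)//.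
  apply: le_trans E.
  by rewrite (bigD1 k)//= lerDl sumr_ge0// => i _; rewrite sqr_ge0.
apply: (@le_trans _ _ (\sum_(k < N) rho ^+ m * S)); first exact: ler_sum.
by rewrite sumr_const card_ord -[leLHS]mulr_natl mulrA.
Qed.

(** Minkowski's inequality for [pointwise_recursion]; translations in time
    preserve the norms. *)
Lemma window_recursion m b : m%:R * h <= b ->
  (window b (b + h)%R u <= \sum_(q in @lattice_level N m m)
    (N%:R * rho ^+ m)%:E * window (b - lattice_time tau q)%R
                                  (b - lattice_time tau q + h)%R u)%E.
Proof.
case/andP: rho01 => r0 r1 mb.
have c0 : 0 <= N%:R * rho ^+ m by rewrite mulr_ge0 ?exprn_ge0.
pose v (q : {ffun 'I_N -> 'I_m.+1}) : R -> R := u \_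
    `[b - lattice_time tau q, b - lattice_time tau q + h].
have v0 q t : 0 <= v q t by rewrite /v patchE; case: ifP.
have mv (q : {ffun 'I_N -> 'I_m.+1}) : measurable_fun setT (v q).
  exact: restrict_measurable.
pose w q := v q \o affine 1 (- lattice_time tau q).
have mw (q : {ffun 'I_N -> 'I_m.+1}) : measurable_fun setT (w q).
  by apply: measurableT_comp; [exact: mv|exact: measurable_affine].
have mcw (q : {ffun 'I_N -> 'I_m.+1}) :
    measurable_fun setT (fun t => N%:R * rho ^+ m * w q t).
  exact: measurable_funM.
apply: (@le_trans _ _ (Np p (fun t =>
    (\sum_(q in @lattice_level N m m) N%:R * rho ^+ m * w q t)%R))).
  apply: Np_le => //; first exact: restrict_measurable.
    exact: measurable_sum_cond.
  apply: ae_imply (ae_and (pointwise_recursion m) (ae_neq b)) => t [ut tb].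
  rewrite [leRHS]ger0_norm; last first.
    by rewrite sumr_ge0// => q _; rewrite mulr_ge0// /w /=.
  rewrite patchE mem_setE in_itv/=; case: ifPn => [/andP[bt tbh]|_]; last first.
    by rewrite normr0 sumr_ge0// => q _; rewrite mulr_ge0// /w /=.
  rewrite ger0_norm//; apply: le_trans (ut _) _.
    by apply: le_lt_trans mb _; rewrite lt_neqAle eq_sym tb.
  rewrite mulr_sumr; apply: ler_sum => q _.
  rewrite /w /v /= patchE mem_setE in_itv/= /affine mul1r.
  by rewrite ifT//; apply/andP; split; lra.
apply: le_trans (Np_sum _ _ p1 mcw) _; apply: lee_sum => q _.
rewrite Np_scale// lee_wpmul2l//.
apply: le_trans (Np_affine _ p1 (oner_neq0 R) (mv q)) _.
by rewrite dilation_factor1 ?normr1// mul1e.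
Qed.

End windows.

Section decay.
Context {R : realType} {N : nat}.
Local Notation mu := (@lebesgue_measure R).

(** With m such that the coefficients of [window_recursion] add up to at most
    1/2, the norm of u on a window of length h obeys the scalar delay
    inequality with dp = m h. The initial bound on [0, dp] comes from
    [window_growth]. *)
Theorem energy_contraction_decay (tau : 'I_N -> R) (rho delta h : R) (p : \bar R) :
  (1 <= p)%E -> 0 < delta -> (forall k, delta <= tau k <= h) ->
  0 <= rho < 1 -> 0 < h ->
  exists gamma C : R, [/\ 0 < gamma, 0 < C & forall a : 'I_N -> R -> R,
    energy_contraction tau rho a -> forall t, 0 <= t ->
    (\sum_k window p t (t + tau k)%R (a k) <=
     (C * expR (- gamma * t))%:E * \sum_k window p 0 (tau k) (a k))%E].
Proof.
move=> p1 delta0 tau_bounds rho01 h0.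
have [r0 r1] := andP rho01.
have half0 : 0 < 2^-1 :> R by [].
have [m [m0 mbound]] := geometric_beats_poly N r0 r1 half0.
pose dp := m%:R * h.
have dp0 : 0 < dp by rewrite mulr_gt0// ltr0n.
(* n steps of length delta cover all windows that start in [0, dp]. *)
pose n := (Num.truncn ((dp + h) / delta)).+1.
have ndelta : dp + h <= n%:R * delta.
  by rewrite -ler_pdivrMr// ltW// truncnS_gt.
pose C0 := N%:R * (1 + N%:R : R) ^+ n.
have C00 : 0 <= C0 by rewrite mulr_ge0// exprn_ge0// addr_ge0.
exists (ln 2 / dp), (N%:R * (2 * C0) + 1); split.
- by rewrite divr_gt0// ln_gt0// ltr1n.
- by rewrite ltr_wpDl// !mulr_ge0.
move=> a ha t t0.
have ma := contr_meas ha; have a0 := contr_ge0 ha.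
set W0 := (\sum_k window p 0 _ _)%E.
have W00 : (0 <= W0)%E by rewrite sume_ge0// => k _; exact: Np_ge0.
have K0 : 0 < (N%:R * (2 * C0) + 1) * expR (- (ln 2 / dp) * t).
  by rewrite mulr_gt0 ?expR_gt0// ltr_wpDl// !mulr_ge0.
(* An infinite initial norm makes the claim trivial; otherwise the scalar
   recursion runs in the real numbers. *)
have [->|Wfin] := eqVneq W0 +oo%E; first by rewrite gt0_muley ?lte_fin// leey.
have [w wW] : exists w, W0 = w%:E.
  by exists (fine W0); rewrite fineK// ge0_fin_numE// lt_neqAle Wfin leey.
have w0 : 0 <= w by rewrite -lee_fin -wW.
pose u t := \sum_k a k t.
have mu_ : measurable_fun setT u by exact: measurable_sum.
have u0 s : 0 <= u s by rewrite sumr_ge0.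
pose U b := window p b (b + h) u.
have Uinit b : 0 <= b <= dp -> (U b <= (C0 * w)%:E)%E.
  move=> /andP[b0 bdp].
  apply: (@le_trans _ _ (\sum_k window p 0 (tau k + n%:R * delta)%R (a k))%E).
    apply: le_trans (Np_sum _ _ p1 _); last by move=> k; exact: restrict_measurable.
    apply: Np_le => //; first exact: restrict_measurable.
      by apply: measurable_sum => k; exact: restrict_measurable.
    apply: ae_all => s.
    rewrite patchE mem_setE in_itv/=; case: ifPn => [/andP[bs sb]|_]; last first.
      by rewrite normr0.
    rewrite ger0_norm// ger0_norm; last first.
      by rewrite sumr_ge0// => k _; rewrite patchE; case: ifP.
    apply: ler_sum => k _; rewrite patchE mem_setE in_itv/= ifT//.
    by have /andP[? ?] := tau_bounds k; apply/andP; split; lra.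
  apply: (@le_trans _ _ (\sum_(k < N) ((1 + N%:R) ^+ n)%:E * W0)%E).
    by apply: lee_sum => k _; exact: window_growth tau_bounds rho01 _ ha _ _.
  rewrite sume_const_ge0 ?muleA -?EFinM ?wW -?EFinM//.
  by rewrite lee_fin mulr_ge0// exprn_ge0// addr_ge0.
have Urec b : dp <= b -> (U b <= \sum_(q in @lattice_level N m m)
    (N%:R * rho ^+ m)%:E * U (b - lattice_time tau q)%R)%E.
  by move=> hb; exact: (window_recursion p1 tau_bounds rho01 h0 ha hb).
have Udecay := @delay_recursion_le R _ _ (fun q => q \in @lattice_level N m m)
  (lattice_time tau) (N%:R * rho ^+ m) (m%:R * delta) dp (C0 * w) U.
have {}Udecay j b : j%:R * dp <= b -> 0 <= b -> (U b <= (2^-1 ^+ j * (C0 * w))%:E)%E.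
  apply: Udecay Urec Uinit j b => //.
  - by rewrite mulr_gt0// ltr0n.
  - exact: ltW.
  - by rewrite mulr_ge0 ?exprn_ge0.
  - by rewrite mulr_ge0.
  - move=> q /=; rewrite inE => /eqP qm.
    have := lattice_time_le tau_bounds q; have := lattice_time_ge tau_bounds q.
    by rewrite qm => -> ->.
  - apply: le_trans mbound; rewrite ler_wpM2l ?mulr_ge0 ?exprn_ge0//.
    rewrite sumr_const -natrX ler_nat; apply: leq_trans (max_card _) _.
    by rewrite card_ffun !card_ord.
have Ut : (U t <= (2 * expR (- (ln 2 / dp) * t) * (C0 * w))%:E)%E.
  apply: (@le_trans _ _ (2^-1 ^+ Num.truncn (t / dp) * (C0 * w))%:E).
    apply: Udecay => //; rewrite -ler_pdivlMr// truncn_le divr_ge0//.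
    exact: ltW.
  by rewrite lee_fin ler_wpM2r ?mulr_ge0// half_power_le_exp.
apply: (@le_trans _ _ (\sum_(k < N) U t)%E).
  apply: lee_sum => k _; apply: window_le => //; apply: ae_all => s /andP[ts st].
  split.
    by have /andP[? ?] := tau_bounds k; apply/andP; split; lra.
  by rewrite /u (bigD1 k)//= lerDl sumr_ge0.
rewrite sume_const_ge0; last exact: Np_ge0.
apply: (@le_trans _ _ (N%:R%:E * (2 * expR (- (ln 2 / dp) * t) * (C0 * w))%:E)%E).
  by rewrite lee_wpmul2l// lee_fin.
rewrite wW -!EFinM lee_fin.
set e := expR _; have e0 : 0 <= e by exact: expR_ge0.
rewrite [leRHS](_ : _ = N%:R * (2 * e * (C0 * w)) + e * w); last by ring.
by rewrite lerDl mulr_ge0.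
Qed.

End decay.

(** * Loss of energy at the nodes *)

Section boundary.
Context {R : realType} {N : nat}.
Implicit Types (A : 'M[R]_(N + N)) (f g : 'I_N -> R).

(** The quadratic form of A + A^T is twice that of A. *)
Lemma loewner_quadratic A (alpha : R) (w : 'cV[R]_(N + N)) :
  loewner_ge (A + A^T) (alpha *: 1%:M) ->
  alpha * \sum_j w j ord0 ^+ 2 <= 2 * \sum_j w j ord0 * (A *m w) j ord0.
Proof.
move=> [_ /(_ w)].
have -> : w^T *m (A + A^T - alpha *: 1%:M) *m w =
  w^T *m A *m w + (w^T *m A *m w)^T - alpha *: (w^T *m w).
  rewrite mulmxBr mulmxDr mulmxBl mulmxDl !trmx_mul trmxK -!mulmxA.
  by rewrite -scalemxAl mul1mx -scalemxAr.
have ww : (w^T *m w) ord0 ord0 = \sum_j w j ord0 ^+ 2.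
  by rewrite mxE; apply: eq_bigr => j _; rewrite mxE.
have wAw : (w^T *m A *m w) ord0 ord0 = \sum_j w j ord0 * (A *m w) j ord0.
  by rewrite -mulmxA mxE; apply: eq_bigr => j _; rewrite [w^T _ _]mxE.
move: (w^T *m A *m w) wAw (w^T *m w) ww => X hX Y hY.
rewrite !mxE hX hY; lra.
Qed.

Lemma mulmx_entry_bound A (M s : R) (w : 'cV[R]_(N + N)) j :
  (forall i k, `|A i k| <= M) -> (forall k, `|w k ord0| <= s) ->
  `|(A *m w) j ord0| <= (N + N)%:R * M * s.
Proof.
move=> AM ws; rewrite mxE; apply: le_trans (ler_norm_sum _ _ _) _.
apply: (@le_trans _ _ (\sum_(k < N + N) M * s)).
  by apply: ler_sum => k _; rewrite normrM ler_pM.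
by rewrite sumr_const card_ord -[leLHS]mulr_natl mulrA.
Qed.

(** Let w be the vector of boundary currents, Z the incoming and Y the
    outgoing energy. The power w^T A w equals Z - Y, because (f + g) K (f - g)
    = K (f^2 - g^2) at each end, and it is at least (alpha/2) |w|^2.
    Conversely the incoming waves are linear combinations of w and A w, so
    that Z <= C |w|^2 where C depends on K and on the bound of A. Therefore Y
    <= (1 - alpha/(2C)) Z. *)
Lemma boundary_contraction (alpha M : R) (K : 'I_N -> R) : 0 < alpha ->
  (forall k, 0 < K k) ->
  exists rho : R, 0 <= rho < 1 /\ forall A,
  loewner_ge (A + A^T) (alpha *: 1%:M) -> (forall j k, `|A j k| <= M) ->
  forall f0 g0 f1 g1 : 'I_N -> R,
  col_mx (\col_k (f0 k + g0 k)) (\col_k (f1 k + g1 k)) =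
    A *m col_mx (- \col_k (K k * (f0 k - g0 k))) (\col_k (K k * (f1 k - g1 k))) ->
  \sum_k K k * (f0 k ^+ 2 + g1 k ^+ 2) <=
    rho ^+ 2 * \sum_k K k * (g0 k ^+ 2 + f1 k ^+ 2).
Proof.
move=> alpha0 K0; pose m := (N + N)%:R * M.
(* The term alpha ensures alpha <= C, so that 1 - alpha/(2C) is nonnegative
   and has a square root. *)
pose C := \sum_k K k * (m ^+ 2 + (K k)^-1 ^+ 2) + alpha.
have C1 : alpha <= C.
  rewrite lerDr sumr_ge0// => k _.
  by rewrite mulr_ge0 ?(ltW (K0 k))// addr_ge0// sqr_ge0.
have C0 : 0 < C by exact: lt_le_trans C1.
have r0 : 0 <= 1 - alpha / (2 * C).
  by rewrite subr_ge0 ler_pdivrMr ?mulr_gt0//; lra.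
have r1 : 1 - alpha / (2 * C) < 1.
  by rewrite ltrBlDr ltrDl divr_gt0// mulr_gt0.
exists (Num.sqrt (1 - alpha / (2 * C))); split.
  by rewrite sqrtr_ge0/= -[ltRHS]sqrtr1 ltr_sqrt.
move=> A Adiss AM f0 g0 f1 g1 E; rewrite sqr_sqrtr//.
set w := (X in A *m X) in E.
have wl k : w (lshift N k) ord0 = - (K k * (f0 k - g0 k)).
  by rewrite /w col_mxEu !mxE.
have wr k : w (rshift N k) ord0 = K k * (f1 k - g1 k).
  by rewrite /w col_mxEd !mxE.
have Al k : (A *m w) (lshift N k) ord0 = f0 k + g0 k.
  by rewrite -E col_mxEu !mxE.
have Ar k : (A *m w) (rshift N k) ord0 = f1 k + g1 k.
  by rewrite -E col_mxEd !mxE.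
pose S := \sum_j w j ord0 ^+ 2.
have S0 : 0 <= S by rewrite sumr_ge0// => j _; exact: sqr_ge0.
have wS j : `|w j ord0| <= Num.sqrt S.
  rewrite -sqrtr_sqr ler_wsqrtr// /S (bigD1 j)//= lerDl sumr_ge0// => i _.
  exact: sqr_ge0.
have AS j : ((A *m w) j ord0) ^+ 2 <= m ^+ 2 * S.
  have := mulmx_entry_bound j AM wS; rewrite -/m => h.
  have hm : 0 <= m * Num.sqrt S by apply: le_trans h.
  rewrite -(sqr_sqrtr S0) -exprMn -real_normK ?num_real//.
  by rewrite ler_pXn2r// nnegrE.
have wS2 j : (w j ord0) ^+ 2 <= S.
  by rewrite /S (bigD1 j)//= lerDl sumr_ge0// => i _; exact: sqr_ge0.
set Y := leLHS; set Z := \sum_k K k * (g0 k ^+ 2 + f1 k ^+ 2).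
have YZ : \sum_j w j ord0 * (A *m w) j ord0 = Z - Y.
  rewrite big_split_ord/= -sumrB -big_split/=; apply: eq_bigr => k _.
  by rewrite wl wr Al Ar; ring.
have diss := loewner_quadratic w Adiss.
rewrite YZ -/S in diss.
have ZC : Z <= C * S.
  rewrite mulrDl; apply: (@le_trans _ _ ((\sum_k K k * (m ^+ 2 + (K k)^-1 ^+ 2)) * S)).
    rewrite mulr_suml; apply: ler_sum => k _; rewrite -mulrA ler_wpM2l ?(ltW (K0 k))//.
    have a1 := AS (lshift N k); have a2 := AS (rshift N k).
    have b1 := wS2 (lshift N k); have b2 := wS2 (rshift N k).
    have Kn : K k != 0 by rewrite gt_eqF.
    have c1 : (f0 k - g0 k) ^+ 2 <= (K k)^-1 ^+ 2 * S.
      have -> : (f0 k - g0 k) ^+ 2 = (K k)^-1 ^+ 2 * (w (lshift N k) ord0) ^+ 2.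
        by rewrite wl; field.
      by rewrite ler_wpM2l// sqr_ge0.
    have c2 : (f1 k - g1 k) ^+ 2 <= (K k)^-1 ^+ 2 * S.
      have -> : (f1 k - g1 k) ^+ 2 = (K k)^-1 ^+ 2 * (w (rshift N k) ord0) ^+ 2.
        by rewrite wr; field.
      by rewrite ler_wpM2l// sqr_ge0.
    rewrite Al in a1; rewrite Ar in a2.
    have := sqr_ge0 (f0 k + g0 k + (f0 k - g0 k)).
    have := sqr_ge0 (f1 k + g1 k - (f1 k - g1 k)).
    nra.
  by rewrite lerDl mulr_ge0// ltW.
suff : alpha / (2 * C) * Z <= Z - Y by rewrite mulrBl mul1r; lra.
apply: (@le_trans _ _ (alpha / 2 * S)); last lra.
rewrite invfM mulrA -mulrA ler_pM2l ?divr_gt0//.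
by rewrite ler_pdivrMl.
Qed.

End boundary.

(** * Smooth bump functions *)

Section smooth_functions.
Context {R : realType}.
Implicit Types (f g : R -> R) (n : nat).

(** Differentiability n times, by recursion on n, so that the closure
    properties follow by induction. *)
Fixpoint ndiff n f : Prop :=
  if n is m.+1 then exists g, (forall x : R, is_derive x 1 f (g x)) /\ ndiff m g
  else True.

Definition infdiff f : Prop := forall n, ndiff n f.

Lemma ndiffS n f : ndiff n.+1 f -> ndiff n f.
Proof.
elim: n f => [//|n ih] f [g [fg gn]]; exists g; split=> //.
exact: ih.
Qed.

Lemma ndiff_cst n (c : R) : ndiff n (fun=> c).
Proof.
elim: n c => [//|n ih] c; exists (fun=> 0); split => // x.
exact: is_derive_cst.
Qed.

Lemma ndiff_add n f g : ndiff n f -> ndiff n g -> ndiff n (fun x => f x + g x).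
Proof.
elim: n f g => [//|n ih] f g [f' [df nf]] [g' [dg ng]].
exists (fun x => f' x + g' x); split; last exact: ih.
move=> x; exact: is_deriveD.
Qed.

Lemma ndiff_mul n f g : ndiff n f -> ndiff n g -> ndiff n (fun x => f x * g x).
Proof.
elim: n f g => [//|n ih] f g hf hg; have := hf; have := hg.
move=> [g' [dg ng]] [f' [df nf]].
exists (fun x => f x * g' x + g x * f' x); split.
  move=> x; exact: is_deriveM.
by apply: ndiff_add; apply: ih => //; exact: ndiffS.
Qed.

Lemma ndiff_affine n f (a b : R) : ndiff n f -> ndiff n (f \o affine a b).
Proof.
elim: n f => [//|n ih] f [f' [df nf]].
exists (fun x => a * (f' \o affine a b) x); split; last first.
  by apply: ndiff_mul; [exact: ndiff_cst|exact: ih].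
move=> x.
have da : is_derive x 1 (affine a b) a.
  rewrite /affine.
  have : is_derive x 1 (fun x : R => a * x + b) (a *: 1 + 0).
    exact: is_deriveD.
  by rewrite addr0 /GRing.scale/= mulr1.
rewrite mulrC /=; exact: is_derive1_comp.
Qed.

(** The derivatives provided for the various n agree, by uniqueness of the
    derivative. *)
Lemma infdiff_derive f : infdiff f ->
  exists g, (forall x : R, is_derive x 1 f (g x)) /\ infdiff g.
Proof.
move=> hf; have [g [dg _]] := hf 1%N.
exists g; split=> // n; have [g' [dg' ng']] := hf n.+1.
suff -> : g = g' by [].
apply/funext => x; have := dg x; have := dg' x.
by move=> [_ <-] [_ <-].
Qed.

Lemma is_derive_continuous f g : (forall x : R, is_derive x 1 f (g x)) -> continuous f.
Proof.
by move=> df x; apply/differentiable_continuous/derivable1_diffP; have [] := df x.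
Qed.

Lemma infdiff_continuous f : infdiff f -> continuous f.
Proof. by move=> hf; have [g [dg _]] := infdiff_derive hf; exact: is_derive_continuous dg. Qed.

(** The functions x^(-n) exp(-1/x) for x > 0, extended by zero. The derivative
    of each of them is a combination of two others, also at 0, which makes
    exp(-1/x) smooth. *)
Definition flat n (x : R) : R := if 0 < x then x^-1 ^+ n * expR (- x^-1) else 0.

Lemma flat_ge0 n x : 0 <= flat n x.
Proof.
rewrite /flat; case: ifP => // x0.
by rewrite mulr_ge0 ?expR_ge0// exprn_ge0// invr_ge0 ltW.
Qed.

(** The exponential series gives exp(y) >= y^(n+2)/(n+2)!, used at y = 1/x.
    The exponent 2 is what the derivative at 0 needs. *)
Lemma flat_bound n x : 0 < x -> flat n x <= n.+2`!%:R * x ^+ 2.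
Proof.
move=> x0; rewrite /flat x0.
have y0 : 0 < x^-1 by rewrite invr_gt0.
have f0 : 0 < (n.+2`!%:R : R) by rewrite ltr0n fact_gt0.
have := @expR_ge1Dxn R x^-1 n.+1 (ltW y0).
move=> h; have {}h : x^-1 ^+ n.+2 / n.+2`!%:R <= expR x^-1.
  by apply: le_trans h; rewrite lerDr.
rewrite expRN ler_pdivrMr ?expR_gt0//.
rewrite ler_pdivrMr// in h.
apply: (@le_trans _ _ (x ^+ 2 * x^-1 ^+ n.+2)).
  by rewrite -[n.+2]addn2 exprD mulrCA -exprMn divff ?expr1n ?mulr1// gt_eqF.
have -> : n.+2`!%:R * x ^+ 2 * expR x^-1 = x ^+ 2 * (expR x^-1 * n.+2`!%:R) by ring.
by rewrite ler_wpM2l// exprn_ge0// ltW.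
Qed.

Lemma flat_derive n (x : R) : is_derive x 1 (flat n) (flat n.+2 x - n%:R * flat n.+1 x).
Proof.
have [x0|x0|->] := ltgtP x 0.
- rewrite {2 3}/flat ltNge (ltW x0)/= mulr0 subr0.
  apply: (@near_eq_is_derive _ _ _ (cst 0)).
  near=> y; rewrite /flat ltNge (_ : (y <= 0) = true)//.
  apply/ltW; near: y; exact: lt_nbhsl.
- rewrite {2 3}/flat x0.
  have xn : x != 0 by rewrite gt_eqF.
  have dV : is_derive x 1 (fun y : R => y^-1) (- x ^- 2).
    have := @is_deriveV R (@id R) x 1 1 xn (is_derive_id x 1).
    by rewrite /GRing.scale/= mulr1.
  have dVn : is_derive x 1 (fun y : R => y^-1 ^+ n) (n%:R * x^-1 ^+ n.-1 * (- x ^- 2)).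
    have := @is_deriveX _ _ (fun y : R => y^-1) n x 1 _ dV.
    rewrite [X in is_derive _ _ X](_ : _ = (fun y : R => y^-1 ^+ n))//.
    by apply/funext => y; rewrite exprfctE.
  have dE : is_derive x 1 (fun y : R => expR (- y^-1)) (x ^- 2 * expR (- x^-1)).
    have dN : is_derive x 1 (fun y : R => - y^-1) (x ^- 2).
      by have := is_deriveN dV; rewrite opprK.
    rewrite mulrC; exact: (@is_derive1_comp _ expR (fun y : R => - y^-1)).
  have D := is_deriveM dVn dE.
  have E : x^-1 ^+ n *: (x ^- 2 * expR (- x^-1)) +
      expR (- x^-1) *: (n%:R * x^-1 ^+ n.-1 * (- x ^- 2)) =
      x^-1 ^+ n.+2 * expR (- x^-1) - n%:R * (x^-1 ^+ n.+1 * expR (- x^-1)).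
    rewrite /GRing.scale/= -exprVn; case: n {dVn D} => [|n]/=.
      by rewrite !expr0 !exprS expr0; ring.
    by rewrite !exprS; ring.
  rewrite -E; apply: near_eq_is_derive D.
  near=> y; rewrite /flat (_ : (0 < y) = true)//.
  near: y; exact: lt_nbhsr.
- rewrite {2 3}/flat ltxx mulr0 subr0.
  have f0 : flat n 0 = 0 by rewrite /flat ltxx.
  suff h0 : h^-1 *: ((flat n \o shift 0) (h *: (1 : R)) - flat n 0) @[h --> 0^'] --> (0 : R).
    apply: DeriveDef; first by apply/cvg_ex; exists 0.
    by apply/cvg_lim.
  pose C : R := n.+2`!%:R.
  have C0 : 0 < C by rewrite ltr0n fact_gt0.
  apply/cvgrPdist_le => /= e e0; near=> h.
  rewrite f0 subr0 sub0r normrN addr0 /GRing.scale/= mulr1 normrM.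
  have hn0 : h != 0 by near: h; exact: nbhs_dnbhs_neq.
  have hn : `|h| <= e / C.
    near: h; apply: dnbhs0_le; exact: divr_gt0.
  rewrite (ger0_norm (flat_ge0 _ _)) normfV ler_pdivrMl ?normr_gt0//.
  have [h0|h0] := ltP 0 h; last first.
    by rewrite {1}/flat ltNge h0/= mulr_ge0// ltW.
  apply: le_trans (flat_bound n h0) _; rewrite -/C (ger0_norm (ltW h0)).
  rewrite (ger0_norm (ltW h0)) in hn; rewrite ler_pdivlMr// in hn.
  rewrite expr2 mulrCA; apply: ler_wpM2l; first exact: ltW.
  by rewrite mulrC.
Unshelve. all: by end_near. Qed.

Lemma flat_ndiff m n : ndiff m (flat n).
Proof.
elim: m n => [//|m ih] n.
exists (fun x => flat n.+2 x + (- n%:R) * flat n.+1 x); split.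
  by move=> x; rewrite mulNr; exact: flat_derive.
apply: ndiff_add => //; apply: ndiff_mul => //; exact: ndiff_cst.
Qed.

Lemma infdiff_mul f g : infdiff f -> infdiff g -> infdiff (fun x => f x * g x).
Proof. by move=> hf hg n; exact: ndiff_mul. Qed.

Lemma infdiff_affine f (a b : R) : infdiff f -> infdiff (f \o affine a b).
Proof. by move=> hf n; exact: ndiff_affine. Qed.

(** As j grows, the slopes of both factors concentrate at the end points and
    the product tends to the indicator of ]p, q[. *)
Definition bump (p q : R) (j : nat) (x : R) : R :=
  flat 0 (j.+1%:R * (x - p)) * flat 0 (j.+1%:R * (q - x)).

Lemma bump_infdiff p q j : infdiff (bump p q j).
Proof.
have -> : bump p q j = fun x =>
    (flat 0 \o affine j.+1%:R (- j.+1%:R * p)) x *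
    (flat 0 \o affine (- j.+1%:R) (j.+1%:R * q)) x.
  by apply/funext => x; rewrite /bump /= /affine; congr (flat _ _ * flat _ _); ring.
by apply: infdiff_mul; apply: infdiff_affine => n; exact: flat_ndiff.
Qed.

Lemma flat0_le1 x : 0 <= flat 0 x <= 1.
Proof.
rewrite flat_ge0/= /flat; case: ifP => // x0.
by rewrite expr0 mul1r -[leRHS]expR0 ler_expR oppr_le0 invr_ge0 ltW.
Qed.

Lemma bump_bounds p q j x : 0 <= bump p q j x <= 1.
Proof.
rewrite /bump; set a := flat _ _; set b := flat _ _.
have /andP[a0 a1] : 0 <= a <= 1 by exact: flat0_le1.
have /andP[b0 b1] : 0 <= b <= 1 by exact: flat0_le1.
by rewrite mulr_ge0//= mulr_ile1.
Qed.

Lemma bump_out p q j x : ~~ (p < x < q) -> bump p q j x = 0.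
Proof.
rewrite negb_and -!leNgt /bump /flat => /orP[xp|qx].
  by rewrite pmulr_rgt0// subr_gt0 ltNge xp mul0r.
by rewrite (pmulr_rgt0 (q - x))// subr_gt0 (ltNge x) qx mulr0.
Qed.

Lemma flat0_cvg (y : R) : 0 < y -> flat 0 (j.+1%:R * y) @[j --> \oo] --> (1 : R).
Proof.
move=> y0.
have -> : (fun j => flat 0 (j.+1%:R * y)) = (fun j => expR (- (j.+1%:R^-1 * y^-1))).
  by apply/funext => j; rewrite /flat mulr_gt0// expr0 mul1r invfM.
rewrite -[X in _ --> X](@expR0 R); apply: continuous_cvg.
  exact: continuous_expR.
rewrite -[X in _ --> X]oppr0; apply: cvgN.
rewrite -[X in _ --> X](mul0r y^-1); apply: cvgMr_tmp.
exact: cvg_harmonic.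
Qed.

Lemma bump_cvg p q x : bump p q j x @[j --> \oo] --> (\1_(`]p, q[%classic) x : R).
Proof.
rewrite indicE mem_setE in_itv/=; case: (boolP (p < x < q)) => [/andP[px xq]|h].
  rewrite -[X in _ --> X](mulr1 1); apply: cvgM; apply: flat0_cvg; lra.
rewrite (_ : (fun j => bump p q j x) = fun=> 0); first exact: cvg_cst.
by apply/funext => j; exact: bump_out.
Qed.

End smooth_functions.

(** * Test functions adapted to characteristics *)

Section wave_tests.
Context {R : realType}.
Local Notation mu := (@lebesgue_measure R).
Variable c : R.
Implicit Types (f g a b : R -> R) (phi : R * R -> R).

Lemma is_derive_dir f (x w d : R) : is_derive x 1 f d -> is_derive x w f (w * d).
Proof.
move=> [df dE]; have /derivable1_diffP hd := df.
apply: DeriveDef; first exact: diff_derivable.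
rewrite deriveE// -[X in 'd f x X](mulr1 w) -[w * 1]/(w *: (1 : R)) linearZ/=.
by rewrite -deriveE// dE.
Qed.

(** Chain rule for a function of one variable composed with a linear form. *)
Lemma is_derive_linear f (l : R * R -> R) (z v : R * R) (d : R) :
  (forall h : R, l (h *: v + z) = h * l v + l z) ->
  is_derive (l z) 1 f d -> is_derive z v (f \o l) (l v * d).
Proof.
move=> lE df.
have [D DE] := is_derive_dir (l v) df.
have E : (fun h => h^-1 *: (((f \o l) \o shift z) (h *: v) - (f \o l) z)) =
    (fun h => h^-1 *: ((f \o shift (l z)) (h *: l v) - f (l z))).
  by apply/funext => h; rewrite /= lE.
by apply: DeriveDef; [rewrite /derivable E|rewrite /derive E].
Qed.

(** In characteristic coordinates this is the product b(t) a(xi). The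
    transport operator differentiates the factor b alone, see
    [wave_test_transport]. *)
Definition wave_test b a : R * R -> R := fun z => b z.1 * a (z.2 - c * z.1).

(** A class of functions that is stable under both partial derivatives, used
    to obtain all the iterated partial derivatives of a product. *)
Inductive wave_sum : (R * R -> R) -> Prop :=
| wave_sum_test b a : infdiff b -> infdiff a -> wave_sum (wave_test b a)
| wave_sum_add phi psi : wave_sum phi -> wave_sum psi ->
    wave_sum (fun z => phi z + psi z).

Lemma wave_test_derive a b a' b' z v : (forall x : R, is_derive x 1 a (a' x)) ->
  (forall x : R, is_derive x 1 b (b' x)) ->
  is_derive z v (wave_test b a)
    (v.1 * wave_test b' a z + (v.2 - c * v.1) * wave_test b a' z).
Proof.
move=> da db.
have d1 : is_derive z v (b \o fst) (v.1 * b' z.1).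
  by apply: is_derive_linear => // h.
have d2 : is_derive z v (a \o (fun z => z.2 - c * z.1))
    ((v.2 - c * v.1) * a' (z.2 - c * z.1)).
  apply: (@is_derive_linear a (fun z => z.2 - c * z.1)) => // h.
  by rewrite /= /GRing.scale/=; ring.
have := is_deriveM d1 d2.
rewrite (_ : _ *: _ + _ *: _ = v.1 * wave_test b' a z + (v.2 - c * v.1) * wave_test b a' z)//.
by rewrite /wave_test /GRing.scale/=; ring.
Qed.

Lemma infdiff_scale (k : R) f : infdiff f -> infdiff (fun x => k * f x).
Proof. by move=> hf; apply: infdiff_mul => // n; exact: ndiff_cst. Qed.

Lemma wave_test_dt a b a' b' : (forall x : R, is_derive x 1 a (a' x)) ->
  (forall x : R, is_derive x 1 b (b' x)) ->
  dt (wave_test b a) = fun z => wave_test b' a z - c * wave_test b a' z.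
Proof.
move=> da db; apply/funext => z; rewrite /dt.
by have [_ ->] := wave_test_derive z (1, 0) da db; rewrite /=; ring.
Qed.

Lemma wave_test_dx a b a' b' : (forall x : R, is_derive x 1 a (a' x)) ->
  (forall x : R, is_derive x 1 b (b' x)) ->
  dx (wave_test b a) = wave_test b a'.
Proof.
move=> da db; apply/funext => z; rewrite /dx.
by have [_ ->] := wave_test_derive z (0, 1) da db; rewrite /=; ring.
Qed.

Lemma wave_sum_derive phi v : wave_sum phi ->
  exists psi, wave_sum psi /\ forall z, is_derive z v phi (psi z).
Proof.
elim=> [b a hb ha|f g _ [f' [wf df]] _ [g' [wg dg]]].
  have [a' [da ha']] := infdiff_derive ha; have [b' [db hb']] := infdiff_derive hb.
  exists (fun z => wave_test (fun t => v.1 * b' t) a z +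
                   wave_test (fun t => (v.2 - c * v.1) * b t) a' z); split.
    by apply: wave_sum_add; apply: wave_sum_test => //; exact: infdiff_scale.
  move=> z; have := wave_test_derive z v da db.
  by rewrite /wave_test !mulrA.
exists (fun z => f' z + g' z); split; first exact: wave_sum_add.
by move=> z; exact: is_deriveD.
Qed.

Lemma wave_test_continuous a b : continuous a -> continuous b ->
  continuous (wave_test b a).
Proof.
move=> ca cb z; apply: cvgM.
  by apply: continuous_comp; [exact: cvg_fst|exact: cb].
apply: (@continuous_comp _ _ _ (fun z : R * R => z.2 - c * z.1) a); last exact: ca.
apply: cvgB; first exact: cvg_snd.
by apply: cvgM; [exact: cvg_cst|exact: cvg_fst].
Qed.

Lemma wave_sum_continuous phi : wave_sum phi -> continuous phi.
Proof.
elim=> [b a hb ha|f g _ cf _ cg].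
  by apply: wave_test_continuous; exact: infdiff_continuous.
by move=> z; apply: cvgD; [exact: cf|exact: cg].
Qed.

Lemma wave_sum_iterated s phi : wave_sum phi -> wave_sum (iterated_partial s phi).
Proof.
move=> wp; elim: s => [//|d s ih] /=.
case: d.
  have [psi [wpsi dpsi]] := wave_sum_derive (0, 1) ih.
  rewrite (_ : dx _ = psi)//; apply/funext => z.
  by rewrite /dx; have [_ ->] := dpsi z.
have [psi [wpsi dpsi]] := wave_sum_derive (1, 0) ih.
rewrite (_ : dt _ = psi)//; apply/funext => z.
by rewrite /dt; have [_ ->] := dpsi z.
Qed.

Lemma wave_sum_smooth phi : wave_sum phi -> smooth phi.
Proof.
move=> wp s; have ws := wave_sum_iterated s wp.
split; first exact: wave_sum_continuous.
move=> z; have [p1 [_ d1]] := wave_sum_derive (1, 0) ws.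
have [p2 [_ d2]] := wave_sum_derive (0, 1) ws.
by have [? _] := d1 z; have [? _] := d2 z.
Qed.

(** Boxes in characteristic coordinates that lie over Omega. *)
Definition char_box (t0 t1 x0 x1 : R) : Prop :=
  forall t x, t0 <= t <= t1 -> x0 <= x <= x1 -> 0 < t /\ 0 < x + c * t < 1.

Lemma wave_test_test_function a b t0 t1 x0 x1 : infdiff a -> infdiff b ->
  char_box t0 t1 x0 x1 ->
  (forall t, ~~ (t0 <= t <= t1) -> b t = 0) ->
  (forall x, ~~ (x0 <= x <= x1) -> a x = 0) -> test_function (wave_test b a).
Proof.
move=> ha hb box b0 a0.
pose S : set (R * R) := (fst @^-1` `[t0, t1]) `&`
  ((fun z => z.2 - c * z.1) @^-1` `[x0, x1]).
have S_closed : closed S.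
  apply: closedI.
    apply: preimage_closed; last exact: interval_closed.
    by move=> z _; exact: cvg_fst.
  apply: preimage_closed; last exact: interval_closed.
  move=> z _; apply: cvgB; first exact: cvg_snd.
  by apply: cvgM; [exact: cvg_cst|exact: cvg_fst].
have SO : S `<=` @Omega R.
  move=> [t x] [] /=; rewrite !in_itv/= => ht hx.
  have [tp /andP[h1 h2]] := box _ _ ht hx.
  by rewrite /Omega; split; rewrite /= in_itv/= ?andbT//; apply/andP; split; lra.
have clS : closure [set z | wave_test b a z != 0] `<=` S.
  rewrite closureE; apply: smallest_sub => //.
  move=> [t x] /= h; split => /=; rewrite in_itv/=.
    by apply: contraNT h => /b0; rewrite /wave_test/= => ->; rewrite mul0r.
  by apply: contraNT h => /a0; rewrite /wave_test/= => ->; rewrite mulr0.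
split.
- exact/wave_sum_smooth/wave_sum_test.
- apply: (@subclosed_compact _ _ ((`[t0, t1]%classic : set R) `*` (`[0, 1]%classic : set R))).
  + exact: closed_closure.
  + by apply: compact_setX; exact: segment_compact.
  + move=> [t x] /clS Sz; have [/= _] := SO _ Sz; move: Sz => [/= h _].
    by rewrite /= [x \in _]in_itv/= => /andP[/ltW x1' /ltW x2']; split=> //=; apply/andP.
- exact: subset_trans SO.
Qed.

Lemma wave_test_transport a b a' b' : (forall x : R, is_derive x 1 a (a' x)) ->
  (forall x : R, is_derive x 1 b (b' x)) ->
  forall z, dt (wave_test b a) z + c * dx (wave_test b a) z = wave_test b' a z.
Proof.
move=> da db z; rewrite (wave_test_dt da db) (wave_test_dx da db); ring.
Qed.

End wave_tests.

Section primitive.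
Context {R : realType}.
Local Notation mu := (@lebesgue_measure R).

Lemma supported_integrable (f : R -> R) (p q : R) : continuous f ->
  (forall x, ~~ (p < x < q) -> f x = 0) -> mu.-integrable setT (EFin \o f).
Proof.
move=> cf f0.
have fE : f = f \_ `[p, q].
  apply/funext => x; rewrite patchE mem_setE in_itv/=; case: ifPn => // h.
  apply: f0; apply: contra h => /andP[? ?]; apply/andP; split; exact: ltW.
rewrite fE -restrict_EFin; apply/(integrable_mkcond _ _).1 => //.
apply: continuous_compact_integrable; first exact: segment_compact.
exact: continuous_subspaceT.
Qed.

(** The primitive from -oo vanishes before p, and after q it is the total
    integral of psi, which is zero. *)
Lemma primitive_infdiff (psi : R -> R) (p q : R) : infdiff psi ->
  (forall x, ~~ (p < x < q) -> psi x = 0) -> \int[mu]_x psi x = 0 ->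
  exists b, [/\ infdiff b, forall x : R, is_derive x 1 b (psi x) &
    forall x, ~~ (p <= x <= q) -> b x = 0].
Proof.
move=> hpsi psi0 ipsi.
have cpsi := infdiff_continuous hpsi.
have fi := supported_integrable cpsi psi0.
pose b x := \int[mu]_(t in [set` Interval -oo%O (BRight x)]) psi t.
have db (x : R) : is_derive x 1 b (psi x).
  have xx : x < x + 1 by rewrite ltrDl.
  have fi' : mu.-integrable `]-oo, (x + 1)] (EFin \o psi) by exact: integrableS fi.
  have Nyx : ((-oo%O : itv_bound R) < BRight x)%E by exact: ltNyr.
  have [d1 d2] := @continuous_FTC1 R psi -oo%O x (x + 1) xx fi' Nyx (cpsi x).
  by apply: DeriveDef; [exact: d1|rewrite -derive1E; exact: d2].
exists b; split=> //.
  by case=> [//|n]; exists psi; split => //; exact: hpsi.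
move=> x; rewrite negb_and -!ltNge => /orP[xp|qx].
  rewrite /b /Rintegral integral0_eq// => t; rewrite /= in_itv/= => tx.
  congr EFin.
  by apply: psi0; rewrite negb_and -!leNgt; apply/orP; left; lra.
rewrite -ipsi /b /Rintegral integral_mkcond; congr fine; apply: eq_integral => t _.
rewrite patchE mem_setE in_itv/=; case: ifPn => //; rewrite -ltNge => tx.
by rewrite psi0// negb_and -!leNgt; apply/orP; right; lra.
Qed.

End primitive.

(** * Tools of integration *)

Section zero_primitive.
Context {R : realType}.
Local Notation mu := (@lebesgue_measure R).

(** The primitive of h is continuous and vanishes at rational points, hence
    everywhere, and by Lebesgue differentiation its derivative is h almost
    everywhere. With rational end points, only countably many null sets have
    to be discarded before this is applied. *)
Lemma zero_of_rational_primitive (h : R -> R) (p q : R) : p < q ->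
  mu.-integrable setT (EFin \o h) ->
  (forall y : rat, p < ratr y < q -> \int[mu]_(t in `]p, (ratr y : R)[) h t = 0) ->
  {ae mu, forall x, p < x < q -> h x = 0}.
Proof.
move=> pq hi h0.
pose F x := \int[mu]_(t in [set` Interval (BLeft p) (BRight x)]) h t.
have hiS (i : interval R) : mu.-integrable [set` i] (EFin \o h) by exact: integrableS hi.
have Frat (y : rat) : p < ratr y < q -> F (ratr y) = 0.
  move=> yy; rewrite -[RHS](h0 y yy) /F.
  by rewrite -Rintegral_itv_obnd_cbnd// -Rintegral_itv_bndo_bndc.
have Fcont : {within `[p, q], continuous F}.
  exact: (@parameterized_integral_continuous R p q h (ltW pq) (hiS _)).
have F0 x : p < x < q -> F x = 0.
  move=> /andP[px xq]; apply/eqP; apply: contraT => Fx.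
  have Fx0 : 0 < `|F x| by rewrite normr_gt0.
  have cF : {for x, continuous F}.
    by apply: (within_continuous_continuous pq Fcont); rewrite in_itv/= px.
  have : \forall y \near x, [/\ p < y, y < q & F y != 0].
    near=> y; split.
    - by near: y; exact: lt_nbhsr.
    - by near: y; exact: lt_nbhsl.
    - near: y; move: cF => /cvgrPdist_lt /(_ _ Fx0); apply: filterS => y.
      by apply: contraTneq => ->; rewrite subr0 ltxx.
  move=> [e /= e0 he].
  have /rat_in_itvoo[r] : x - e < x + e by lra.
  rewrite in_itv/= => /andP[r1 r2].
  have xr : ball_ Num.norm x e (ratr r) by rewrite /= ltr_norml; lra.
  have [pr rq /negP Fr] := he _ xr.
  by case: Fr; rewrite Frat ?pr.
have locf : locally_integrable [set: R] h by apply: open_integrable_locally => //; exact: openT.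
have := @FTC1 R h (BLeft p) (fun y => hiS _) locf.
apply: ae_imply => x hx /andP[px xq].
have [|_ <-] := hx; first by rewrite lte_fin.
rewrite derive1E.
have D0 : is_derive x 1 F 0.
  apply: (@near_eq_is_derive _ _ _ (cst 0)).
  near=> y; rewrite /= F0//; apply/andP; split.
    by near: y; exact: lt_nbhsr.
  by near: y; exact: lt_nbhsl.
by have [_ ->] := D0.
Unshelve. all: by end_near. Qed.

End zero_primitive.

Section shear_integral.
Context {R : realType}.
Local Notation mu := (@lebesgue_measure R).
Local Notation mu2 := (mu \x mu)%E.
Implicit Types (f : R * R -> R).

Lemma ge0_integral_shear c (f : R * R -> \bar R) : measurable_fun setT f ->
  (forall z, (0 <= f z)%E) ->
  (\int[mu2]_z f (shear c z) = \int[mu2]_z f z)%E.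
Proof.
move=> mf f0.
have := @ge0_integral_pushforward _ _
  (measurableTypeR R * measurableTypeR R)%type
  (measurableTypeR R * measurableTypeR R)%type R (shear c)
  (@measurable_shear R c) mu2 setT f measurableT mf (fun x _ => f0 x).
rewrite preimage_setT => /= <-.
apply: eq_measure_integral => [|? A mA _ /=]; first exact: measurable_shear.
by rewrite /pushforward shear_preserving.
Qed.

Lemma integrable_shear c f : mu2.-integrable setT (EFin \o f) ->
  mu2.-integrable setT (EFin \o (f \o shear c)).
Proof.
move=> /integrableP[/measurable_EFinP mf fi]; apply/integrableP; split.
  by apply/measurable_EFinP; apply: measurableT_comp => //; exact: measurable_shear.
have := @ge0_integral_shear c (fun z => `|(f z)%:E|%E).
rewrite /= => -> //.
by apply/measurable_EFinP; exact: measurableT_comp.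
Qed.

Lemma integral_shear c f : mu2.-integrable setT (EFin \o f) ->
  \int[mu2]_z f (shear c z) = \int[mu2]_z f z.
Proof.
move=> fi.
have mf : measurable_fun setT (EFin \o f) by case/integrableP: fi.
rewrite /Rintegral integralE [in RHS]integralE; congr (fine (_ - _)%E).
  rewrite -(@ge0_integral_shear c (EFin \o f)^\+%E)//.
    by apply: eq_integral => x _; rewrite !funeposE.
  exact: measurable_funepos.
rewrite -(@ge0_integral_shear c (EFin \o f)^\-%E)//.
  by apply: eq_integral => x _; rewrite !funenegE.
exact: measurable_funeneg.
Qed.

Lemma integrable_mul_bounded d (T : measurableType d)
    (m : {measure set T -> \bar R}) (f g : T -> R) (B : R) :
  m.-integrable setT (EFin \o f) -> measurable_fun setT g ->
  (forall z, `|g z| <= B) -> m.-integrable setT (EFin \o (fun z => f z * g z)).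
Proof.
move=> fi mg gB; have /integrableP[/measurable_EFinP mf _] := fi.
apply: (@le_integrable _ _ _ m setT measurableT _ (fun z => (B%:E * (EFin \o f) z)%E)).
- by apply/measurable_EFinP; exact: measurable_funM.
- move=> z _; rewrite /= lee_fin normrM mulrC normrM.
  by rewrite ler_wpM2r// (le_trans (gB z))// ler_norm.
- exact: integrableZl.
Qed.

Lemma Rdominated_cvg d (T : measurableType d)
    (m : {measure set T -> \bar R}) (f_ : nat -> T -> R) (f g : T -> R) :
  (forall j, measurable_fun setT (f_ j)) -> measurable_fun setT f ->
  (forall x, f_ j x @[j --> \oo] --> f x) ->
  m.-integrable setT (EFin \o g) -> (forall j x, `|f_ j x| <= g x) ->
  \int[m]_x f_ j x @[j --> \oo] --> \int[m]_x f x.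
Proof.
move=> mf_ mf ff gi fg.
have fi : m.-integrable setT (EFin \o f).
  apply: (@le_integrable _ _ _ m setT measurableT _ (EFin \o g)) => //.
    exact/measurable_EFinP.
  move=> x _; rewrite /= lee_fin.
  have g0 : 0 <= g x by apply: le_trans (fg 0%N x).
  rewrite (ger0_norm g0); have := cvg_norm (ff x).
  move=> /(_ _) h; rewrite -(cvg_lim _ h)//.
  by apply: limr_le; [apply: cvgP h|exact: nearW].
have [_ _ h] : [/\ m.-integrable setT (EFin \o f),
  (\int[m]_(x in setT) `|(EFin \o f_ j) x - (EFin \o f) x|)%E @[j --> \oo] --> 0%E &
  (\int[m]_(x in setT) (EFin \o f_ j) x)%E @[j --> \oo] --> (\int[m]_(x in setT) (EFin \o f) x)%E].
  apply: (@dominated_convergence _ _ R m setT measurableT _ _ (EFin \o g)) => //.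
  - by move=> j; exact/measurable_EFinP.
  - exact/measurable_EFinP.
  - by apply: ae_all => x _; apply: cvg_EFin; [exact: nearW|exact: ff].
  - by apply: ae_all => x j _; rewrite /= lee_fin.
apply: fine_cvg; rewrite fineK//.
exact: integrable_fin_num.
Qed.

Lemma integrable_mul_bounded2 (f g : R * R -> R) (B : R) :
  mu2.-integrable setT (EFin \o f) -> measurable_fun setT g ->
  (forall z, `|g z| <= B) -> mu2.-integrable setT (EFin \o (fun z => f z * g z)).
Proof.
exact: (@integrable_mul_bounded _ (measurableTypeR R * measurableTypeR R)%type mu2 f g B).
Qed.

Lemma integrable_mul_bounded1 (f g : R -> R) (B : R) :
  mu.-integrable setT (EFin \o f) -> measurable_fun setT g ->
  (forall z, `|g z| <= B) -> mu.-integrable setT (EFin \o (fun z => f z * g z)).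
Proof. exact: (@integrable_mul_bounded _ (measurableTypeR R) mu f g B). Qed.

(** Fubini's theorem for real-valued integrals: where the extended-valued
    inner integral is not finite, [fine] replaces it by 0, and this happens on
    a null set. *)
Lemma integrable_section_integral (f : R * R -> R) :
  mu2.-integrable setT (EFin \o f) ->
  mu.-integrable setT (EFin \o (fun x => \int[mu]_t f (t, x))) /\
  \int[mu]_x \int[mu]_t f (t, x) = \int[mu2]_z f z.
Proof.
move=> fi; have mG := measurable_fubini_G fi.
have fG : mu.-integrable setT (fubini_G mu (EFin \o f)).
  apply/integrableP; split => //.
  have mf : measurable_fun setT (EFin \o f) by case/integrableP: fi.
  have := (integrable21ltyP mu mu mf).1 fi; apply: le_lt_trans.
  apply: ge0_le_integral => //.
  - exact: measurableT_comp.
  - have mabs : measurable_fun setT (abse \o (EFin \o f)) by exact: measurableT_comp.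
    exact: (@measurable_fun_fubini_tonelli_G _ _ (measurableTypeR R)
      (measurableTypeR R) R mu (abse \o (EFin \o f)) mabs (fun z => abse_ge0 _)).
  - move=> x _; apply: le_abse_integral => //.
    exact: measurableT_comp.
have E : {ae mu, forall x, fubini_G mu (EFin \o f) x =
    (EFin \o (fun x => \int[mu]_t f (t, x))) x}.
  apply: ae_imply (ae_integrable2 fi) => x fx.
  by rewrite /= /Rintegral fineK//; exact: integrable_fin_num.
have mr : measurable_fun setT (EFin \o (fun x => \int[mu]_t f (t, x))).
  by apply/measurable_EFinP; exact: measurableT_comp mG.
split.
  apply: (@le_integrable _ _ _ mu setT measurableT _ (fubini_G mu (EFin \o f))) => //.
  move=> x _; rewrite /= /Rintegral /fubini_G.
  by case: (\int[mu]_t _)%E => [r| |] /=; rewrite ?leey.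
rewrite /Rintegral -(integral21_prod_meas1 fi); congr fine.
apply/esym; apply: ae_eq_integral => //.
by apply: ae_imply E => x Ex _.
Qed.

Lemma Rdominated_cvg1 (f_ : nat -> R -> R) (f g : R -> R) :
  (forall j, measurable_fun setT (f_ j)) -> measurable_fun setT f ->
  (forall x, f_ j x @[j --> \oo] --> f x) ->
  mu.-integrable setT (EFin \o g) -> (forall j x, `|f_ j x| <= g x) ->
  \int[mu]_x f_ j x @[j --> \oo] --> \int[mu]_x f x.
Proof. exact: (@Rdominated_cvg _ (measurableTypeR R) mu f_ f g). Qed.

Lemma Rdominated_cvg2 (f_ : nat -> R * R -> R) (f g : R * R -> R) :
  (forall j, measurable_fun setT (f_ j)) -> measurable_fun setT f ->
  (forall x, f_ j x @[j --> \oo] --> f x) ->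
  mu2.-integrable setT (EFin \o g) -> (forall j x, `|f_ j x| <= g x) ->
  \int[mu2]_x f_ j x @[j --> \oo] --> \int[mu2]_x f x.
Proof.
exact: (@Rdominated_cvg _ (measurableTypeR R * measurableTypeR R)%type mu2 f_ f g).
Qed.

End shear_integral.

(** * The weak transport equation on a box *)

Section transport_box.
Context {R : realType}.
Local Notation mu := (@lebesgue_measure R).
Local Notation mu2 := (mu \x mu)%E.
Variables (c : R) (u : R * R -> R).
Hypothesis u_int : forall T : R, mu2.-integrable (`]0, T] `*` `]0, 1[) (EFin \o u).
Hypothesis u_weak : forall phi, test_function phi ->
  \int[mu2]_(z in @Omega R) (u z * (dt phi z + c * dx phi z)) = 0.

Definition char_region : set (R * R) := shear c @^-1` (@Omega R).

(** The function u in characteristic coordinates, extended by zero outside the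
    preimage of Omega. *)
Definition char_fun : R * R -> R := (u \_ (@Omega R)) \o shear c.

Variables (t0 t1 x0 x1 : R).
Hypotheses (t01 : t0 < t1) (x01 : x0 < x1) (box : char_box c t0 t1 x0 x1).

Let Q : set (R * R) := `]t0, t1[ `*` `]x0, x1[.
Let V : R * R -> R := char_fun \_ Q.

Lemma strip_measurable (T : R) : measurable ((`]0, T] `*` `]0, 1[) : set (R * R)).
Proof. exact: measurableX. Qed.

Lemma strip_integrable (T : R) :
  mu2.-integrable setT (EFin \o (u \_ (`]0, T] `*` `]0, 1[))).
Proof.
rewrite -restrict_EFin; apply/(integrable_mkcond _ _).1 => //.
exact: strip_measurable.
Qed.

Lemma box_fun_integrable : mu2.-integrable setT (EFin \o V).
Proof.
have mQ : measurable Q by exact: measurableX.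
have -> : V = ((u \_ (`]0, t1] `*` `]0, 1[)) \o shear c) \_ Q.
  apply/funext => z; rewrite /V !patchE; case: ifPn => //.
  rewrite inE => -[/=]; rewrite !in_itv/= => /andP[z1 z2] /andP[z3 z4].
  have [tp hx] : 0 < z.1 /\ 0 < z.2 + c * z.1 < 1.
    by apply: box; apply/andP; split; exact: ltW.
  rewrite /char_fun /= !patchE !mem_set//; split; rewrite /shear/= in_itv/= ?andbT//.
  by rewrite tp ltW.
rewrite -restrict_EFin; apply/(integrable_mkcond _ _).1 => //.
apply: integrableS (integrable_shear c (strip_integrable t1)) => //.
Qed.

Lemma box_funE t x : t0 < t < t1 -> x0 < x < x1 ->
  V (t, x) = u (t, x + c * t) /\ (0 < t /\ 0 < x + c * t < 1).
Proof.
move=> tt xx; have [tp hx] : 0 < t /\ 0 < x + c * t < 1.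
  by apply: box; move/andP: tt xx => [? ?] /andP[? ?]; apply/andP; split; exact: ltW.
split=> //; rewrite /V /char_fun /Q !patchE !mem_set//= patchE mem_set//.
by split; rewrite /shear/= in_itv/= ?andbT.
Qed.

(** The weak equation for the test function b(t) a(x - c t), written in
    characteristic coordinates: the derivative falls on b only. *)
Lemma weak_char (a b b' : R -> R) (B : R) : infdiff a -> infdiff b ->
  (forall x : R, is_derive x 1 b (b' x)) ->
  (forall t, ~~ (t0 <= t <= t1) -> b t = 0) ->
  (forall t, ~~ (t0 < t < t1) -> b' t = 0) ->
  (forall x, ~~ (x0 < x < x1) -> a x = 0) ->
  (forall x, `|a x| <= 1) -> (forall t, `|b' t| <= B) ->
  \int[mu2]_z (V z * (b' z.1 * a z.2)) = 0.
Proof.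
move=> ha hb db b0 b'0 a0 a1 b'B.
have a0' x : ~~ (x0 <= x <= x1) -> a x = 0.
  by move=> h; apply: a0; apply: contra h => /andP[? ?]; apply/andP; split; exact: ltW.
have [a' [da ha']] := infdiff_derive ha.
have [b'' [db'' hb'']] := infdiff_derive hb.
have E : b'' = b'.
  by apply/funext => x; have := db x; have := db'' x => -[_ <-] [_ <-].
rewrite {b''}E in db'' hb''.
have tphi := wave_test_test_function ha hb box b0 a0'.
have := u_weak tphi.
under eq_Rintegral do rewrite (wave_test_transport c da db).
rewrite Rintegral_mkcond.
pose G z := (u \_ (`]0, t1] `*` `]0, 1[)) z * wave_test c b' a z.
rewrite (_ : _ \_ _ = G); last first.
  apply/funext => -[t x]; rewrite /G !patchE.
  case: ifPn => [|nO]; last first.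
    rewrite ifF ?mul0r//; apply/negbTE; apply: contra nO.
    rewrite !inE => -[/=]; rewrite in_itv/= => /andP[tp _] xx.
    by split => //=; rewrite in_itv/= tp.
  rewrite inE => -[/=]; rewrite in_itv/= andbT => tp xx.
  case: ifPn => // nS; rewrite mul0r /wave_test /= b'0 ?mul0r ?mulr0//.
  apply: contra nS => /andP[_ tt]; rewrite inE; split => //=.
  by rewrite in_itv/= tp ltW.
have B0 : 0 <= B by apply: le_trans (b'B 0); exact: normr_ge0.
have Gi : mu2.-integrable setT (EFin \o G).
  apply: (@integrable_mul_bounded2 _ _ (wave_test c b' a) B).
  - exact: strip_integrable.
  - apply: continuous_measurable_plane; apply: wave_test_continuous;
    exact: infdiff_continuous.
  - move=> z; rewrite /wave_test normrM -[leRHS]mulr1.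
    by apply: ler_pM => //.
rewrite -(integral_shear c Gi) => <-; apply: eq_Rintegral => -[t x] _.
rewrite /G /shear /wave_test /= [in RHS]patchE/= addrK.
have [tt|tt] := boolP (t0 < t < t1); last by rewrite b'0// !mul0r !mulr0.
have [xx|xx] := boolP (x0 < x < x1); last by rewrite a0// !mulr0.
have [VE [tp hx]] := box_funE tt xx.
rewrite VE.
rewrite mem_set//; split; rewrite /= in_itv/= ?tp//=.
by case/andP: tt => _ /ltW.
Qed.

(** A combination of two indicators with zero integral, as the derivatives of
    compactly supported functions must have. Its vanishing against a function
    of t says that the integral of this function over ]t0, y[ is proportional
    to y - t0. *)
Let K (y t : R) : R := (t1 - t0) * \1_(`]t0, y[%classic) t - (y - t0) * \1_(`]t0, t1[%classic) t.

Lemma bump_integrable (p q : R) j : mu.-integrable setT (EFin \o bump p q j).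
Proof.
apply: (@supported_integrable _ _ p q).
  by apply: infdiff_continuous; exact: bump_infdiff.
by move=> x; exact: bump_out.
Qed.

Lemma integral_indic_itv (p q : R) : p <= q ->
  \int[mu]_t (\1_(`]p, q[%classic) t : R) = q - p.
Proof.
move=> pq; rewrite /Rintegral integral_indic// setIT.
have := @lebesgue_measure_itv R `]p, q[; rewrite /= lte_fin => ->.
case: ifPn => //; rewrite -leNgt => qp.
have -> : p = q by apply/le_anti/andP.
by rewrite subrr.
Qed.

Lemma bump_integral_cvg (p q : R) : p <= q ->
  \int[mu]_t bump p q j t @[j --> \oo] --> q - p.
Proof.
move=> pq; rewrite -(integral_indic_itv pq).
have ii : mu.-integrable setT (EFin \o (\1_(`]p, q[%classic) : R -> R)).
  exact: integrable_indic_itv.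
apply: (@Rdominated_cvg1 _ _ _ (\1_(`]p, q[%classic) : R -> R)) => //.
- by move=> j; apply: continuous_measurable_fun; apply: infdiff_continuous; exact: bump_infdiff.
- by move=> x; exact: bump_cvg.
- move=> j x; rewrite indicE mem_setE in_itv/=.
  have /andP[b0 b1] := bump_bounds p q j x.
  by rewrite ger0_norm//; case: (boolP (p < x < q)) => // h; rewrite bump_out.
Qed.

(** Two bumps weighted by each other's integrals give a function of zero mean,
    which is the derivative of a function supported in the box by
    [primitive_infdiff]. *)
Lemma box_test_integral_j (y w : R) (j : nat) : t0 < y -> y <= t1 -> w <= x1 ->
  \int[mu2]_z (V z * (((\int[mu]_t bump t0 t1 j t) * bump t0 y j z.1 -
    (\int[mu]_t bump t0 y j t) * bump t0 t1 j z.1) * bump x0 w j z.2)) = 0.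
Proof.
move=> t0y yt1 wx1.
set m := \int[mu]_t bump t0 t1 j t; set m' := \int[mu]_t bump t0 y j t.
pose psi t := m * bump t0 y j t - m' * bump t0 t1 j t.
have hpsi : infdiff psi.
  have -> : psi = fun t => m * bump t0 y j t + (- m') * bump t0 t1 j t.
    by apply/funext => t; rewrite /psi mulNr.
  by move=> n; apply: ndiff_add; apply: infdiff_scale; exact: bump_infdiff.
have out q t : q <= t1 -> ~~ (t0 < t < t1) -> bump t0 q j t = 0.
  move=> qt1 h; apply: bump_out; apply: contra h => /andP[? ?].
  by apply/andP; split=> //; exact: lt_le_trans qt1.
have psi0 t : ~~ (t0 < t < t1) -> psi t = 0.
  by move=> h; rewrite /psi !out// !mulr0 subrr.
have bi q := bump_integrable t0 q j.
have ipsi : \int[mu]_t psi t = 0.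
  rewrite RintegralB//; last 2 first.
  - by have := integrableZl measurableT m (bi y).
  - by have := integrableZl measurableT m' (bi t1).
  by rewrite !RintegralZl// -/m -/m' mulrC subrr.
have [b [hb db b0]] := primitive_infdiff hpsi psi0 ipsi.
apply: (@weak_char (bump x0 w j) b psi (`|m| + `|m'|)) => //.
- exact: bump_infdiff.
- move=> x h; apply: bump_out; apply: contra h => /andP[? ?].
  by apply/andP; split=> //; exact: lt_le_trans wx1.
- by move=> x; have /andP[? ?] := bump_bounds x0 w j x; rewrite ger0_norm.
- move=> t; apply: le_trans (ler_normB _ _) _; rewrite (normrM m) (normrM m').
  have /andP[? ?] := bump_bounds t0 y j t; have /andP[? ?] := bump_bounds t0 t1 j t.
  rewrite (ger0_norm (x := bump t0 y j t))// (ger0_norm (x := bump t0 t1 j t))//.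
  by apply: lerD; rewrite ler_piMr.
Qed.

(** The limit j -> oo of the previous identity, by dominated convergence. *)
Lemma box_test_integral (y w : R) : t0 < y -> y <= t1 -> w <= x1 ->
  \int[mu2]_z (V z * (K y z.1 * \1_(`]x0, w[%classic) z.2)) = 0.
Proof.
move=> t0y yt1 wx1.
have Vi := box_fun_integrable; have /integrableP[/measurable_EFinP mV _] := Vi.
pose m j := \int[mu]_t bump t0 t1 j t; pose m' j := \int[mu]_t bump t0 y j t.
have cm : m j @[j --> \oo] --> t1 - t0 by apply: bump_integral_cvg; exact: ltW.
have cm' : m' j @[j --> \oo] --> y - t0 by apply: bump_integral_cvg; exact: ltW.
have mbump (p q : R) j : measurable_fun setT (bump p q j).
  by apply: continuous_measurable_fun; apply: infdiff_continuous; exact: bump_infdiff.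
have mle j q : 0 <= \int[mu]_t bump t0 q j t.
  by apply: Rintegral_ge0 => t _; case/andP: (bump_bounds t0 q j t).
have mub j q : t0 <= q -> \int[mu]_t bump t0 q j t <= q - t0.
  move=> t0q; rewrite -(integral_indic_itv t0q); apply: le_Rintegral => //.
  - exact: bump_integrable.
  - exact: integrable_indic_itv.
  - move=> x _; rewrite indicE mem_setE in_itv/=.
    have /andP[b0 b1] := bump_bounds t0 q j x.
    by case: (boolP (t0 < x < q)) => // h; rewrite bump_out.
have cvg0 : (fun=> 0) @ \oo --> \int[mu2]_z (V z * (K y z.1 * \1_(`]x0, w[%classic) z.2)).
  have -> : (fun=> 0) = (fun j => \int[mu2]_z (V z * ((m j * bump t0 y j z.1 -
      m' j * bump t0 t1 j z.1) * bump x0 w j z.2))).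
    by apply/funext => j; rewrite box_test_integral_j.
  apply: (@Rdominated_cvg2 _ _ _ (fun z => 2 * (t1 - t0) * `|V z|)).
  - move=> j; apply: measurable_funM => //; apply: measurable_funM.
      apply: measurable_funB; apply: measurable_funM => //;
      exact: measurableT_comp measurable_fst.
    exact: measurableT_comp measurable_snd.
  - apply: measurable_funM => //; apply: measurable_funM.
      apply: measurable_funB; apply: measurable_funM => //;
      apply: measurableT_comp measurable_fst; exact: measurable_indic.
    apply: measurableT_comp measurable_snd; exact: measurable_indic.
  - move=> z; apply: cvgMl_tmp; apply: cvgM; last exact: bump_cvg.
    by apply: cvgB; apply: cvgM => //; exact: bump_cvg.
  - have := integrableZl measurableT (2 * (t1 - t0)) (integrable_norm Vi).
    exact.
  - move=> j z; rewrite normrM mulrC ler_wpM2r// normrM.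
    have /andP[a0 a1] := bump_bounds x0 w j z.2.
    have /andP[b0 b1] := bump_bounds t0 y j z.1.
    have /andP[b'0 b'1] := bump_bounds t0 t1 j z.1.
    have m1 : 0 <= m j <= t1 - t0 by rewrite mle mub// ltW.
    have m2 : 0 <= m' j <= t1 - t0.
      by rewrite mle/=; apply: le_trans (mub j y (ltW t0y)) _; lra.
    rewrite (ger0_norm a0); apply: (@le_trans _ _ (2 * (t1 - t0) * 1)); last by rewrite mulr1.
    apply: ler_pM => //; apply: le_trans (ler_normB _ _) _.
    rewrite (normrM (m j)) (normrM (m' j)) (ger0_norm b0) (ger0_norm b'0).
    case/andP: m1 => m10 m11; case/andP: m2 => m20 m21.
    rewrite (ger0_norm m10) (ger0_norm m20) mulr_natl mulr2n.
    by apply: lerD; rewrite -[leRHS]mulr1; exact: ler_pM.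
by rewrite -(cvg_lim (@Rhausdorff R) cvg0) lim_cst.
Qed.

(** By Fubini, the integrals of the left-hand side over ]x0, w[ vanish for all
    rational w in ]x0, x1[. *)
Lemma box_section_integral (y : R) : t0 < y -> y <= t1 ->
  {ae mu, forall x, x0 < x < x1 -> \int[mu]_t (V (t, x) * K y t) = 0}.
Proof.
move=> t0y yt1.
have Vi := box_fun_integrable.
pose H x := \int[mu]_t (V (t, x) * K y t).
have Kb z : `|K y z.1| <= 2 * (t1 - t0).
  rewrite /K; apply: le_trans (ler_normB _ _) _; rewrite !normrM mulr_natl mulr2n.
  have h (A : set R) t : `|\1_A t : R| <= 1 by rewrite indicE; case: (_ \in _); rewrite ?normr1
      ?normr0.
  apply: lerD; rewrite -[leRHS]mulr1; apply: ler_pM => //.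
    by rewrite ger0_norm// subr_ge0 ltW.
  by rewrite ger0_norm ?subr_ge0 ?lerD2r// ltW.
have mK : measurable_fun setT (K y).
  by apply: measurable_funB; apply: measurable_funM => //; exact: measurable_indic.
have VKi : mu2.-integrable setT (EFin \o (fun z => V z * K y z.1)).
  apply: (@integrable_mul_bounded2 _ _ _ (2 * (t1 - t0))) => //.
  exact: measurableT_comp measurable_fst.
have [Hi _] := integrable_section_integral VKi.
apply: (@zero_of_rational_primitive _ H x0 x1 x01 Hi) => w /andP[_ /ltW wx1].
rewrite -[RHS](box_test_integral t0y yt1 wx1).
have VKwi : mu2.-integrable setT (EFin \o
    (fun z => V z * (K y z.1 * \1_(`]x0, (ratr w : R)[%classic) z.2))).
  apply: (@integrable_mul_bounded2 _ _ _ (2 * (t1 - t0))) => //.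
    apply: measurable_funM; first exact: measurableT_comp measurable_fst.
    by apply: measurableT_comp measurable_snd; exact: measurable_indic.
  move=> z; rewrite normrM -[leRHS]mulr1; apply: ler_pM => //.
  by rewrite indicE; case: (_ \in _); rewrite ?normr1 ?normr0.
have [_ <-] := integrable_section_integral VKwi.
rewrite Rintegral_mkcond; apply: eq_Rintegral => x _.
rewrite patchE mem_setE; case: ifPn => xw.
  by apply: eq_Rintegral => t _; rewrite indicE mem_setE xw mulr1.
rewrite /Rintegral integral0_eq// => t _.
by rewrite indicE mem_setE (negbTE xw) !mulr0.
Qed.

(** For almost every x the function t |-> V (t, x), minus its mean over ]t0,
    t1[, has a primitive that vanishes at rational points. *)
Lemma box_constant : {ae mu, forall x, x0 < x < x1 ->
  exists k, {ae mu, forall t, t0 < t < t1 -> char_fun (t, x) = k}}.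
Proof.
have Vi := box_fun_integrable.
have := @ae_countable _ _ _ mu rat (fun y x => t0 < ratr y < t1 ->
  x0 < x < x1 -> \int[mu]_t (V (t, x) * K (ratr y) t) = 0).
move=> /(_ _)/wrap[y|H].
  have [yy|nyy] := boolP (t0 < ratr y < t1); last exact: ae_all.
  case/andP: (yy) => t0y /ltW yt1.
  by apply: ae_imply (box_section_integral t0y yt1) => x h _.
apply: ae_imply (ae_and H (ae_integrable2 Vi)) => x [Hx Vx] xx.
pose f t := V (t, x).
have fi : mu.-integrable setT (EFin \o f) by exact: Vx.
pose kappa := (\int[mu]_t f t) / (t1 - t0).
pose ind (q t : R) : R := \1_(`]t0, q[%classic) t.
have indi q : mu.-integrable setT (EFin \o ind q) by exact: integrable_indic_itv.
have mind q : measurable_fun setT (ind q) by exact: measurable_indic.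
have fii q : mu.-integrable setT (EFin \o (fun t => f t * ind q t)).
  apply: (@integrable_mul_bounded1 _ _ _ 1) => // t.
  by rewrite /ind indicE; case: (_ \in _); rewrite ?normr1 ?normr0.
have f1 : \int[mu]_t (f t * ind t1 t) = \int[mu]_t f t.
  apply: eq_Rintegral => t _; rewrite /f /V !patchE /ind indicE mem_setE in_itv/=.
  case: (boolP (t0 < t < t1)) => tt; first by rewrite mulr1.
  rewrite mulr0; case: ifPn => //; rewrite inE => -[/=].
  by rewrite in_itv/= (negbTE tt).
have fint q : \int[mu]_(t in `]t0, q[) f t = \int[mu]_t (f t * ind q t).
  rewrite Rintegral_mkcond; apply: eq_Rintegral => t _.
  by rewrite patchE /ind indicE; case: (_ \in _); rewrite ?mulr1 ?mulr0.
pose g t := f t - kappa * ind t1 t.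
have kii : mu.-integrable setT (EFin \o (fun t => kappa * ind t1 t)).
  by have := integrableZl measurableT kappa (indi t1).
have gi : mu.-integrable setT (EFin \o g).
  by have := integrableB measurableT fi kii.
exists kappa.
suff : {ae mu, forall t, t0 < t < t1 -> g t = 0}.
  apply: ae_imply => t gt tt; have := gt tt.
  rewrite /g /f /ind indicE mem_setE in_itv/= tt mulr1 => /eqP.
  rewrite subr_eq0 => /eqP <-.
  by rewrite /V patchE mem_set//; split; rewrite /= in_itv.
apply: (zero_of_rational_primitive t01 gi) => y yy.
case/andP: (yy) => t0y yt1.
have := Hx y yy xx.
under eq_Rintegral do rewrite /K mulrBr mulrCA (mulrCA _ (ratr y - t0)).
rewrite RintegralB//; last 2 first.
- by have := integrableZl measurableT (t1 - t0) (fii (ratr y)).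
- by have := integrableZl measurableT (ratr y - t0) (fii t1).
rewrite !RintegralZl//; [|exact: fii|exact: fii].
rewrite f1 -fint => E.
rewrite RintegralB//; [|exact: integrableS fi|exact: integrableS kii].
rewrite [X in _ - X](_ : _ = kappa * (ratr y - t0)); last first.
  transitivity (\int[mu]_(t in `]t0, (ratr y : R)[) kappa); last first.
    rewrite Rintegral_cst//; have := @lebesgue_measure_itv R `]t0, (ratr y : R)[.
    by rewrite /= lte_fin t0y => ->.
  apply: eq_Rintegral => t; rewrite inE/= in_itv/= => /andP[a1 a2].
  by rewrite /ind indicE mem_setE in_itv/= a1 (lt_trans a2)// mulr1.
have t10 : t1 - t0 != 0 by rewrite subr_eq0 gt_eqF.
apply: (mulfI t10); rewrite mulr0 -[RHS]E mulrBr; congr (_ - _).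
by rewrite /kappa; field.
Qed.

End transport_box.

(** * Functions that are constant along characteristics *)

Section glue.
Context {R : realType}.
Local Notation mu := (@lebesgue_measure R).

Lemma ae_itv_exists (p q : R) (P : R -> Prop) : p < q ->
  {ae mu, forall t, P t} -> exists t, p < t < q /\ P t.
Proof.
move=> pq [E [mE E0 PE]]; apply: contrapT => h.
have sub : `]p, q[%classic `<=` E.
  move=> t /=; rewrite in_itv/= => tt; apply: PE => /= Pt.
  by apply: h; exists t.
have : (mu `]p, q[%classic <= 0)%E.
  by rewrite -E0; apply: le_measure => //; rewrite inE.
have -> := @lebesgue_measure_itv R `]p, q[.
by rewrite /= lte_fin pq -EFinB lee_fin subr_le0 leNgt pq.
Qed.

(** The constants found on two overlapping intervals agree. Any interval is
    compared with a fixed one, ]p0, q0[, inside a third interval that contains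
    both. *)
Lemma ae_constant_glue (g : R -> R) (S : R -> Prop) :
  (forall a b t, S a -> S b -> a <= t <= b -> S t) ->
  (forall t, S t -> exists p q : rat, [/\ ratr p < t < ratr q, S (ratr p) & S (ratr q)]) ->
  (forall p q : rat, S (ratr p) -> S (ratr q) -> ratr p < ratr q :> R ->
    exists k, {ae mu, forall t, ratr p < t < ratr q -> g t = k}) ->
  exists k, {ae mu, forall t, S t -> g t = k}.
Proof.
move=> Sconv Sopen Sloc.
have [[t St]|nS] := pselect (exists t, S t); last first.
  by exists 0; apply: ae_all => t St; case: nS; exists t.
have [p0 [q0 [/andP[p0t tq0] Sp0 Sq0]]] := Sopen t St.
have pq0 : ratr p0 < ratr q0 :> R by exact: lt_trans tq0.
have [k0 hk0] := Sloc p0 q0 Sp0 Sq0 pq0.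
exists k0.
have key (p q : rat) : S (ratr p) -> S (ratr q) ->
    {ae mu, forall t, ratr p < t < ratr q -> g t = k0}.
  move=> Sp Sq.
  have Sm : S (ratr (Num.min p p0)) by rewrite /Num.min; case: ifP.
  have SM : S (ratr (Num.max q q0)) by rewrite /Num.max; case: ifP.
  have m1 : ratr (Num.min p p0) <= ratr p :> R by rewrite ler_rat ge_min lexx.
  have m2 : ratr (Num.min p p0) <= ratr p0 :> R by rewrite ler_rat ge_min lexx orbT.
  have M1 : ratr q <= ratr (Num.max q q0) :> R by rewrite ler_rat le_max lexx.
  have M2 : ratr q0 <= ratr (Num.max q q0) :> R by rewrite ler_rat le_max lexx orbT.
  have mM : ratr (Num.min p p0) < ratr (Num.max q q0) :> R.
    by apply: le_lt_trans m2 _; apply: lt_le_trans M2.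
  have [k hk] := Sloc _ _ Sm SM mM.
  have [s [/andP[s1 s2] [g1 g2]]] := ae_itv_exists pq0 (ae_and hk hk0).
  have kk : k = k0.
    rewrite -g1; last by rewrite (le_lt_trans m2)// (lt_le_trans s2).
    by apply: g2; rewrite s1.
  rewrite -kk; apply: ae_imply hk => x gx /andP[x1 x2]; apply: gx.
  by rewrite (le_lt_trans m1)// (lt_le_trans x2).
have := @ae_countable _ _ _ mu (rat * rat)%type (fun pq t => S (ratr pq.1) ->
  S (ratr pq.2) -> ratr pq.1 < t < ratr pq.2 -> g t = k0).
move=> /(_ _)/wrap[[p q] /=|].
  have [Sp|nSp] := pselect (S (ratr p)); last by apply: ae_all.
  have [Sq|nSq] := pselect (S (ratr q)); last by apply: ae_all.
  by apply: ae_imply (key p q Sp Sq) => x h _ _.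
apply: ae_imply => x h Sx.
by have [p [q [pxq Sp Sq]]] := Sopen x Sx; exact: (h (p, q)).
Qed.

End glue.

Section transport.
Context {R : realType}.
Local Notation mu := (@lebesgue_measure R).
Local Notation mu2 := (mu \x mu)%E.
Variables (c : R) (u : R * R -> R).
Hypothesis c0 : c != 0.
Hypothesis u_meas : measurable_fun (@Omega R) u.
Hypothesis u_int : forall T : R, mu2.-integrable (`]0, T] `*` `]0, 1[) (EFin \o u).
Hypothesis u_weak : forall phi, test_function phi ->
  \int[mu2]_(z in @Omega R) (u z * (dt phi z + c * dx phi z)) = 0.

Local Notation U := (char_fun c u).
Local Notation Rg := (@char_region R c).

Lemma char_regionP (t x : R) : Rg (t, x) <-> 0 < t /\ 0 < x + c * t < 1.
Proof.
split; rewrite /char_region/Omega/shear/=.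
  by move=> [] /=; rewrite !in_itv/= andbT => ? ?.
by move=> [t0 tx]; split => /=; rewrite in_itv/= ?andbT.
Qed.

Lemma between_mul (p q t : R) : p <= t <= q ->
  (c * p <= c * t <= c * q) \/ (c * q <= c * t <= c * p).
Proof.
move=> /andP[pt tq]; have [c_ge0|c_lt0] := leP 0 c.
  by left; rewrite !ler_wpM2l.
by right; rewrite !ler_wnM2l// ltW.
Qed.

Lemma char_box_around (p q x : R) : p < q -> Rg (p, x) -> Rg (q, x) ->
  exists x0 x1 : rat, [/\ ratr x0 < x < ratr x1 & char_box c p q (ratr x0) (ratr x1)].
Proof.
move=> pq /char_regionP[p0 /andP[h1 h2]] /char_regionP[q0 /andP[h3 h4]].
pose e := Num.min (Num.min (x + c * p) (x + c * q))
                  (Num.min (1 - (x + c * p)) (1 - (x + c * q))).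
have e0 : 0 < e by rewrite /e !lt_min; apply/andP; split; apply/andP; split; lra.
have e1 : e <= x + c * p by rewrite /e !ge_min lexx.
have e2 : e <= x + c * q by rewrite /e !ge_min lexx !orbT.
have e3 : e <= 1 - (x + c * p) by rewrite /e !ge_min lexx !orbT.
have e4 : e <= 1 - (x + c * q) by rewrite /e !ge_min lexx !orbT.
have /rat_in_itvoo[a] : x - e < x by lra.
rewrite in_itv/= => /andP[a1 a2].
have /rat_in_itvoo[b] : x < x + e by lra.
rewrite in_itv/= => /andP[b1 b2].
exists a, b; split; first by rewrite a2.
move=> t y tt /andP[y1 y2]; have /andP[t1 t2] := tt.
split; first by apply: lt_le_trans t1.
by have [/andP[? ?]|/andP[? ?]] := between_mul tt; apply/andP; split; lra.
Qed.

Lemma char_region_nbhs (t x : R) : Rg (t, x) ->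
  exists2 e, 0 < e & forall s, t - e < s < t + e -> Rg (s, x).
Proof.
move=> /char_regionP[t0 /andP[h1 h2]].
have cn : 0 < `|c| by rewrite normr_gt0.
pose e := Num.min t (Num.min (x + c * t) (1 - (x + c * t)) / `|c|).
have e0 : 0 < e.
  by rewrite /e lt_min t0/= divr_gt0// lt_min h1/=; lra.
have e1 : e <= t by rewrite /e ge_min lexx.
exists e => // s /andP[s1 s2]; apply/char_regionP; split; first lra.
have : `|c * s - c * t| < Num.min (x + c * t) (1 - (x + c * t)).
  rewrite -mulrBr normrM mulrC -ltr_pdivlMr//.
  apply: (@lt_le_trans _ _ e); first by rewrite ltr_norml; lra.
  by rewrite /e ge_min lexx orbT.
by rewrite lt_min !ltr_norml => /andP[/andP[? ?] /andP[? ?]]; apply/andP; split; lra.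
Qed.

(** The characteristic through x meets Omega during an interval of times,
    which rational boxes exhaust. The constants of [box_constant] on these
    boxes are glued together. *)
Lemma section_constant : {ae mu, forall x, exists k,
  {ae mu, forall t, Rg (t, x) -> U (t, x) = k}}.
Proof.
pose I4 := (rat * rat * (rat * rat))%type.
have := @ae_countable _ _ _ mu I4 (fun q x => ratr q.1.1 < ratr q.1.2 :> R ->
  char_box c (ratr q.1.1) (ratr q.1.2) (ratr q.2.1) (ratr q.2.2) ->
  ratr q.2.1 < x < ratr q.2.2 ->
  exists k, {ae mu, forall t, ratr q.1.1 < t < ratr q.1.2 -> U (t, x) = k}).
move=> /(_ _)/wrap[[[p q] [a b]] /=|].
  have [pq|] := boolP (ratr p < ratr q :> R); last by move=> ?; exact: ae_all.
  have [ab|nab] := boolP (ratr a < ratr b :> R); last first.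
    apply: ae_all => x _ _ /andP[h1 h2].
    by rewrite (lt_trans h1 h2) in nab.
  have [bx|nbx] := pselect (char_box c (ratr p) (ratr q) (ratr a) (ratr b)); last first.
    by apply: ae_all => x _ /nbx.
  apply: ae_imply (box_constant u_int u_weak pq ab bx) => x h _ _.
  exact: h.
apply: ae_imply => x Hx; apply: ae_constant_glue.
- move=> a b t /char_regionP[a0 /andP[? ?]] /char_regionP[b0 /andP[? ?]] tt.
  apply/char_regionP; split; first by case/andP: tt => + _; exact: lt_le_trans.
  by have [/andP[? ?]|/andP[? ?]] := between_mul tt; apply/andP; split; lra.
- move=> t /char_region_nbhs[e e0 ball].
  have /rat_in_itvoo[p] : t - e < t by lra.
  rewrite in_itv/= => /andP[p1 p2].
  have /rat_in_itvoo[q] : t < t + e by lra.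
  rewrite in_itv/= => /andP[q1 q2].
  by exists p, q; split; [rewrite p2|apply: ball; lra..].
- move=> p q Sp Sq pq.
  have [a [b [xab bx]]] := char_box_around pq Sp Sq.
  exact: (Hx ((p, q), (a, b))).
Qed.

Lemma Omega_measurable : measurable (@Omega R).
Proof. exact: measurableX. Qed.

Lemma char_region_measurable : measurable Rg.
Proof.
by rewrite -[Rg]setTI; apply: measurable_shear => //; exact: Omega_measurable.
Qed.

Lemma char_fun_measurable : measurable_fun setT U.
Proof.
apply: measurableT_comp; last exact: measurable_shear.
by apply/(measurable_restrictT _ _).1 => //; exact: Omega_measurable.
Qed.

Lemma char_fun_out z : ~ Rg z -> U z = 0.
Proof. by move=> nz; rewrite /char_fun /= patchE memNset. Qed.

Definition section_length (x : R) : \bar R := mu (ysection Rg x).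

(** The constant of [section_constant], selected in a measurable way as the
    mean over the section. Division by zero makes it 0 where the section is
    empty. *)
Definition section_mean (x : R) : R :=
  \int[mu]_t U (t, x) / fine (section_length x).

Lemma section_length_fin x : section_length x \is a fin_num.
Proof.
rewrite ge0_fin_numE//; pose T := (1 + `|x|) / `|c|.
have cn : 0 < `|c| by rewrite normr_gt0.
apply: (@le_lt_trans _ _ (mu `[0, T]%classic)).
  apply: le_measure; rewrite ?inE//.
    by apply: measurable_ysection; exact: char_region_measurable.
  move=> t /ysectionP/char_regionP[t0 /andP[h1 h2]] /=; rewrite in_itv/= ltW//=.
  rewrite /T ler_pdivlMr// -[leLHS]ger0_norm ?mulr_ge0//; last exact: ltW.
  rewrite normrM normr_id mulrC -normrM.
  have -> : c * t = (x + c * t) - x by ring.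
  apply: le_trans (ler_normB _ _) _; rewrite lerD2r ger0_norm; exact: ltW.
have -> := @lebesgue_measure_itv R `[0, T].
by rewrite /=; case: ifP => _ //; rewrite ltry.
Qed.

Lemma section_mean_measurable : measurable_fun setT section_mean.
Proof.
apply: measurable_funM.
  rewrite /Rintegral; apply: measurableT_comp => //.
  under eq_fun do rewrite integralE.
  have mU : measurable_fun setT (EFin \o U) by apply/measurable_EFinP; exact: char_fun_measurable.
  apply: emeasurable_funB.
  - have := (@measurable_fun_fubini_tonelli_G _ _ (measurableTypeR R)
      (measurableTypeR R) R mu (EFin \o U)^\+%E (measurable_funepos mU) (fun z => funepos_ge0 _ _)).
    rewrite /fubini_G; congr measurable_fun; apply/funext => x.
    by apply: eq_integral => t _; rewrite !funeposE.
  - have := (@measurable_fun_fubini_tonelli_G _ _ (measurableTypeR R)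
      (measurableTypeR R) R mu (EFin \o U)^\-%E (measurable_funeneg mU) (fun z => funeneg_ge0 _ _)).
    rewrite /fubini_G; congr measurable_fun; apply/funext => x.
    by apply: eq_integral => t _; rewrite !funenegE.
have mL : measurable_fun setT section_length.
  by apply: measurable_fun_ysection; exact: char_region_measurable.
have mf : measurable_fun setT (fine \o section_length) by exact: measurableT_comp.
rewrite (_ : (fun x => _) = (fun x => `|(fine \o section_length) x| `^ (-1))); last first.
  apply/funext => x; rewrite /= ger0_norm ?fine_ge0//.
  by rewrite powR_inv1// fine_ge0.
apply: (@measurableT_comp _ _ _ _ _ _ (@powR R ^~ (-1))); first exact: measurable_powR.
exact: measurableT_comp.
Qed.

(** The constant is integrated over the section, whose length is finite
    because c is not zero and positive because Omega is open. *)
Lemma section_mean_constant : {ae mu, forall x,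
  {ae mu, forall t, Rg (t, x) -> U (t, x) = section_mean x}}.
Proof.
apply: ae_imply section_constant => x [k hk].
have [[t Rtx]|nR] := pselect (exists t, Rg (t, x)); last first.
  by apply: ae_all => t Rtx; case: nR; exists t.
suff -> : section_mean x = k by [].
pose A := ysection Rg x.
have mA : measurable A by apply: measurable_ysection; exact: char_region_measurable.
have mUx : measurable_fun setT (fun t => U (t, x)).
  apply: measurableT_comp; first exact: char_fun_measurable.
  exact: measurable_fun_pair.
have E : \int[mu]_t U (t, x) = k * fine (section_length x).
  transitivity (\int[mu]_(t in A) k); last by rewrite Rintegral_cst.
  rewrite [RHS]Rintegral_mkcond /Rintegral; congr fine; apply: ae_eq_integral => //.
  - exact/measurable_EFinP.
  - apply/measurable_EFinP; apply/(measurable_restrictT _ _).1 => //.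
  - apply: ae_imply hk => s hs _; congr EFin; rewrite patchE.
    case: ifPn => [|nA]; first by rewrite inE => /ysectionP; exact: hs.
    apply: char_fun_out => h; move/negP: nA; apply.
    by rewrite inE; apply/ysectionP.
rewrite /section_mean E mulfK// gt_eqF// fine_gt0//.
have := section_length_fin x; rewrite fin_numElt => /andP[_ ->]; rewrite andbT.
have [e e0 he] := char_region_nbhs Rtx.
apply: (@lt_le_trans _ _ (mu `]t - e, t + e[%classic)).
  have -> := @lebesgue_measure_itv R `]t - e, t + e[.
  rewrite /= lte_fin ifT; last lra.
  by rewrite -EFinB lte_fin; lra.
apply: le_measure; rewrite ?inE//.
by move=> s /=; rewrite in_itv/= => /he ?; apply/ysectionP.
Qed.

(** The set of exceptions is measurable since [section_mean] is, so that it is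
    null as soon as its sections are. *)
Lemma section_mean_ae : {ae mu2, forall z, @Omega R z ->
  u z = section_mean (z.2 - c * z.1)}.
Proof.
pose E : set (R * R) := Rg `&` [set z | U z != section_mean z.2].
have mE : measurable E.
  apply: measurableI; first exact: char_region_measurable.
  have mh : measurable_fun setT (fun z : R * R => U z - section_mean z.2).
    apply: measurable_funB; first exact: char_fun_measurable.
    apply: measurableT_comp; first exact: section_mean_measurable.
    exact: measurable_snd.
  have := mh measurableT (~` [set 0]) (measurableC (measurable_set1 0)).
  rewrite setTI; congr measurable; apply/seteqP; split => z /=.
    by move=> /eqP; rewrite subr_eq0.
  by move=> h; apply/eqP; rewrite subr_eq0.
have E0 : mu2 E = 0%E.
  apply: ysection_null => //; apply: ae_imply section_mean_constant => x [N [mN N0 hN]].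
  apply: (subset_measure0 _ mN _ N0).
    exact: measurable_ysection.
  move=> t /ysectionP[Rtx /eqP h]; apply: hN => /= k; exact/h/k.
exists (shear (- c) @^-1` E); split.
- by rewrite -[_ @^-1` _]setTI; exact: measurable_shear.
- by rewrite shear_preserving.
- move=> z /= /not_implyP[Oz /eqP h].
  have zE : shear c (shear (- c) z) = z by rewrite -[RHS](shearK (- c)) opprK.
  split; first by rewrite /char_region/= zE.
  rewrite /= /char_fun /= zE patchE mem_set//.
  by move: h; rewrite mulNr.
Qed.

(** Where the sections have length at least delta, the mean is at most 1/delta
    times the integral of |u| along the section, and this is integrable by
    Fubini. *)
Lemma section_mean_integrable (a b delta : R) : 0 < delta ->
  (forall x, a <= x <= b -> (delta%:E <= section_length x)%E) ->
  mu.-integrable `[a, b] (EFin \o section_mean).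
Proof.
move=> d0 hd.
have cn : 0 < `|c| by rewrite normr_gt0.
pose T := (1 + `|a| + `|b|) / `|c|.
pose G z := (u \_ (`]0, T] `*` `]0, 1[)) (shear c z) * \1_(`[a, b]%classic) z.2.
have Gi : mu2.-integrable setT (EFin \o G).
  apply: (@integrable_mul_bounded2 _ _ _ 1).
  - exact: (integrable_shear c (strip_integrable u_int T)).
  - by apply: measurableT_comp measurable_snd; exact: measurable_indic.
  - by move=> z; rewrite indicE; case: (_ \in _); rewrite ?normr1 ?normr0.
have GU t x : a <= x <= b -> G (t, x) = U (t, x).
  move=> axb; rewrite /G indicE mem_set/= ?in_itv//= mulr1 /char_fun/= !patchE.
  have [/char_regionP[t0 /andP[h1 h2]]|nR] := pselect (Rg (t, x)).
    rewrite !mem_set//; first by split; rewrite /shear/= in_itv/= ?andbT ?h1.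
    split; rewrite /shear/= in_itv/= ?t0/= ?h1//.
    rewrite /T ler_pdivlMr// -[leLHS]ger0_norm ?mulr_ge0//; last exact: ltW.
    rewrite normrM normr_id mulrC -normrM.
    have -> : c * t = (x + c * t) - x by ring.
    apply: le_trans (ler_normB _ _) _; rewrite -addrA.
    rewrite (ger0_norm (ltW h1)); apply: lerD; first exact: ltW.
    case/andP: axb => ax xb; rewrite ler_norml.
    have := ler_norm b; have := ler_norm (- a); rewrite normrN.
    have := normr_ge0 a; have := normr_ge0 b.
    by move=> *; apply/andP; split; lra.
  rewrite !memNset// => -[/=]; rewrite !in_itv/=.
  by move=> /andP[t0 _] h; apply: nR; apply/char_regionP.
have [Hi _] := integrable_section_integral Gi.
have DHi : mu.-integrable `[a, b] (EFin \o (fun x => delta^-1 * \int[mu]_t G (t, x))).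
  have h := integrableZl measurableT delta^-1 Hi.
  have : mu.-integrable setT (EFin \o (fun x => delta^-1 * \int[mu]_t G (t, x))) by exact: h.
  exact: integrableS.
have mS : measurable_fun `[a, b] (EFin \o section_mean).
  by apply: measurable_funTS; apply/measurable_EFinP; exact: section_mean_measurable.
apply: (@le_integrable _ (measurableTypeR R) R mu _ (measurable_itv `[a, b]) _ _ mS _ DHi) => x /=.
rewrite in_itv/= => axb.
rewrite lee_fin /section_mean (@eq_Rintegral _ _ _ mu setT (fun t => G (t, x))); last first.
  by move=> t _; rewrite GU.
rewrite mulrC !normrM ler_wpM2r//.
have L := hd _ axb; rewrite -(fineK (section_length_fin x)) lee_fin in L.
have L0 : 0 < fine (section_length x) by exact: lt_le_trans L.
by rewrite !ger0_norm ?invr_ge0 ?(ltW L0) ?(ltW d0)// lef_pV2.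
Qed.

(** Weak solutions of the transport equation are functions of x - c t. Nothing
    is claimed about integrability of F near the two values of x - c t whose
    characteristics stay in Omega for a vanishing time. *)
Theorem transport_constant : exists F : R -> R, [/\ measurable_fun setT F,
  {ae mu2, forall z, @Omega R z -> u z = F (z.2 - c * z.1)} &
  forall a b delta : R, 0 < delta ->
    (forall x, a <= x <= b -> (delta%:E <= mu [set t | @Omega R (t, x + c * t)%R])%E) ->
    mu.-integrable `[a, b] (EFin \o F)].
Proof.
exists section_mean; split.
- exact: section_mean_measurable.
- exact: section_mean_ae.
- move=> a b delta d0 h; apply: (section_mean_integrable d0) => x /h.
  rewrite /section_length; congr (_ <= mu _)%E.
  by apply/seteqP; split => t /=; [move=> ?; exact/ysectionP|move/ysectionP].
Qed.

End transport.

(** * One-sided means *)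

Section traces.
Context {R : realType}.
Local Notation mu := (@lebesgue_measure R).
Implicit Types (f g h : R -> R).

Lemma integrable_scale (D : set (measurableTypeR R)) (k : R) f : measurable D ->
  mu.-integrable D (EFin \o f) -> mu.-integrable D (EFin \o (fun x => k * f x)).
Proof. by move=> mD fi; have := integrableZl mD k fi. Qed.

(** Existence of the one-sided mean of f at p along s |-> p + c s, with limit
    f p. The slopes in use are 1 and -1 at the ends of a line, and 1/tau and
    -1/tau at time 0. *)
Definition trace_pt f (p c : R) : Prop :=
  (exists2 d, 0 < d & mu.-integrable `[0, d] (EFin \o (f \o affine c p))) /\
  e^-1 * \int[mu]_(s in `[0, e]) f (affine c p s) @[e --> 0^'+] --> f p.

Lemma cvg_dnbhs0_scale (c : R) : c != 0 -> c * e @[e --> 0^'+] --> 0^'.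
Proof.
move=> c0 A [d /= d0 dA]; have cn : 0 < `|c| by rewrite normr_gt0.
have d1 : 0 < d / `|c| by exact: divr_gt0.
suff : \forall e \near 0^'+, A (c * e) by [].
near=> e; apply: dA => /=.
  by rewrite sub0r normrN normrM mulrC -ltr_pdivlMr// ger0_norm.
by rewrite mulf_neq0// gt_eqF.
Unshelve. all: by end_near. Qed.

Lemma restrict_affine f (c x : R) (i j : interval R) :
  (forall s, (s \in i) = (affine c x s \in j)) ->
  (f \o affine c x) \_ [set` i] = (f \_ [set` j]) \o affine c x.
Proof.
by move=> ij; apply/funext => s; rewrite /= !patchE !mem_setE ij.
Qed.

(** Where the primitive of f is differentiable with derivative f, the one-
    sided means converge for all slopes at once: they are difference quotients
    of the primitive. *)
Lemma ae_trace_pt f (a b : R) : a < b -> mu.-integrable `[a, b] (EFin \o f) ->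
  {ae mu, forall x, a < x < b -> forall c, c != 0 -> trace_pt f x c}.
Proof.
move=> ab fi.
pose fab := f \_ `[a, b].
have fabi : mu.-integrable setT (EFin \o fab).
  by rewrite -restrict_EFin; apply/(integrable_mkcond _ _).1.
have hiS (i : interval R) : mu.-integrable [set` i] (EFin \o fab).
  by exact: integrableS fabi.
pose F y := \int[mu]_(t in [set` Interval (BLeft a) (BRight y)]) fab t.
have locf : locally_integrable [set: R] fab.
  by apply: open_integrable_locally => //; exact: openT.
have FB y y' : a <= y -> y <= y' -> \int[mu]_(t in `[y, y']) fab t = F y' - F y.
  move=> ay yy'; rewrite -Rintegral_itv_obnd_cbnd//.
  by rewrite /F Rintegral_itvB.
have := @FTC1 R fab (BLeft a) (fun y => hiS _) locf.
apply: ae_imply => x Hx /andP[ax xb] c c0.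
have [dF F'x] : derivable F x 1 /\ derive1 F x = fab x by apply: Hx; rewrite lte_fin.
have fabx : fab x = f x by rewrite /fab patchE mem_setE in_itv/= !ltW.
have cn : 0 < `|c| by rewrite normr_gt0.
pose m := Num.min (x - a) (b - x) / `|c|.
have m0 : 0 < m by rewrite divr_gt0// lt_min !subr_gt0 ax.
have near_ab s : 0 <= s <= m -> a <= affine c x s <= b.
  move=> /andP[s0 sm]; have : `|c * s| <= Num.min (x - a) (b - x).
    by rewrite normrM mulrC -ler_pdivlMr// ger0_norm.
  rewrite le_min !ler_norml /affine => /andP[/andP[? ?] /andP[? ?]].
  by apply/andP; split; lra.
have fE e : 0 < e -> e <= m ->
    \int[mu]_(s in `[0, e]) f (affine c x s) = c^-1 * (F (x + c * e) - F x).
  move=> e0 em.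
  rewrite (@eq_Rintegral _ _ _ mu _ (fab \o affine c x)); last first.
    move=> s; rewrite inE/= in_itv/= => /andP[s0 se].
    by rewrite /fab/= patchE mem_setE in_itv/= near_ab// s0 (le_trans se).
  rewrite Rintegral_mkcond.
  have e2 : a <= x + c * e <= b.
    have := near_ab e; rewrite /affine (addrC _ x); apply.
    by rewrite ltW.
  have [c_gt0|c_le0] := ltP 0 c.
    rewrite (@restrict_affine fab c x _ `[x, x + c * e]); last first.
      move=> s; rewrite !in_itv/= /affine -[in RHS](addrC x) lerDl lerD2l.
      by rewrite pmulr_rge0// ler_pM2l.
    rewrite /= (@integral_affine _ c x (fab \_ `[x, x + c * e]))//; last first.
      by rewrite -restrict_EFin; apply/(integrable_mkcond _ _).1 => //; exact: hiS.
    rewrite -Rintegral_mkcond FB; [by rewrite gtr0_norm|exact: ltW|].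
    by rewrite lerDl mulr_ge0// ltW.
  have c_lt0 : c < 0 by rewrite lt_neqAle c0.
  rewrite (@restrict_affine fab c x _ `[x + c * e, x]); last first.
    move=> s; rewrite !in_itv/= /affine -[in RHS](addrC x) gerDl lerD2l.
    by rewrite nmulr_rle0// ler_nM2l// andbC.
  rewrite /= (@integral_affine _ c x (fab \_ `[x + c * e, x]))//; last first.
    by rewrite -restrict_EFin; apply/(integrable_mkcond _ _).1 => //; exact: hiS.
  rewrite -Rintegral_mkcond FB//; last 2 first.
  - by case/andP: e2.
  - by rewrite gerDl mulr_le0_ge0// ltW.
  by rewrite ltr0_norm// invrN mulNr -mulrN opprB.
split.
  exists m => //.
  have h : mu.-integrable setT (EFin \o (fab \o affine c x)) by exact: integrable_affine.
  have {}h : mu.-integrable `[0, m] (EFin \o (fab \o affine c x)) by exact: integrableS h.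
  apply: eq_integrable h => // s; rewrite inE/= in_itv/= => sm.
  by rewrite /fab/= patchE mem_setE in_itv/= near_ab.
have cvgF : (h^-1 *: ((F \o shift x) (h *: (1 : R)) - F x)) @[h --> 0^'] --> fab x.
  by rewrite -F'x derive1E; exact: dF.
have := cvg_comp _ _ (cvg_dnbhs0_scale c0) cvgF.
rewrite fabx; apply: cvg_trans; apply: near_eq_cvg.
near=> e.
have e0 : 0 < e by [].
have em : e <= m by near: e; exact: nbhs_right_le.
rewrite fE// /= /GRing.scale/= mulr1 (addrC (c * e)) invfM.
ring.
Unshelve. all: by end_near. Qed.

(** The means of h see h up to null sets, so the representation of h by f and
    g may hold almost everywhere only. *)
Lemma trace_pt_combine h f g (p q c d al be : R) :
  measurable_fun (`[0, 1]%classic : set R) h -> measurable_fun setT f -> measurable_fun setT g ->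
  trace_pt f p c -> trace_pt g q d ->
  {ae mu, forall s, 0 < s < 1 -> h s = al * f (affine c p s) + be * g (affine d q s)} ->
  e^-1 * \int[mu]_(s in `[0, e]) h s @[e --> 0^'+] --> al * f p + be * g q.
Proof.
move=> mh mf mg [[d1 d10 fi] cf] [[d2 d20 gi] cg] hE.
have c1 : al * (e^-1 * \int[mu]_(s in `[0, e]) f (affine c p s)) @[e --> 0^'+] --> al * f p.
  exact: cvgMl_tmp.
have c2 : be * (e^-1 * \int[mu]_(s in `[0, e]) g (affine d q s)) @[e --> 0^'+] --> be * g q.
  exact: cvgMl_tmp.
have := @cvgD _ _ _ _ _ _ _ _ _ c1 c2.
move=> /(_ _) c12; move: (c12).
apply: cvg_trans; apply: near_eq_cvg; near=> e.
have e0 : 0 < e by [].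
have e1 : e <= 1 by near: e; exact: nbhs_right_le.
have ed1 : e <= d1 by near: e; exact: nbhs_right_le.
have ed2 : e <= d2 by near: e; exact: nbhs_right_le.
have fie : mu.-integrable `[0, e] (EFin \o (f \o affine c p)).
  by apply: integrableS fi => //; apply: subset_itvl; rewrite bnd_simp.
have gie : mu.-integrable `[0, e] (EFin \o (g \o affine d q)).
  by apply: integrableS gi => //; apply: subset_itvl; rewrite bnd_simp.
have mfc : measurable_fun `[0, e] (fun s => al * f (affine c p s)).
  apply: measurable_funM => //; apply: (measurableT_comp mf).
  exact: measurable_affine.
have mgc : measurable_fun `[0, e] (fun s => be * g (affine d q s)).
  apply: measurable_funM => //; apply: (measurableT_comp mg).
  exact: measurable_affine.
have -> : \int[mu]_(s in `[0, e]) h s =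
    \int[mu]_(s in `[0, e]) (al * f (affine c p s) + be * g (affine d q s)).
  rewrite /Rintegral; congr fine; apply: ae_eq_integral => //.
  - apply/measurable_EFinP; apply: measurable_funS mh => //.
    by apply: subset_itvl; rewrite bnd_simp.
  - by apply/measurable_EFinP; exact: measurable_funD.
  have ne0 : {ae mu, forall s, s != 0 /\ s != 1}.
    exact: ae_and (ae_neq _) (ae_neq _).
  apply: ae_imply (ae_and hE ne0) => s [hs [s0 s1]]; rewrite /= in_itv/= => /andP[s0' s1'].
  rewrite hs// !lt_neqAle eq_sym s0 s0' s1/=.
  exact: le_trans e1.
rewrite RintegralD//; last 2 first.
- exact: integrable_scale.
- exact: integrable_scale.
have mI : measurable (`[0, e]%classic : set (measurableTypeR R)) by exact: measurable_itv.
rewrite (RintegralZl al mI fie) (RintegralZl be mI gie) /=.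
rewrite -[LHS]/(al * (e^-1 * \int[mu]_(s in `[0, e]) f (affine c p s)) +
  be * (e^-1 * \int[mu]_(s in `[0, e]) g (affine d q s))).
by rewrite mulrDr (mulrCA al) (mulrCA be).
Unshelve. all: by end_near. Qed.

(** Means at the end x = 1 become means at 0. *)
Lemma Rintegral_reflect h (e : R) : 0 <= e <= 1 -> measurable_fun (`[0, 1]%classic : set R) h ->
  \int[mu]_(s in `[1 - e, 1]) h s = \int[mu]_(s in `[0, e]) h (1 - s).
Proof.
move=> /andP[e0 e1] mh; rewrite Rintegral_mkcond [in RHS]Rintegral_mkcond.
pose H := h \_ `[1 - e, 1].
have -> : (fun s => h (1 - s)) \_ `[0, e] = H \o affine (-1) 1.
  apply/funext => s; rewrite /H /= !patchE !mem_setE !in_itv/= /affine.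
  rewrite (_ : -1 * s + 1 = 1 - s); last ring.
  rewrite (_ : (1 - e <= 1 - s <= 1) = (0 <= s <= e))//.
  by rewrite lerD2l lerN2 gerBl andbC.
have mH : measurable_fun setT (EFin \o H).
  apply/measurable_EFinP; apply/(measurable_restrictT _ _).1 => //.
  apply: measurable_funS mh => //.
  by apply: subset_itvr; rewrite bnd_simp subr_ge0.
have N1 : (-1 : R) != 0 by rewrite oppr_eq0 oner_eq0.
have A1 := @ge0_integral_affine R (-1) 1 (EFin \o H)^\+%E N1 (measurable_funepos mH)
    (fun=> funepos_ge0 _ _).
have A2 := @ge0_integral_affine R (-1) 1 (EFin \o H)^\-%E N1 (measurable_funeneg mH)
    (fun=> funeneg_ge0 _ _).
rewrite normrN1 invr1 mul1e in A1; rewrite normrN1 invr1 mul1e in A2.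
rewrite /Rintegral integralE [in RHS]integralE -A1 -A2.
by congr (fine (_ - _)%E); apply: eq_integral => s _; rewrite ?funeposE ?funenegE.
Qed.

End traces.

(** * Travelling waves on one line *)

Section test_function_bounds.
Context {R : realType}.
Local Notation mu := (@lebesgue_measure R).
Local Notation mu2 := (mu \x mu)%E.
Implicit Types (phi : R * R -> R).

Lemma derive_out_support phi v z : ~ closure [set z | phi z != 0] z ->
  'D_v phi z = 0.
Proof.
move=> nz.
have : nbhs z (~` closure [set z | phi z != 0]).
  by apply: open_nbhs_nbhs; split=> //; apply: closed_openC; exact: closed_closure.
move=> hn.
have D0 : is_derive z v phi 0.
  apply: (@near_eq_is_derive _ _ _ (cst 0)).
  apply: filterS hn => y ny /=.
  apply/esym/eqP; apply: contraT => py; case: ny; exact: subset_closure.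
by have [_ ->] := D0.
Qed.

Lemma test_function_bounds phi : test_function phi -> exists B T : R,
  [/\ 0 < T, (forall z, `|dt phi z| <= B), (forall z, `|dx phi z| <= B) &
   forall z, @Omega R z -> T < z.1 -> dt phi z = 0 /\ dx phi z = 0].
Proof.
move=> [sphi cS SO]; set S := closure _ in cS SO.
have bounded (psi : R * R -> R) : continuous psi -> (forall z, ~ S z -> psi z = 0) ->
    exists B, forall z, `|psi z| <= B.
  move=> cpsi psi0.
  have := @compact_bounded _ _ _ (continuous_compact (continuous_subspaceT cpsi) cS).
  move=> [M [_ hM]]; exists (`|M| + 1) => z.
  have [Sz|nSz] := pselect (S z); last by rewrite psi0// normr0 addr_ge0.
  have MM : M < `|M| + 1 by rewrite (le_lt_trans (ler_norm M))// ltrDl.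
  by apply: (hM _ MM); exists z.
have [B1 hB1] : exists B, forall z, `|dt phi z| <= B.
  apply: bounded; first by have [] := sphi [:: false].
  by move=> z; exact: derive_out_support.
have [B2 hB2] : exists B, forall z, `|dx phi z| <= B.
  apply: bounded; first by have [] := sphi [:: true].
  by move=> z; exact: derive_out_support.
have := @compact_bounded _ _ _ (continuous_compact (f := fst) (A := S) (continuous_subspaceT _) cS).
move=> /(_ _)/wrap[z|[M [_ hM]]]; first exact: cvg_fst.
exists (Num.max B1 B2), (`|M| + 1); split.
- by rewrite ltr_wpDl.
- by move=> z; rewrite (le_trans (hB1 z))// le_max lexx.
- by move=> z; rewrite (le_trans (hB2 z))// le_max lexx orbT.
- move=> z Oz Tz; suff nS : ~ S z by split; exact: derive_out_support.
  move=> Sz; have MM : M < `|M| + 1 by rewrite (le_lt_trans (ler_norm M))// ltrDl.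
  have := hM _ MM z.1; rewrite /= => /(_ _)/wrap[|h]; first by exists z.
  by have := lt_le_trans Tz (le_trans (ler_norm _) h); rewrite ltxx.
Qed.

Definition plane_strip (T : R) : set (R * R) := `[0, T] `*` `[0, 1].

Lemma plane_strip_measurable (T : R) :
  measurable (plane_strip T : set (measurableTypeR R * measurableTypeR R)).
Proof. by apply: measurableX; exact: measurable_itv. Qed.

Lemma Omega_bar_measurable :
  measurable (@Omega_bar R : set (measurableTypeR R * measurableTypeR R)).
Proof. by apply: measurableX; exact: measurable_itv. Qed.

Lemma plane_strip_Omega_bar (T : R) : plane_strip T `<=` @Omega_bar R.
Proof.
by move=> z [/=]; rewrite !in_itv/= => /andP[z1 _] z2; split; rewrite /= in_itv/= ?z1.
Qed.

(** Test functions vanish at late times, so that integrability on strips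
    suffices. *)
Lemma test_integrable (h psi : R * R -> R) (B T : R) :
  (forall T, mu2.-integrable (plane_strip T) (EFin \o h)) ->
  continuous psi -> (forall z, `|psi z| <= B) ->
  (forall z, @Omega R z -> T < z.1 -> psi z = 0) ->
  mu2.-integrable (@Omega R) (EFin \o (fun z => h z * psi z)).
Proof.
move=> hi cpsi psiB psi0.
pose G z := (h \_ (plane_strip T)) z * psi z.
have mS : measurable (plane_strip T) by exact: measurableX.
have Gi : mu2.-integrable setT (EFin \o G).
  apply: (@integrable_mul_bounded2 _ _ psi B) => //.
    by rewrite -restrict_EFin; apply/(integrable_mkcond _ _).1 => //; exact: hi.
  exact: continuous_measurable_plane.
have Gi' : mu2.-integrable (@Omega R) (EFin \o G).
  by apply: integrableS Gi => //; exact: Omega_measurable.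
apply: eq_integrable Gi'; first exact: Omega_measurable.
move=> z; rewrite inE => Oz; rewrite /= /G patchE; congr EFin.
have [zT|zT] := leP z.1 T; last by rewrite psi0// !mulr0.
rewrite mem_set//; case: Oz; rewrite /= !in_itv/= andbT => z1 /andP[z2 z3].
by split; rewrite /= in_itv/=; apply/andP; split=> //; exact: ltW.
Qed.

End test_function_bounds.

Section line.
Context {R : realType}.
Local Notation mu := (@lebesgue_measure R).
Local Notation mu2 := (mu \x mu)%E.
Variables (L C : R) (v i : R -> R -> R).
Hypotheses (L0 : 0 < L) (C0 : 0 < C).
Local Notation tau := (Num.sqrt (L * C)).
Local Notation K := (Num.sqrt (C / L)).
Hypothesis v_meas : measurable_fun (@Omega_bar R) (fun z : R * R => v z.1 z.2).
Hypothesis i_meas : measurable_fun (@Omega_bar R) (fun z : R * R => i z.1 z.2).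
Hypothesis v_int : forall T, mu2.-integrable (plane_strip T) (EFin \o (fun z => v z.1 z.2)).
Hypothesis i_int : forall T, mu2.-integrable (plane_strip T) (EFin \o (fun z => i z.1 z.2)).
Hypothesis telegrapher : forall phi : R * R -> R, test_function phi ->
  \int[mu2]_(z in @Omega R) (L * i z.1 z.2 * dt phi z + v z.1 z.2 * dx phi z) = 0 /\
  \int[mu2]_(z in @Omega R) (C * v z.1 z.2 * dt phi z + i z.1 z.2 * dx phi z) = 0.

Lemma tau_gt0 : 0 < tau. Proof. by rewrite sqrtr_gt0 mulr_gt0. Qed.

Lemma K_gt0 : 0 < K. Proof. by rewrite sqrtr_gt0 divr_gt0. Qed.

Lemma tauK : tau * K = C.
Proof.
rewrite -sqrtrM ?mulr_ge0 ?ltW//.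
rewrite (_ : L * C * (C / L) = C ^+ 2); last by field; rewrite gt_eqF.
by rewrite sqrtr_sqr gtr0_norm.
Qed.

Lemma tau_divK : tau / K = L.
Proof.
have K0 := K_gt0.
have KK : K ^+ 2 = C / L by rewrite sqr_sqrtr// ltW// divr_gt0.
apply: (mulIf (x := K ^+ 2)); first by rewrite expf_neq0// gt_eqF.
rewrite {2}KK expr2 mulrA divfK ?gt_eqF// tauK; field.
by rewrite gt_eqF.
Qed.

(** This is sg/tau times the equation of the current plus 1/(tau K) times the
    equation of the voltage, with L = tau/K, C = tau K and sg = 1 or -1. *)
Lemma wave_weak (sg : R) : sg ^+ 2 = 1 -> forall phi, test_function phi ->
  \int[mu2]_(z in @Omega R) ((v z.1 z.2 + sg * K^-1 * i z.1 z.2) *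
     (dt phi z + (sg / tau) * dx phi z)) = 0.
Proof.
move=> sg2 phi tphi; have [E1 E2] := telegrapher tphi.
have [B [T [T0 dtB dxB out]]] := test_function_bounds tphi.
have [sphi _ _] := tphi.
have cdt : continuous (dt phi) by have [] := sphi [:: false].
have cdx : continuous (dx phi) by have [] := sphi [:: true].
have K0 := K_gt0; have t0 := tau_gt0.
have it := test_integrable i_int cdt dtB (fun z Oz Tz => (out z Oz Tz).1).
have ix := test_integrable i_int cdx dxB (fun z Oz Tz => (out z Oz Tz).2).
have vt := test_integrable v_int cdt dtB (fun z Oz Tz => (out z Oz Tz).1).
have vx := test_integrable v_int cdx dxB (fun z Oz Tz => (out z Oz Tz).2).
have mO : measurable (@Omega R : set (measurableTypeR R * measurableTypeR R)) by exact:
    Omega_measurable.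
have e1 : mu2.-integrable (@Omega R)
    (EFin \o (fun z => L * i z.1 z.2 * dt phi z + v z.1 z.2 * dx phi z)).
  have := integrableD mO (integrableZl mO L it) vx.
  by apply: eq_integrable => // z _; rewrite /= -EFinM -EFinD mulrA.
have e2 : mu2.-integrable (@Omega R)
    (EFin \o (fun z => C * v z.1 z.2 * dt phi z + i z.1 z.2 * dx phi z)).
  have := integrableD mO (integrableZl mO C vt) ix.
  by apply: eq_integrable => // z _; rewrite /= -EFinM -EFinD mulrA.
transitivity (\int[mu2]_(z in @Omega R)
  ((sg / tau) * (L * i z.1 z.2 * dt phi z + v z.1 z.2 * dx phi z) +
   (tau * K)^-1 * (C * v z.1 z.2 * dt phi z + i z.1 z.2 * dx phi z))).
  apply: eq_Rintegral => z _.
  have sgV : sg * sg = 1 by rewrite -expr2.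
  move: tauK tau_divK K0 t0; generalize K tau => k t hC hL k0 t0.
  rewrite -hC -hL.
  set x1 := v z.1 z.2; set x2 := i z.1 z.2; set d1 := dt phi z; set d2 := dx phi z.
  have -> : sg / t * (t / k * x2 * d1 + x1 * d2) +
      (t * k)^-1 * (t * k * x1 * d1 + x2 * d2) =
      sg / k * x2 * d1 + sg / t * x1 * d2 + x1 * d1 + (t * k)^-1 * x2 * d2.
    by field; rewrite !gt_eqF.
  have -> : (t * k)^-1 = sg * sg * (t * k)^-1 by rewrite sgV mul1r.
  by field; rewrite !gt_eqF.
rewrite RintegralD//; last 2 first.
- by have := integrableZl mO (sg / tau) e1.
- by have := integrableZl mO (tau * K)^-1 e2.
by rewrite !RintegralZl// E1 E2 !mulr0 addr0.
Qed.

Lemma section_lower_bound (c x l r delta : R) : delta <= r - l -> 0 <= l ->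
  (forall t, l < t < r -> 0 < x + c * t < 1) ->
  (delta%:E <= mu [set t | @Omega R (t, x + c * t)%R])%E.
Proof.
move=> dlr l0 h.
apply: (@le_trans _ _ (mu `]l, r[%classic)).
  rewrite lebesgue_measure_itv/= lte_fin; case: ltP => [_|rl]; first by rewrite -EFinB lee_fin.
  by rewrite lee_fin (le_trans dlr)// subr_le0.
apply: le_measure; rewrite ?inE//.
  apply: open_measurable.
  rewrite (_ : mkset _ = [set t | 0 < t] `&` [set t | x + c * t \in `]0, 1[]).
    apply: openI; first exact: open_gt.
    apply: (@open_comp _ _ (fun t : R => x + c * t) (`]0, 1[%classic)); last first.
      exact: interval_open.
    by move=> t _; apply: cvgD; [exact: cvg_cst|apply: cvgM; [exact: cvg_cst|exact: cvg_id]].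
  by apply/seteqP; split => t; rewrite /Omega/= !in_itv/= andbT.
move=> t /=; rewrite in_itv/= => tt; split => /=; rewrite in_itv/=.
  by rewrite andbT (le_lt_trans l0)//; case/andP: tt.
exact: h.
Qed.

(** The waves f and g are half of v + i/K and of v - i/K. The characteristics
    x - t/tau = xi leave Omega quickly when xi is close to 1, and so do x +
    t/tau = xi for xi close to 0; there the local integrability of f and g
    will follow from the initial data. *)
Theorem line_decomposition : exists f g : R -> R,
  [/\ measurable_fun setT f, measurable_fun setT g,
   {ae mu2, forall z : R * R, @Omega R z ->
      v z.1 z.2 = f (z.2 - z.1 / tau) + g (z.2 + z.1 / tau) /\
      i z.1 z.2 = K * (f (z.2 - z.1 / tau) - g (z.2 + z.1 / tau))},
   forall a b, b < 1 -> mu.-integrable `[a, b] (EFin \o f) &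
   forall a b, 0 < a -> mu.-integrable `[a, b] (EFin \o g)].
Proof.
have K0 := K_gt0; have t0 := tau_gt0.
have mO : measurable (@Omega R : set (measurableTypeR R * measurableTypeR R)) by exact:
    Omega_measurable.
have OO : @Omega R `<=` @Omega_bar R.
  by move=> z [/= ]; rewrite !in_itv/= !andbT => /ltW z1 /andP[/ltW z2 /ltW z3]; split => /=;
      rewrite in_itv/= ?andbT// z2.
have mOb := @Omega_bar_measurable R.
have wave (sg : R) : sg ^+ 2 = 1 -> exists F : R -> R, [/\ measurable_fun setT F,
    {ae mu2, forall z, @Omega R z ->
      v z.1 z.2 + sg * K^-1 * i z.1 z.2 = F (z.2 - (sg / tau) * z.1)} &
    forall a b delta : R, 0 < delta ->
    (forall x, a <= x <= b -> (delta%:E <= mu [set t | @Omega R (t, x + (sg / tau) * t)%R])%E) ->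
    mu.-integrable `[a, b] (EFin \o F)].
  move=> sg2; apply: (@transport_constant R (sg / tau)
      (fun z => v z.1 z.2 + sg * K^-1 * i z.1 z.2)).
  - have t1 : tau != 0 by rewrite gt_eqF.
    rewrite mulf_neq0 ?invr_eq0//; apply/eqP => sg0.
    by move: sg2; rewrite sg0 expr0n/= => /eqP; rewrite eq_sym oner_eq0.
  - apply: measurable_funS OO _ => //.
    by apply: measurable_funD => //; apply: measurable_funM.
  - move=> T.
    have mS := @plane_strip_measurable R T.
    have h : mu2.-integrable (plane_strip T)
        (EFin \o (fun z : R * R => v z.1 z.2 + sg * K^-1 * i z.1 z.2)).
      by have := integrableD mS (v_int T) (integrableZl mS (sg * K^-1) (i_int T)).
    have mB : measurable ((`]0, T] `*` `]0, 1[) : set (measurableTypeR R * measurableTypeR R)).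
      by apply: measurableX; exact: measurable_itv.
    apply: (integrableS mS mB _ h).
    by move=> z [] /=; rewrite !in_itv/= => /andP[/ltW z1 z2] /andP[/ltW z3 /ltW z4]; split;
        rewrite /= in_itv/= ?z1 ?z3.
  - exact: wave_weak.
have [F1 [mF1 eF1 iF1]] := wave 1 (expr1n _ _).
have [F2 [mF2 eF2 iF2]] := wave (-1) (sqrr_sign _ 1).
exists (fun x => 2^-1 * F1 x), (fun x => 2^-1 * F2 x); split.
- exact: measurable_funM.
- exact: measurable_funM.
- apply: ae_imply (ae_and eF1 eF2) => z [h1 h2] Oz.
  move: (h1 Oz) (h2 Oz); rewrite div1r mul1r mulN1r mulN1r !mulNr opprK ![tau^-1 * _]mulrC => <- <-.
  by split; field; rewrite gt_eqF.
- move=> a b b1; apply: integrable_scale => //.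
  apply: (iF1 _ _ (Num.min (tau * (1 - b)) tau)).
    by rewrite lt_min t0 andbT mulr_gt0// subr_gt0.
  move=> x /andP[ax xb]; rewrite div1r.
  (* The characteristic x + t/tau stays in ]0, 1[ for - x tau < t < tau (1 -
     x). *)
  apply: (@section_lower_bound _ _ (Num.max 0 (- x * tau)) (tau * (1 - x))).
  + have [x0|x0] := leP (- x * tau) 0.
      by rewrite subr0 ge_min ler_pM2l// lerD2l lerN2 xb.
    by rewrite ge_min; apply/orP; right; lra.
  + by rewrite le_max lexx.
  + move=> t /andP[]; rewrite gt_max => /andP[t_gt0 xt] tx.
    have -> : x + tau^-1 * t = (x * tau + t) / tau by field; rewrite gt_eqF.
    by rewrite divr_gt0 ?ltr_pdivrMr//; [|lra]; lra.
- move=> a b a0; apply: integrable_scale => //.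
  apply: (iF2 _ _ (Num.min (tau * a) tau)).
    by rewrite lt_min t0 andbT mulr_gt0.
  move=> x /andP[ax xb]; rewrite mulN1r.
  (* The characteristic x - t/tau stays in ]0, 1[ for (x - 1) tau < t < tau x.
     *)
  apply: (@section_lower_bound _ _ (Num.max 0 ((x - 1) * tau)) (tau * x)).
  + have [x0|x0] := leP ((x - 1) * tau) 0.
      by rewrite subr0 ge_min ler_pM2l// ax.
    by rewrite ge_min; apply/orP; right; lra.
  + by rewrite le_max lexx.
  + move=> t /andP[]; rewrite gt_max => /andP[t_gt0 xt] tx.
    have -> : x + - tau^-1 * t = (x * tau - t) / tau by field; rewrite gt_eqF.
    by rewrite divr_gt0 ?ltr_pdivrMr//; [|lra]; lra.
Qed.

End line.

(** * Boundary and initial values on one line *)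

Section line_traces.
Context {R : realType}.
Local Notation mu := (@lebesgue_measure R).
Local Notation mu2 := (mu \x mu)%E.

Lemma rat_between (S : set R) (x : R) : open S -> S x ->
  exists p q : rat, [/\ S (ratr p), S (ratr q) & ratr p < x < ratr q].
Proof.
move=> oS Sx; have [d /= d0 dS] := oS _ Sx.
have [p] := @rat_in_itvoo R (x - d) x ltac:(lra).
have [q] := @rat_in_itvoo R x (x + d) ltac:(lra).
rewrite !in_itv/= => /andP[xq qd] /andP[dp px].
exists p, q; split; last by rewrite px.
  by apply: dS => /=; rewrite gtr0_norm; lra.
by apply: dS => /=; rewrite ltr0_norm; lra.
Qed.

(** Countably many rational intervals cover an open set. *)
Lemma ae_trace_pt_open (S : set R) (f : R -> R) : open S ->
  (forall a b, S a -> S b -> mu.-integrable `[a, b] (EFin \o f)) ->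
  {ae mu, forall x, S x -> forall c, c != 0 -> trace_pt f x c}.
Proof.
move=> oS fi.
have := @ae_countable _ _ _ mu (rat * rat)%type (fun pq x => S (ratr pq.1) ->
  S (ratr pq.2) -> ratr pq.1 < x < ratr pq.2 -> forall c, c != 0 -> trace_pt f x c).
move=> /(_ _)/wrap[[p q] /=|].
  have [pq|qp] := ltP (ratr p : R) (ratr q); last first.
    apply: ae_all => x _ _ /andP[px xq].
    by have := lt_le_trans (lt_trans px xq) qp; rewrite ltxx.
  have [Sp|nSp] := pselect (S (ratr p)); last by apply: ae_all.
  have [Sq|nSq] := pselect (S (ratr q)); last by apply: ae_all.
  by apply: ae_imply (ae_trace_pt pq (fi _ _ Sp Sq)) => x hx _ _.
apply: ae_imply => x hx Sx c c0.
have [p [q [Sp Sq pxq]]] := rat_between oS Sx.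
exact: (hx (p, q)).
Qed.

Variables (tau al be : R) (h : R -> R -> R) (f g : R -> R).
Hypothesis t0 : 0 < tau.
Hypothesis h_meas : measurable_fun (@Omega_bar R) (fun z : R * R => h z.1 z.2).
Hypotheses (f_meas : measurable_fun setT f) (g_meas : measurable_fun setT g).
Hypothesis h_wave : {ae mu2, forall z : R * R, @Omega R z ->
  h z.1 z.2 = al * f (z.2 - z.1 / tau) + be * g (z.2 + z.1 / tau)}.
Hypothesis f_loc : forall a b, b < 1 -> mu.-integrable `[a, b] (EFin \o f).
Hypothesis g_loc : forall a b, 0 < a -> mu.-integrable `[a, b] (EFin \o g).

Lemma ae_trace_f : {ae mu, forall x, x < 1 -> forall c, c != 0 -> trace_pt f x c}.
Proof.
apply: (@ae_trace_pt_open [set x | x < 1]); first exact: open_lt.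
by move=> a b _; exact: f_loc.
Qed.

Lemma ae_trace_g : {ae mu, forall x, 0 < x -> forall c, c != 0 -> trace_pt g x c}.
Proof.
apply: (@ae_trace_pt_open [set x | 0 < x]); first exact: open_gt.
by move=> a b a0 _; exact: g_loc.
Qed.

Lemma measurable_xslice t : 0 <= t ->
  measurable_fun (`[0, 1]%classic : set R) (fun x : R => h t x).
Proof.
move=> t_ge0.
have mO := @Omega_bar_measurable R.
apply: (@measurable_comp _ _ _ _ _ _ (@Omega_bar R) (fun z : R * R => h z.1 z.2) _
    (fun x => (t, x)) mO) => //.
  by move=> _ [x xI <-]; split => //=; rewrite in_itv/= t_ge0.
exact: measurable_funTS (measurable_pair1 t).
Qed.

Lemma measurable_tslice x : 0 <= x <= 1 ->
  measurable_fun (`[0, 1]%classic : set R) (fun t : R => h t x).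
Proof.
move=> x01.
have mO := @Omega_bar_measurable R.
apply: (@measurable_comp _ _ _ _ _ _ (@Omega_bar R) (fun z : R * R => h z.1 z.2) _
    (fun t => (t, x)) mO) => //.
  by move=> _ [t + <-]; rewrite /= in_itv/= => /andP[t_ge0 _]; split => //=; rewrite in_itv/=
      ?t_ge0.
exact: measurable_funTS (measurable_pair2 x).
Qed.

(** For almost every t, both - t/tau and t/tau are points where the means of f
    and g converge, since affine maps preserve null sets. *)
Lemma line_mean_x0 : {ae mu, forall t, 0 < t ->
  mean_x0 h t e @[e --> 0^'+] --> al * f (- t / tau) + be * g (t / tau)}.
Proof.
have Vt0 : tau^-1 != 0 by rewrite invr_eq0 gt_eqF.
have nVt0 : - tau^-1 != 0 by rewrite oppr_eq0.
have F1 := ae_affine 0 nVt0 ae_trace_f.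
have G1 := ae_affine 0 Vt0 ae_trace_g.
apply: ae_imply (ae_and (ae_and F1 G1) (ae_xsection h_wave)) => t [[Ft Gt] Ht] t_gt0.
have E1 : affine (- tau^-1) 0 t = - t / tau by rewrite /affine addr0; ring.
have E2 : affine tau^-1 0 t = t / tau by rewrite /affine addr0; ring.
rewrite E1 in Ft; rewrite E2 in Gt.
apply: (@trace_pt_combine _ (h t) f g (- t / tau) (t / tau) 1 1) => //.
- by apply: measurable_xslice; exact: ltW.
- apply: Ft; last exact: oner_neq0.
  by rewrite mulNr (@lt_trans _ _ 0)// oppr_lt0 divr_gt0.
- by apply: Gt; [rewrite divr_gt0|exact: oner_neq0].
- apply: ae_imply Ht => s hs s01.
  rewrite (hs _)/=; last by split; rewrite /= in_itv/= ?andbT.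
  by rewrite /affine !mul1r mulNr.
Qed.

(** As at the end x = 0, after the reflection s |-> 1 - s. *)
Lemma line_mean_x1 : {ae mu, forall t, 0 < t ->
  mean_x1 h t e @[e --> 0^'+] --> al * f (1 - t / tau) + be * g (1 + t / tau)}.
Proof.
have Vt0 : tau^-1 != 0 by rewrite invr_eq0 gt_eqF.
have nVt0 : - tau^-1 != 0 by rewrite oppr_eq0.
have F1 := ae_affine 1 nVt0 ae_trace_f.
have G1 := ae_affine 1 Vt0 ae_trace_g.
have N1 : (-1 : R) != 0 by rewrite oppr_eq0 oner_eq0.
apply: ae_imply (ae_and (ae_and F1 G1) (ae_xsection h_wave)) => t [[Ft Gt] Ht] t_gt0.
have E1 : affine (- tau^-1) 1 t = 1 - t / tau by rewrite /affine; ring.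
have E2 : affine tau^-1 1 t = 1 + t / tau by rewrite /affine; ring.
rewrite E1 in Ft; rewrite E2 in Gt.
have tt0 : 0 < t / tau by rewrite divr_gt0.
have mh : measurable_fun (`[0, 1]%classic : set R) (fun x : R => h t x).
  by apply: measurable_xslice; exact: ltW.
have := @trace_pt_combine _ (fun s => h t (1 - s)) f g (1 - t / tau) (1 + t / tau) (-1) (-1) al be.
move=> /(_ _ f_meas g_meas _ _ _)/wrap[].
- have mI : measurable (`[0, 1]%classic : set (measurableTypeR R)) by exact: measurable_itv.
  have mr : measurable_fun (`[0, 1]%classic : set R) (fun s : R => 1 - s) by exact: measurable_funB.
  apply: (measurable_comp mI _ mh mr).
  by move=> _ [s + <-]; rewrite /= !in_itv/=; lra.
- by apply: Ft => //; lra.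
- by apply: Gt => //; lra.
- apply: ae_imply (ae_affine 1 N1 Ht) => s hs s01.
  have E3 : affine (-1) 1 s = 1 - s by rewrite /affine; ring.
  rewrite E3 in hs.
  rewrite (hs _)/=; last by split; rewrite /= in_itv/= ?andbT//; lra.
  by congr (_ * f _ + _ * g _); rewrite /affine; ring.
apply: cvg_trans; apply: near_eq_cvg; near=> e.
rewrite /mean_x1 Rintegral_reflect//.
by apply/andP; split; [exact: ltW|near: e; exact: nbhs_right_le].
Unshelve. all: by end_near. Qed.

Lemma line_mean_t0 : {ae mu, forall x, 0 < x < 1 ->
  mean_t0 h x e @[e --> 0^'+] --> al * f x + be * g x}.
Proof.
have Vt0 : tau^-1 != 0 by rewrite invr_eq0 gt_eqF.
have nVt0 : - tau^-1 != 0 by rewrite oppr_eq0.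
apply: ae_imply (ae_and (ae_and ae_trace_f ae_trace_g) (ae_ysection h_wave)) => x [[Fx Gx] Hx]
    /andP[x0 x1].
apply: (@trace_pt_combine _ (fun t => h t x) f g x x (- tau^-1) tau^-1) => //.
- by apply: measurable_tslice; rewrite !ltW.
- exact: Fx.
- exact: Gx.
- apply: ae_imply Hx => s hs /andP[s0 s1].
  rewrite (hs _)/=; last by split; rewrite /= in_itv/= ?andbT// x0.
  by congr (_ * f _ + _ * g _); rewrite /affine; ring.
Qed.

End line_traces.

(** * The wave form of a solution *)

Section network_core.
Context {R : realType}.
Local Notation mu := (@lebesgue_measure R).
Local Notation mu2 := (mu \x mu)%E.

Lemma integrable_dominated_ae (D : set (measurableTypeR R)) (f G : R -> R) :
  measurable D -> measurable_fun setT f ->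
  mu.-integrable setT (EFin \o G) -> {ae mu, forall x, D x -> `|f x| <= G x} ->
  mu.-integrable D (EFin \o f).
Proof.
move=> mD mf Gi fG; apply/integrableP; split.
  by apply/measurable_EFinP; exact: measurable_funTS.
have GiD : mu.-integrable D (EFin \o G) by exact: integrableS Gi.
have /integrableP[mG Gfin] := GiD.
apply: le_lt_trans Gfin; apply: ae_ge0_le_integral => //.
- by apply/measurable_EFinP; apply: measurableT_comp => //; exact: measurable_funTS.
- by apply: measurableT_comp.
- apply: ae_imply fG => x fGx Dx; rewrite /= lee_fin.
  by rewrite (le_trans (fGx Dx))// ler_norm.
Qed.

(** Completes the local integrability of the waves: near 1 for f and near 0
    for g they are combinations of the initial data. *)
Lemma integrable_extend (a b c d : R) (f G : R -> R) : measurable_fun setT f ->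
  mu.-integrable `[a, b] (EFin \o f) -> mu.-integrable `[c, d] (EFin \o G) ->
  {ae mu, forall x, c < x < d -> f x = G x} -> forall p q,
  (forall x, p <= x <= q -> a <= x <= b \/ c <= x <= d) ->
  mu.-integrable `[p, q] (EFin \o f).
Proof.
move=> mf fi Gi fG p q pq.
apply: (@integrable_dominated_ae _ f
  (fun x => `|(f \_ `[a, b]) x| + `|(G \_ `[c, d]) x|)) => //.
  have restr (u : R -> R) x y : mu.-integrable `[x, y] (EFin \o u) ->
      mu.-integrable setT (EFin \o (fun t => `|(u \_ `[x, y]) t|)).
    move=> ui; apply: integrable_norm.
    by rewrite -restrict_EFin; apply/(integrable_mkcond _ _).1.
  exact: integrableD (restr _ _ _ fi) (restr _ _ _ Gi).
have ne : {ae mu, forall s, s != c /\ s != d} by exact: ae_and (ae_neq _) (ae_neq _).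
apply: ae_imply (ae_and fG ne) => x [fGx [xc xd]] /=; rewrite in_itv/= => /pq.
have [|nab [//|cd]] := boolP (a <= x <= b).
  by move=> ab _; rewrite patchE mem_setE in_itv/= ab lerDl.
have -> : (G \_ `[c, d]) x = G x by rewrite patchE mem_setE in_itv/= cd.
rewrite fGx ?lerDr//.
by move: cd; rewrite !lt_neqAle (eq_sym c) xc xd.
Qed.

Variables (N : nat) (L C : 'I_N -> R) (A : R -> 'M[R]_(N + N)).
Hypotheses (L0 : forall k, 0 < L k) (C0 : forall k, 0 < C k).
Variables (v i : R -> R -> 'cV[R]_N) (v0 i0 : R -> 'cV[R]_N).
Hypothesis v_meas : forall k, measurable_fun (@Omega_bar R) (fun z : R * R => v z.1 z.2 k ord0).
Hypothesis i_meas : forall k, measurable_fun (@Omega_bar R) (fun z : R * R => i z.1 z.2 k ord0).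
Hypothesis v_int : forall k T, mu2.-integrable (plane_strip T)
    (EFin \o (fun z => v z.1 z.2 k ord0)).
Hypothesis i_int : forall k T, mu2.-integrable (plane_strip T)
    (EFin \o (fun z => i z.1 z.2 k ord0)).
Hypothesis v0_int : forall k, mu.-integrable `[0, 1] (EFin \o (fun x => v0 x k ord0)).
Hypothesis i0_int : forall k, mu.-integrable `[0, 1] (EFin \o (fun x => i0 x k ord0)).
Hypothesis sol : network_solution L C A v i v0 i0.

Local Notation tau := (tau L C).
Local Notation K := (Kadm L C).

(** Limits are unique, so the traces in the boundary and initial conditions
    can be replaced by the values of f and g. The initial data then make f
    integrable up to 1 and g integrable from 0 on. *)
Theorem network_decomposition : exists f g : 'I_N -> R -> R,
  [/\ (forall k, measurable_fun setT (f k)), (forall k, measurable_fun setT (g k)),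
   wave_form L C v i f g,
   {ae mu, forall t, 0 < t ->
      col_mx (\col_k (f k (- t / tau k) + g k (t / tau k)))
             (\col_k (f k (1 - t / tau k) + g k (1 + t / tau k))) =
      A t *m col_mx (- \col_k (K k * (f k (- t / tau k) - g k (t / tau k))))
             (\col_k (K k * (f k (1 - t / tau k) - g k (1 + t / tau k))))} &
   {ae mu, forall x, 0 < x < 1 ->
      v0 x = slice_v L C f g 0 x /\ i0 x = slice_i L C f g 0 x}].
Proof.
have tau0 k : 0 < tau k by exact: tau_gt0.
have K0 k : 0 < K k by exact: K_gt0.
have /boolp.choice[f /boolp.choice[g fg]] := fun k => @line_decomposition R (L k) (C k)
    (fun t x => v t x k ord0) (fun t x => i t x k ord0) (L0 k) (C0 k) (v_meas k)
  (i_meas k) (v_int k) (i_int k) (fun phi tphi => sol_distr sol k tphi).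
have fm k : measurable_fun setT (f k) by have [] := fg k.
have gm k : measurable_fun setT (g k) by have [] := fg k.
have f_loc k a b : b < 1 -> mu.-integrable `[a, b] (EFin \o f k) by have [_ _ _ h _] := fg k;
    exact: h.
have g_loc k a b : 0 < a -> mu.-integrable `[a, b] (EFin \o g k) by have [_ _ _ _ h] := fg k;
    exact: h.
have fgE : {ae mu2, forall z : R * R, forall k, @Omega R z ->
      v z.1 z.2 k ord0 = f k (z.2 - z.1 / tau k) + g k (z.2 + z.1 / tau k) /\
      i z.1 z.2 k ord0 = K k * (f k (z.2 - z.1 / tau k) - g k (z.2 + z.1 / tau k))}.
  by apply: ae_countable => k; have [] := fg k.
have vE k : {ae mu2, forall z : R * R, @Omega R z ->
    v z.1 z.2 k ord0 = 1 * f k (z.2 - z.1 / tau k) + 1 * g k (z.2 + z.1 / tau k)}.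
  by apply: ae_imply fgE => z h Oz; rewrite !mul1r (h k Oz).1.
have iE k : {ae mu2, forall z : R * R, @Omega R z ->
    i z.1 z.2 k ord0 = K k * f k (z.2 - z.1 / tau k) + (- K k) * g k (z.2 + z.1 / tau k)}.
  by apply: ae_imply fgE => z h Oz; rewrite mulNr -mulrBr (h k Oz).2.
have vx0 k := line_mean_x0 (h := fun t x => v t x k ord0) (tau0 k) (v_meas k) (fm k) (gm k)
    (vE k) (f_loc k) (g_loc k).
have vx1 k := line_mean_x1 (h := fun t x => v t x k ord0) (tau0 k) (v_meas k) (fm k) (gm k)
    (vE k) (f_loc k) (g_loc k).
have vt0 k := line_mean_t0 (h := fun t x => v t x k ord0) (tau0 k) (v_meas k) (fm k) (gm k)
    (vE k) (f_loc k) (g_loc k).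
have ix0 k := line_mean_x0 (h := fun t x => i t x k ord0) (tau0 k) (i_meas k) (fm k) (gm k)
    (iE k) (f_loc k) (g_loc k).
have ix1 k := line_mean_x1 (h := fun t x => i t x k ord0) (tau0 k) (i_meas k) (fm k) (gm k)
    (iE k) (f_loc k) (g_loc k).
have it0 k := line_mean_t0 (h := fun t x => i t x k ord0) (tau0 k) (i_meas k) (fm k) (gm k)
    (iE k) (f_loc k) (g_loc k).
have init : {ae mu, forall x, 0 < x < 1 ->
      v0 x = slice_v L C f g 0 x /\ i0 x = slice_i L C f g 0 x}.
  apply: ae_imply (ae_and (ae_and (ae_countable vt0) (ae_countable it0)) (sol_initial sol)) => x
      [[hv hi] h0] x01.
  have [<- <-] := h0 x01; split; apply/colP => k; rewrite !mxE mul0r subr0 addr0.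
    by rewrite (cvg_lim _ (hv k x01))// !mul1r.
  by rewrite (cvg_lim _ (hi k x01))// mulrBr mulNr.
have f_init k : {ae mu, forall x, 0 < x < 1 ->
    f k x = 2^-1 * (v0 x k ord0 + (K k)^-1 * i0 x k ord0)}.
  apply: ae_imply init => x h /h[-> ->]; rewrite !mxE mul0r subr0 addr0.
  by field; rewrite gt_eqF.
have g_init k : {ae mu, forall x, 0 < x < 1 ->
    g k x = 2^-1 * (v0 x k ord0 + (- (K k)^-1) * i0 x k ord0)}.
  apply: ae_imply init => x h /h[-> ->]; rewrite !mxE mul0r subr0 addr0.
  by field; rewrite gt_eqF.
have mI : measurable (`[0, 1]%classic : set (measurableTypeR R)) by exact: measurable_itv.
have data_int k c : mu.-integrable `[0, 1]
    (EFin \o (fun x => 2^-1 * (v0 x k ord0 + c * i0 x k ord0))).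
  apply: integrable_scale => //.
  by have := integrableD mI (v0_int k) (integrable_scale c mI (i0_int k)).
exists f, g; split => //.
- split.
  + by move=> k; exact: measurable_funTS.
  + by move=> k; exact: measurable_funTS.
  + move=> k a; have h2 : (2^-1 : R) < 1 by lra.
    apply: (integrable_extend (fm k) (f_loc k a _ h2) (data_int k (K k)^-1) (f_init k)).
    by move=> x; lra.
  + move=> k b; have h2 : 0 < (2^-1 : R) by lra.
    apply: (integrable_extend (gm k) (g_loc k _ b h2) (data_int k (- (K k)^-1)) (g_init k)).
    by move=> x; lra.
  + apply: ae_imply fgE => z h Oz; split; apply/colP => k; rewrite !mxE.
      by have [] := h k Oz.
    by have [] := h k Oz.
- have := ae_and (ae_and (ae_and (ae_countable vx0) (ae_countable vx1))
      (ae_and (ae_countable ix0) (ae_countable ix1))) (sol_boundary sol).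
  apply: ae_imply => t [[[hv0 hv1] [hi0 hi1]] hb] t_gt0.
  have := hb t_gt0.
  have -> : trace_x0 v t = \col_k (f k (- t / tau k) + g k (t / tau k)).
    by apply/colP => k; rewrite !mxE (cvg_lim _ (hv0 k t_gt0))// !mul1r.
  have -> : trace_x1 v t = \col_k (f k (1 - t / tau k) + g k (1 + t / tau k)).
    by apply/colP => k; rewrite !mxE (cvg_lim _ (hv1 k t_gt0))// !mul1r.
  have -> : trace_x0 i t = \col_k (K k * (f k (- t / tau k) - g k (t / tau k))).
    by apply/colP => k; rewrite !mxE (cvg_lim _ (hi0 k t_gt0))// mulrBr -mulNr.
  have -> : trace_x1 i t = \col_k (K k * (f k (1 - t / tau k) - g k (1 + t / tau k))).
    by apply/colP => k; rewrite !mxE (cvg_lim _ (hi1 k t_gt0))// mulrBr mulNr.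
  by [].
Qed.

End network_core.

(** * Decay of the waves in L^p *)

Section euclidean_norm.
Context {R : realType}.
Implicit Types n : nat.

Lemma enorm_ge0 n (u : 'cV[R]_n) : 0 <= enorm u.
Proof. exact: sqrtr_ge0. Qed.

Lemma entry_le_enorm n (u : 'cV[R]_n) j : `|u j ord0| <= enorm u.
Proof.
rewrite -sqrtr_sqr ler_sqrt ?sumr_ge0// => [|k _]; last exact: sqr_ge0.
by rewrite (bigD1 j)//= lerDl sumr_ge0// => k _; exact: sqr_ge0.
Qed.

Lemma enorm_le_sum n (u : 'cV[R]_n) : enorm u <= \sum_j `|u j ord0|.
Proof.
have S0 : 0 <= \sum_j `|u j ord0| by rewrite sumr_ge0.
rewrite -(ger0_norm S0) -sqrtr_sqr ler_sqrt ?sqr_ge0//.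
rewrite (eq_bigr (fun j => `|u j ord0| ^+ 2)); first exact: sum_sqr_le.
by move=> j _; rewrite real_normK ?num_real.
Qed.

Lemma enorm_col_mx_le n (u w : 'cV[R]_n) :
  enorm (col_mx u w) <= \sum_k (`|u k ord0| + `|w k ord0|).
Proof.
apply: (le_trans (enorm_le_sum _)); rewrite big_split_ord/= big_split/=.
by apply: lerD; apply: ler_sum => k _; rewrite ?col_mxEu ?col_mxEd.
Qed.

Lemma measurable_enorm n (u : R -> 'cV[R]_n) (D : set R) :
  (forall j, measurable_fun D (fun x : R => u x j ord0)) ->
  measurable_fun D (fun x => enorm (u x)).
Proof.
move=> mu_; rewrite /enorm.
have msqrt : measurable_fun setT (@Num.sqrt R).
  by apply: continuous_measurable_fun; exact: sqrt_continuous.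
apply: (measurableT_comp msqrt).
by apply: measurable_sum => j; apply: measurable_funX.
Qed.

End euclidean_norm.

Section wave_decay.
Context {R : realType}.
Local Notation mu := (@lebesgue_measure R).

Lemma Lp_normE p n (u : R -> 'cV[R]_n) :
  Lp_norm p u = Np p ((fun x => enorm (u x)) \_ `[0, 1]).
Proof. by rewrite /Lp_norm /Np restrict_EFin. Qed.

Variables (N : nat) (L C : 'I_N -> R).
Hypotheses (L0 : forall k, 0 < L k) (C0 : forall k, 0 < C k).
Local Notation tau := (tau L C).
Local Notation K := (Kadm L C).

Lemma delay_gt0 k : 0 < tau k. Proof. exact: tau_gt0. Qed.
Lemma admittance_gt0 k : 0 < K k. Proof. exact: K_gt0. Qed.

Section one_wave.
Variables (f g : 'I_N -> R -> R).
Hypotheses (fm : forall k, measurable_fun setT (f k)) (gm : forall k, measurable_fun setT (g k)).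

(** Square root of the energy that reaches the ends of line k at time t: g
    arrives at the end 0 and f at the end 1. *)
Definition line_amplitude k t : R :=
  Num.sqrt (K k * (g k (t / tau k) ^+ 2 + f k (1 - t / tau k) ^+ 2)).

Definition wave_slice t x : 'cV[R]_(N + N) :=
  col_mx (slice_i L C f g t x) (slice_v L C f g t x).

Let comp_affine (u : R -> R) c d : measurable_fun setT u ->
  measurable_fun setT (fun x => u (affine c d x)).
Proof. by move=> mu_; apply: measurableT_comp => //; exact: measurable_affine. Qed.

Lemma line_amplitude_measurable k : measurable_fun setT (line_amplitude k).
Proof.
have msqrt : measurable_fun setT (@Num.sqrt R).
  by apply: continuous_measurable_fun; exact: sqrt_continuous.
apply: (measurableT_comp msqrt); apply: measurable_funM => //.
apply: measurable_funD; apply: measurable_funX.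
  apply: eq_measurable_fun (comp_affine (tau k)^-1 0 (gm k)) => t _.
  by rewrite /affine addr0 mulrC.
apply: eq_measurable_fun (comp_affine (- (tau k)^-1) 1 (fm k)) => t _.
by rewrite /affine; congr f; ring.
Qed.

Lemma wave_slice_measurable t j : measurable_fun setT (fun x => wave_slice t x j ord0).
Proof.
have hf k : measurable_fun setT (fun x : R => f k (x - t / tau k)).
  by apply: eq_measurable_fun (comp_affine 1 (- (t / tau k)) (fm k)) => x _; rewrite /affine mul1r.
have hg k : measurable_fun setT (fun x : R => g k (x + t / tau k)).
  by apply: eq_measurable_fun (comp_affine 1 (t / tau k) (gm k)) => x _; rewrite /affine mul1r.
rewrite /wave_slice; case: (splitP j) => k jk.
  have -> : j = lshift N k by exact: val_inj.
  rewrite (_ : (fun _ => _) = fun x => K k * (f k (x - t / tau k) - g k (x + t / tau k))).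
    by apply: measurable_funM => //; exact: measurable_funB.
  by apply/funext => x; rewrite col_mxEu mxE.
have -> : j = rshift N k by exact: val_inj.
rewrite (_ : (fun _ => _) = fun x => f k (x - t / tau k) + g k (x + t / tau k)).
  by exact: measurable_funD.
by apply/funext => x; rewrite col_mxEd mxE.
Qed.

Lemma wave_le_amplitude k t :
  `|g k (t / tau k)| <= (Num.sqrt (K k))^-1 * line_amplitude k t /\
  `|f k (1 - t / tau k)| <= (Num.sqrt (K k))^-1 * line_amplitude k t.
Proof.
have K0 := admittance_gt0 k; have s0 : 0 < Num.sqrt (K k) by rewrite sqrtr_gt0.
rewrite /line_amplitude sqrtrM; last exact: ltW.
rewrite mulKf ?gt_eqF// -!sqrtr_sqr !ler_sqrt ?addr_ge0 ?sqr_ge0//.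
by rewrite lerDl lerDr !sqr_ge0.
Qed.

Lemma amplitude_le_wave k t : line_amplitude k t <=
  Num.sqrt (K k) * (`|g k (t / tau k)| + `|f k (1 - t / tau k)|).
Proof.
have K0 := admittance_gt0 k.
rewrite /line_amplitude sqrtrM; last exact: ltW.
rewrite ler_wpM2l ?sqrtr_ge0//.
have s0 : 0 <= `|g k (t / tau k)| + `|f k (1 - t / tau k)| by rewrite addr_ge0.
rewrite -[leRHS](ger0_norm s0) -sqrtr_sqr ler_sqrt ?sqr_ge0//.
rewrite -(@real_normK _ (g k _)) ?num_real// -(@real_normK _ (f k _)) ?num_real//.
by rewrite sqrrD -addrA lerD2l lerDr mulrn_wge0// mulr_ge0.
Qed.

(** The factor K + 1 bounds v and i by f and g, the inverse square root of K
    bounds these by the amplitude, and the last factor changes the variable x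
    into the time of arrival. *)
Definition slice_factor p k : R := (K k + 1) * (Num.sqrt (K k))^-1 *
  (dilation_factor p (- tau k) + dilation_factor p (tau k)).

Lemma slice_factor_ge0 p k : 0 <= slice_factor p k.
Proof.
have K0 := admittance_gt0 k.
rewrite /slice_factor mulr_ge0 ?addr_ge0 ?dilation_factor_ge0//.
by rewrite mulr_ge0 ?addr_ge0 ?invr_ge0 ?sqrtr_ge0// ltW.
Qed.

(** The waves that are at x at time t reach the ends at the times t + tau (1 -
    x) and t + tau x, both in [t, t + tau]. *)
Lemma slice_le_window p t : (1 <= p)%E ->
  (Lp_norm p (wave_slice t) <=
   \sum_k (slice_factor p k)%:E * window p t (t + tau k)%R (line_amplitude k))%E.
Proof.
move=> p1; rewrite Lp_normE.
pose w k := line_amplitude k \_ `[t, t + tau k].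
have mw k : measurable_fun setT (w k).
  by apply: restrict_measurable => //; exact: line_amplitude_measurable.
have w0 k s : 0 <= w k s by rewrite /w patchE; case: ifP => // _; exact: sqrtr_ge0.
pose ck k := (K k + 1) * (Num.sqrt (K k))^-1.
have ck0 k : 0 <= ck k.
  by rewrite mulr_ge0 ?addr_ge0 ?invr_ge0 ?sqrtr_ge0// ltW//; exact: admittance_gt0.
have mwa k c d : measurable_fun setT (w k \o affine c d) by exact: comp_affine.
have msum k : measurable_fun setT
   (fun x => ck k * (w k (affine (- tau k) (t + tau k) x) + w k (affine (tau k) t x))).
  by apply: measurable_funM => //; apply: measurable_funD; exact: mwa.
apply: (@le_trans _ _ (Np p (fun x => \sum_k
    ck k * (w k (affine (- tau k) (t + tau k) x) + w k (affine (tau k) t x))))).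
  apply: Np_le => //.
  - apply: restrict_measurable => //; apply: measurable_enorm => j.
    exact: wave_slice_measurable.
  - exact: measurable_sum_cond.
  - apply: ae_all => x; rewrite [leRHS]ger0_norm; last first.
      by rewrite sumr_ge0// => k _; rewrite mulr_ge0// addr_ge0.
    rewrite patchE mem_setE in_itv/=; case: ifPn => [/andP[x0 x1]|_]; last first.
      by rewrite normr0 sumr_ge0// => k _; rewrite mulr_ge0// addr_ge0.
    rewrite ger0_norm ?enorm_ge0//; apply: (le_trans (enorm_col_mx_le _ _)).
    apply: ler_sum => k _; rewrite !mxE.
    have K0 := admittance_gt0 k; have t0 := delay_gt0 k.
    have [_ hf] := wave_le_amplitude k (affine (- tau k) (t + tau k) x).
    have [hg _] := wave_le_amplitude k (affine (tau k) t x).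
    have -> : w k (affine (- tau k) (t + tau k) x) = line_amplitude k
        (affine (- tau k) (t + tau k) x).
      rewrite /w patchE mem_setE in_itv/= /affine ifT//.
      have : 0 <= tau k * x <= tau k by rewrite mulr_ge0 ?(ltW t0)// ler_piMr ?(ltW t0).
      by lra.
    have -> : w k (affine (tau k) t x) = line_amplitude k (affine (tau k) t x).
      rewrite /w patchE mem_setE in_itv/= /affine ifT//.
      have : 0 <= tau k * x <= tau k by rewrite mulr_ge0 ?(ltW t0)// ler_piMr ?(ltW t0).
      by lra.
    have e1 : x - t / tau k = 1 - affine (- tau k) (t + tau k) x / tau k.
      by rewrite /affine; field; rewrite gt_eqF.
    have e2 : x + t / tau k = affine (tau k) t x / tau k.
      by rewrite /affine; field; rewrite gt_eqF.
    rewrite e1 e2 /ck -mulrA.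
    set F := f k _ in hf *; set G := g k _ in hg *.
    apply: (@le_trans _ _ ((K k + 1) * (`|F| + `|G|))).
      rewrite mulrDl mul1r; apply: lerD; last exact: ler_normD.
      by rewrite normrM (gtr0_norm K0) ler_wpM2l ?ler_normB// ltW.
    rewrite ler_wpM2l ?addr_ge0// ?(ltW K0)// mulrDr.
    exact: lerD.
apply: (le_trans (Np_sum _ _ p1 msum)); apply: lee_sum => k _.
have t0 := delay_gt0 k.
have tn0 : tau k != 0 by rewrite gt_eqF.
have ntn0 : - tau k != 0 by rewrite oppr_eq0.
have mD : measurable_fun setT (fun x => w k (affine (- tau k) (t + tau k) x) + w k
    (affine (tau k) t x)).
  by apply: measurable_funD; exact: mwa.
rewrite (Np_scale p1 (ck0 k) mD) /slice_factor -/(ck k) [in leRHS]EFinM -muleA.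
rewrite lee_wpmul2l ?lee_fin//.
apply: (le_trans (Np_add p1 (mwa _ _ _) (mwa _ _ _))).
rewrite EFinD ge0_muleDl ?lee_fin ?dilation_factor_ge0//.
by apply: leeD; exact: Np_affine.
Qed.

(** Counterpart of [slice_factor] for the passage from the initial slice to
    the amplitudes. *)
Definition data_factor p k : R := Num.sqrt (K k) * (1 + (K k)^-1) *
  (dilation_factor p (tau k)^-1 + dilation_factor p (- (tau k)^-1)).

Lemma data_factor_ge0 p k : 0 <= data_factor p k.
Proof.
have K0 := admittance_gt0 k.
rewrite /data_factor mulr_ge0 ?addr_ge0 ?dilation_factor_ge0//.
by rewrite mulr_ge0 ?addr_ge0 ?invr_ge0 ?sqrtr_ge0// ltW.
Qed.

(** At time 0, f = (v + i/K)/2 and g = (v - i/K)/2. *)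
Lemma component_le_slice x k :
  `|f k x| <= (1 + (K k)^-1) * enorm (wave_slice 0 x) /\
  `|g k x| <= (1 + (K k)^-1) * enorm (wave_slice 0 x).
Proof.
have K0 := admittance_gt0 k; have Ki0 : 0 < (K k)^-1 by rewrite invr_gt0.
have hi := entry_le_enorm (wave_slice 0 x) (lshift N k).
have hv := entry_le_enorm (wave_slice 0 x) (rshift N k).
rewrite col_mxEu mxE mul0r subr0 addr0 in hi.
rewrite col_mxEd mxE mul0r subr0 addr0 in hv.
move: (enorm _) hi hv => E hi hv.
have E0 : 0 <= E by exact: le_trans hv.
rewrite normrM (gtr0_norm K0) -ler_pdivlMl// in hi.
have KE : 0 <= (K k)^-1 * E by rewrite mulr_ge0// ltW.
rewrite mulrDl mul1r.
move: hi hv; move: ((K k)^-1 * E) KE (f k x) (g k x) => D D0 F G.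
by rewrite !ler_norml => /andP[? ?] /andP[? ?]; split; lra.
Qed.

(** The waves that reach the ends at a time t <= tau were at time 0 at the
    distance t/tau from these ends. *)
Lemma window_le_slice p k : (1 <= p)%E ->
  (window p 0 (tau k) (line_amplitude k) <=
   (data_factor p k)%:E * Lp_norm p (wave_slice 0))%E.
Proof.
move=> p1; rewrite Lp_normE.
pose U := (fun x => enorm (wave_slice 0 x)) \_ `[0, 1].
have mU : measurable_fun setT U.
  apply: restrict_measurable => //; apply: measurable_enorm => j.
  exact: wave_slice_measurable.
have U0 x : 0 <= U x by rewrite /U patchE; case: ifP => // _; exact: enorm_ge0.
have K0 := admittance_gt0 k; have t0 := delay_gt0 k.
have Ki0 : 0 < (K k)^-1 by rewrite invr_gt0.
have tn0 : (tau k)^-1 != 0 by rewrite invr_eq0 gt_eqF.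
have ntn0 : - (tau k)^-1 != 0 by rewrite oppr_eq0.
pose ck := Num.sqrt (K k) * (1 + (K k)^-1).
have ck0 : 0 <= ck by rewrite mulr_ge0 ?sqrtr_ge0// addr_ge0// ltW.
have mUa c d : measurable_fun setT (U \o affine c d) by exact: comp_affine.
have mD : measurable_fun setT (fun t => U (affine (tau k)^-1 0 t) + U (affine (- (tau k)^-1) 1 t)).
  by apply: measurable_funD; exact: mUa.
apply: (@le_trans _ _ (Np p (fun t => ck *
    (U (affine (tau k)^-1 0 t) + U (affine (- (tau k)^-1) 1 t))))).
  apply: Np_le => //.
  - by apply: restrict_measurable => //; exact: line_amplitude_measurable.
  - exact: measurable_funM.
  - apply: ae_all => t; rewrite [leRHS]ger0_norm; last by rewrite mulr_ge0// addr_ge0.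
    rewrite patchE mem_setE in_itv/=; case: ifPn => [/andP[t_ge0 tt]|_]; last first.
      by rewrite normr0 mulr_ge0// addr_ge0.
    rewrite ger0_norm ?sqrtr_ge0//; apply: (le_trans (amplitude_le_wave k t)).
    rewrite /ck -mulrA ler_wpM2l ?sqrtr_ge0//.
    have [_ hg] := component_le_slice (t / tau k) k.
    have [hf _] := component_le_slice (1 - t / tau k) k.
    have q0 : 0 <= t / tau k <= 1.
      by rewrite divr_ge0 ?(ltW t0)//= ler_pdivrMr// mul1r.
    have -> : U (affine (tau k)^-1 0 t) = enorm (wave_slice 0 (t / tau k)).
      rewrite /U patchE mem_setE /affine addr0 [_ * t]mulrC in_itv/= q0//.
    have -> : U (affine (- (tau k)^-1) 1 t) = enorm (wave_slice 0 (1 - t / tau k)).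
      rewrite /U patchE mem_setE /affine (_ : - (tau k)^-1 * t + 1 = 1 - t / tau k); last ring.
      by rewrite in_itv/= ifT//; lra.
    by rewrite mulrDr; apply: lerD.
rewrite (Np_scale p1 ck0 mD) /data_factor -/ck [in leRHS]EFinM -muleA.
rewrite lee_wpmul2l ?lee_fin//.
apply: (le_trans (Np_add p1 (mUa _ _) (mUa _ _))).
rewrite EFinD ge0_muleDl ?lee_fin ?dilation_factor_ge0//.
by apply: leeD; exact: Np_affine.
Qed.

End one_wave.

Section decay.
Variables (A : R -> 'M[R]_(N + N)) (alpha M : R).
Hypotheses (alpha0 : 0 < alpha).
Hypothesis A_bdd : {ae mu, forall t, 0 <= t -> forall j k, `|A t j k| <= M}.
Hypothesis A_diss : {ae mu, forall t, 0 <= t ->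
  loewner_ge (A t + (A t)^T) (alpha *: 1%:M)}.

Definition boundary_relation (f g : 'I_N -> R -> R) : Prop :=
  {ae mu, forall t, 0 < t ->
      col_mx (\col_k (f k (- t / tau k) + g k (t / tau k)))
             (\col_k (f k (1 - t / tau k) + g k (1 + t / tau k))) =
      A t *m col_mx (- \col_k (K k * (f k (- t / tau k) - g k (t / tau k))))
             (\col_k (K k * (f k (1 - t / tau k) - g k (1 + t / tau k))))}.

(** The waves that leave the nodes at time t arrive unchanged at the opposite
    ends at time t + tau k, so that the loss of energy at the nodes at time t
    is the required inequality. *)
Lemma amplitude_contraction : exists rho, 0 <= rho < 1 /\ forall f g : 'I_N -> R -> R,
  (forall k, measurable_fun setT (f k)) -> (forall k, measurable_fun setT (g k)) ->
  boundary_relation f g -> energy_contraction tau rho (line_amplitude f g).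
Proof.
have [rho [rho01 hrho]] := boundary_contraction M alpha0 admittance_gt0.
exists rho; split=> // f g fm gm fg; split.
- exact: line_amplitude_measurable.
- by move=> k t; exact: sqrtr_ge0.
have sq k t : line_amplitude f g k t ^+ 2 = K k * (g k (t / tau k) ^+ 2 + f k (1 - t / tau k) ^+ 2).
  by rewrite sqr_sqrtr// mulr_ge0 ?addr_ge0 ?sqr_ge0// ltW//; exact: admittance_gt0.
apply: ae_imply (ae_and (ae_and A_bdd A_diss) fg) => t [[At Dt] ht] t_gt0.
have := hrho _ (Dt (ltW t_gt0)) (At (ltW t_gt0)) _ _ _ _ (ht t_gt0).
under [X in _ -> _ <= _ * X]eq_bigr do rewrite sq.
move=> h; apply: le_trans h; rewrite le_eqVlt; apply/orP; left; apply/eqP.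
apply: eq_bigr => k _; rewrite sq addrC.
have t0 := delay_gt0 k.
have -> : (t + tau k) / tau k = 1 + t / tau k by field; rewrite gt_eqF.
by have -> : 1 - (1 + t / tau k) = - t / tau k by ring.
Qed.

Theorem wave_Lp_decay p : (1 <= p)%E -> exists gamma B : R, [/\ 0 < gamma, 0 < B &
  forall f g : 'I_N -> R -> R,
  (forall k, measurable_fun setT (f k)) -> (forall k, measurable_fun setT (g k)) ->
  boundary_relation f g -> forall t, 0 <= t ->
  (Lp_norm p (wave_slice f g t) <=
   (B * expR (- gamma * t))%:E * Lp_norm p (wave_slice f g 0))%E].
Proof.
move=> p1; have [rho [rho01 hrho]] := amplitude_contraction.
pose delta := (1 + \sum_k (tau k)^-1)^-1; pose h := 1 + \sum_k tau k.
have S0 : 0 <= \sum_k (tau k)^-1.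
  by rewrite sumr_ge0// => k _; rewrite invr_ge0 ltW// delay_gt0.
have delta0 : 0 < delta by rewrite invr_gt0 ltr_wpDr.
have h0 : 0 < h by rewrite ltr_wpDr// sumr_ge0// => k _; rewrite ltW// delay_gt0.
have tau_bounds k : delta <= tau k <= h.
  have t0 := delay_gt0 k; apply/andP; split.
    rewrite -[leRHS]invrK lef_pV2 ?posrE ?invr_gt0 ?ltr_wpDr//.
    rewrite (bigD1 k)//= addrCA lerDl addr_ge0// sumr_ge0// => j _.
    by rewrite invr_ge0 ltW// delay_gt0.
  rewrite /h (bigD1 k)//= addrCA lerDl addr_ge0// sumr_ge0// => j _.
  by rewrite ltW// delay_gt0.
have [gamma [B [gamma0 B0 decay]]] := energy_contraction_decay p1 delta0 tau_bounds rho01 h0.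
pose B1 := \sum_k slice_factor p k; pose B2 := \sum_k data_factor p k.
have B10 : 0 <= B1 by rewrite sumr_ge0// => k _; exact: slice_factor_ge0.
have B20 : 0 <= B2 by rewrite sumr_ge0// => k _; exact: data_factor_ge0.
exists gamma, (1 + B1 * B * B2); split=> //.
  by rewrite ltr_wpDr// !mulr_ge0// ltW.
move=> f g fm gm fg t t_ge0.
have dec := decay _ (hrho f g fm gm fg) t t_ge0.
have e0 := expR_gt0 (- gamma * t).
set E := expR _ in dec e0 *.
have Be0 : 0 <= B * E by rewrite mulr_ge0// ltW.
pose X := Lp_norm p (wave_slice f g 0).
have X0 : (0 <= X)%E by exact: Lnorm_ge0.
have W0 k s : (0 <= window p s (s + tau k)%R (line_amplitude f g k))%E by exact: Np_ge0.
apply: (le_trans (slice_le_window fm gm t p1)).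
apply: (@le_trans _ _ (B1%:E * \sum_k window p t (t + tau k)%R (line_amplitude f g k))%E).
  rewrite ge0_sume_distrr//; apply: lee_sum => k _.
  rewrite lee_wpmul2r// lee_fin /B1 (bigD1 k)//= lerDl sumr_ge0// => j _.
  exact: slice_factor_ge0.
apply: (@le_trans _ _ (B1%:E * ((B * E)%:E * (B2%:E * X)))%E).
  rewrite lee_wpmul2l ?lee_fin//; apply: (le_trans dec).
  rewrite lee_wpmul2l ?lee_fin//.
  rewrite -sumEFin ge0_sume_distrl; last by move=> k _; rewrite lee_fin data_factor_ge0.
  by apply: lee_sum => k _; exact: window_le_slice.
rewrite !muleA -!EFinM lee_wpmul2r// lee_fin mulrDl mul1r.
by rewrite -[leLHS]add0r; apply: lerD; [exact: ltW|rewrite -!mulrA (mulrC E)].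
Qed.

End decay.
End wave_decay.

(** * Stability in L^p *)

Section Lp_solutions.
Context {R : realType}.
Local Notation mu := (@lebesgue_measure R).
Local Notation mu2 := (mu \x mu)%E.

Lemma lebesgue_measure_unit : mu (`[0, 1]%classic : set R) = 1%E.
Proof. by rewrite lebesgue_measure_itv/= lte_fin ltr01 oppr0 adde0. Qed.

(** Hoelder's inequality on an interval of length 1. *)
Lemma L1_le_Np (p : \bar R) (u : R -> R) : (1 <= p)%E -> measurable_fun setT u ->
  (forall x, ~~ (0 <= x <= 1) -> u x = 0) ->
  (\int[mu]_x `|u x|%:E <= Np p u)%E.
Proof.
move=> p1 um u0.
have mabs : measurable_fun setT (fun x => `|u x|%:E).
  by apply/measurable_EFinP; exact: measurableT_comp.
have uI (F : R -> R) : (forall x, ~~ (0 <= x <= 1) -> F x = 0) ->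
    F = (fun x => F x * \1_(`[0, 1]%classic : set R) x).
  move=> F0; apply/funext => x; rewrite indicE mem_setE in_itv/=.
  by have [_|/F0 ->] := boolP (0 <= x <= 1); rewrite ?mulr1 ?mul0r.
case: p p1 => [r| |]; last by [].
- rewrite lee_fin le_eqVlt => /predU1P[<-|r1].
    by rewrite /Np Lnorm1.
  have r0 : 0 < r by lra.
  have q0 : 0 < r / (r - 1) by rewrite divr_gt0// subr_gt0.
  have pq : r^-1 + (r / (r - 1))^-1 = 1 by field; rewrite !gt_eqF// subr_gt0.
  have mI : measurable_fun setT (\1_(`[0, 1]%classic : set R) : R -> R) by exact: measurable_indic.
  have := @hoelder _ _ _ mu u (\1_(`[0, 1]%classic : set R)) r (r / (r - 1)) um mI r0 q0 pq.
  have -> : ('N[mu]_(r / (r - 1))%:E[EFin \o (\1_(`[0%R, 1%R]%classic : set R) : R -> R)] = 1)%E.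
    rewrite unlock /Lnorm (_ : (\int[mu]_x _)%E = 1%E) ?poweR1r//.
    transitivity (\int[mu]_x (\1_(`[0%R, 1%R]%classic : set R) x)%:E)%E; last first.
      rewrite integral_indic// setIT; exact: lebesgue_measure_unit.
    apply: eq_integral => x _; rewrite /= indicE.
    by case: (_ \in _); rewrite ?normr1 ?normr0 ?powR1 ?powR0// gt_eqF.
  rewrite mule1 Lnorm1; apply: le_trans; apply: ge0_le_integral => //.
  - by apply: measurableT_comp => //; apply/measurable_EFinP; exact: measurable_funM.
  - by move=> x _; rewrite /= lee_fin {1}(uI u u0).
- move=> _; rewrite /Np unlock /Lnorm muT_gt0.
  have hs := ess_sup_ge mu (abse \o (EFin \o u)).
  have s0 : (0 <= ess_sup mu (abse \o (EFin \o u)))%E.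
    by apply: ess_sup_gee; [exact: muT_gt0|apply: ae_all => x; exact: abse_ge0].
  move: (ess_sup _ _) hs s0 => -[c| |] hs s0; [|exact: leey|by []].
  rewrite lee_fin in s0.
  apply: (@le_trans _ _ (\int[mu]_x (c * \1_(`[0, 1]%classic : set R) x)%:E)%E).
    apply: ae_ge0_le_integral => //.
    - by move=> x _; rewrite lee_fin mulr_ge0// indicE; case: (_ \in _).
    - by apply/measurable_EFinP; apply: measurable_funM => //; exact: measurable_indic.
    apply: ae_imply hs => x; rewrite /= !lee_fin => ux _.
    rewrite (uI _ u0) normrM indicE; case: (_ \in _); first by rewrite normr1 !mulr1.
    by rewrite normr0 !mulr0.
  under eq_integral do rewrite EFinM.
  rewrite ge0_integralZl//; last by apply/measurable_EFinP; exact: measurable_indic.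
  rewrite integral_indic// setIT; have := lebesgue_measure_unit => /= ->.
  by rewrite mule1.
Qed.

Lemma slice_L1_le n (p : \bar R) (u : R -> 'cV[R]_n) k : (1 <= p)%E ->
  (forall j, measurable_fun (`[0, 1]%classic : set R) (fun x : R => u x j ord0)) ->
  (\int[mu]_x `|((fun x => u x k ord0) \_ `[0, 1]) x|%:E <= Lp_norm p u)%E.
Proof.
move=> p1 um; rewrite Lp_normE.
have mI : measurable (`[0, 1]%classic : set R) by exact: measurable_itv.
have me : measurable_fun setT ((fun x => enorm (u x)) \_ `[0, 1]).
  by apply/(measurable_restrictT _ _).1 => //; exact: measurable_enorm.
have mk : measurable_fun setT ((fun x => u x k ord0) \_ `[0, 1]).
  by apply/(measurable_restrictT _ _).1.
apply: le_trans (L1_le_Np p1 me _); last first.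
  by move=> x nx; rewrite patchE mem_setE in_itv/= (negbTE nx).
apply: ge0_le_integral => //.
- by apply/measurable_EFinP; exact: measurableT_comp.
- by apply/measurable_EFinP; exact: measurableT_comp.
- move=> x _; rewrite lee_fin !patchE; case: ifP => // _.
  by rewrite [leRHS]ger0_norm ?enorm_ge0//; exact: entry_le_enorm.
Qed.

Lemma in_Lp_integrable n (p : \bar R) (u : R -> 'cV[R]_n) k : (1 <= p)%E ->
  in_Lp p u -> mu.-integrable `[0, 1] (EFin \o (fun x => u x k ord0)).
Proof.
move=> p1 [um ufin].
have mI : measurable (`[0, 1]%classic : set (measurableTypeR R)) by exact: measurable_itv.
have mk : measurable_fun setT ((fun x => u x k ord0) \_ `[0, 1]).
  by apply/(measurable_restrictT _ _).1 => //; exact: measurable_itv.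
apply/(integrable_mkcond _ mI).2; rewrite restrict_EFin; apply/integrableP; split.
  exact/measurable_EFinP.
exact: le_lt_trans (slice_L1_le k p1 um) ufin.
Qed.

(** By Tonelli, since the L^1 norm of each slice is at most its L^p norm. *)
Lemma L1loc_integrable n (p : \bar R) (h : R -> R -> 'cV[R]_n) k T : (1 <= p)%E ->
  in_L1loc_Lp p h -> mu2.-integrable (plane_strip T) (EFin \o (fun z => h z.1 z.2 k ord0)).
Proof.
move=> p1 [hm hi].
pose T1 := `|T| + 1; have T10 : 0 < T1 by rewrite ltr_wpDl.
have mS := @plane_strip_measurable R.
suff h1 : mu2.-integrable (plane_strip T1) (EFin \o (fun z => h z.1 z.2 k ord0)).
  apply: (integrableS (mS T1) (mS T) _ h1) => z [/=]; rewrite !in_itv/= => /andP[z1 z2] z3.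
  split; rewrite /= in_itv/= ?z1//= (le_trans z2)// (le_trans (ler_norm _))//.
  by rewrite lerDl.
pose F := (fun z => h z.1 z.2 k ord0) \_ (plane_strip T1).
suff Fi : mu2.-integrable setT (EFin \o F).
  by apply: (integrable_mkcond _ (mS T1)).2; rewrite restrict_EFin.
have mF : measurable_fun setT (EFin \o F).
  apply/measurable_EFinP; apply: (measurable_restrictT _ (mS T1)).1.
  exact: (measurable_funS (@Omega_bar_measurable R) (@plane_strip_Omega_bar R T1) (hm k)).
apply/(integrable12ltyP mu mu mF).
have hslice t : 0 <= t -> forall j, measurable_fun (`[0, 1]%classic : set R)
    (fun x : R => h t x j ord0).
  by move=> t0 j; exact: (@measurable_xslice R (fun t x => h t x j ord0) (hm j)).
have mI : measurable (`[0, T1]%classic : set (measurableTypeR R)) by exact: measurable_itv.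
have /integrableP[_ hfin] := hi T1 T10.
apply: le_lt_trans hfin; rewrite [leRHS]integral_mkcond.
have mLp : measurable_fun setT ((fun t => `|Lp_norm p (h t)|%E) \_ `[0, T1]).
  apply: (measurable_restrictT _ mI).1.
  have /integrableP[m1 _] := hi T1 T10.
  exact: (measurableT_comp (f := abse) _ m1).
apply: ge0_le_integral => //.
- by move=> t _; apply: integral_ge0.
- pose nF (z : measurableTypeR R * measurableTypeR R) := `|(EFin \o F) z|%E.
  have nF0 z : (0 <= nF z)%E by exact: abse_ge0.
  have mnF : measurable_fun setT nF by exact: (measurableT_comp (f := abse) _ mF).
  have m3 := @measurable_fun_fubini_tonelli_F _ _ (measurableTypeR R) (measurableTypeR R) R mu
      nF mnF nF0.
  exact: m3.
- move=> t _; rewrite patchE mem_setE in_itv/=.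
  have FE x : F (t, x) = if 0 <= t <= T1 then ((fun x => h t x k ord0) \_ `[0, 1]) x else 0.
    rewrite /F !patchE; case: ifPn => zS; case: ifPn => tt //.
    - by move: zS; rewrite inE => -[_ /= xI]; rewrite mem_set.
    - by move: zS; rewrite inE => -[/=]; rewrite in_itv/= (negbTE tt).
    - rewrite mem_setE; case: ifPn => // x1; case/negP: zS; rewrite inE; split => //=.
  under eq_integral do rewrite FE.
  case: ifPn => [/andP[t0 _]|_].
    rewrite gee0_abs; last exact: Lnorm_ge0.
    exact: slice_L1_le (hslice t t0).
  by under eq_integral do rewrite normr0; rewrite integral0.
Qed.

End Lp_solutions.

Section Lp_stability.
Context {R : realType}.
Local Notation mu := (@lebesgue_measure R).

Theorem Lp_stability (N : nat) (L C : 'I_N -> R) (A : R -> 'M[R]_(N + N)) (alpha : R) (p : \bar R) :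
  (forall k, 0 < L k) -> (forall k, 0 < C k) -> ess_bounded_mx A -> 0 < alpha ->
  {ae mu, forall t, 0 <= t -> loewner_ge (A t + (A t)^T) (alpha *: 1%:M)} ->
  (1 <= p)%E -> Lp_exp_stable L C A p.
Proof.
move=> L0 C0 [M AM] alpha0 Adiss p1.
have [gamma [B [gamma0 B0 decay]]] := wave_Lp_decay L0 C0 alpha0 AM Adiss p1.
exists gamma, B; split => // v i v0 i0 [hL1 hv0 hi0 sol].
have vE t x k : v t x k ord0 = col_mx (i t x) (v t x) (rshift N k) ord0 by rewrite col_mxEd.
have iE t x k : i t x k ord0 = col_mx (i t x) (v t x) (lshift N k) ord0 by rewrite col_mxEu.
have [hm _] := hL1.
have v_meas k : measurable_fun (@Omega_bar R) (fun z : R * R => v z.1 z.2 k ord0).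
  by have := hm (rshift N k); under eq_fun do rewrite -vE.
have i_meas k : measurable_fun (@Omega_bar R) (fun z : R * R => i z.1 z.2 k ord0).
  by have := hm (lshift N k); under eq_fun do rewrite -iE.
have v_int k T : (mu \x mu)%E.-integrable (plane_strip T) (EFin \o (fun z => v z.1 z.2 k ord0)).
  have := L1loc_integrable (rshift N k) T p1 hL1.
  by apply: eq_integrable => [|z _]; [exact: measurableX|rewrite /= vE].
have i_int k T : (mu \x mu)%E.-integrable (plane_strip T) (EFin \o (fun z => i z.1 z.2 k ord0)).
  have := L1loc_integrable (lshift N k) T p1 hL1.
  by apply: eq_integrable => [|z _]; [exact: measurableX|rewrite /= iE].
have [f [g [fm gm fg bd _]]] := network_decomposition L0 C0 v_meas i_meas v_int i_int
  (fun k => in_Lp_integrable k p1 hv0) (fun k => in_Lp_integrable k p1 hi0) sol.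
by exists f, g; split => // t t0; exact: decay.
Qed.

End Lp_stability.

(** * Stability of continuous solutions *)

Section clamp.
Context {R : realType}.
Local Notation mu := (@lebesgue_measure R).
Local Notation mu2 := (mu \x mu)%E.

(** Retraction of the plane onto the closure of Omega: composition with it
    turns functions continuous on this closure into functions continuous on
    the plane. *)
Definition clamp (z : R * R) : R * R := (Num.max 0 z.1, Num.max 0 (Num.min 1 z.2)).

Lemma clamp_continuous : continuous clamp.
Proof.
have c1 : continuous (fun z : R * R => Num.max 0 z.1).
  by apply: max_fun_continuous => [z|z]; [exact: cvg_cst|exact: cvg_fst].
have c2 : continuous (fun z : R * R => Num.max 0 (Num.min 1 z.2)).
  apply: max_fun_continuous => [z|]; first exact: cvg_cst.
  by apply: min_fun_continuous => [z|z]; [exact: cvg_cst|exact: cvg_snd].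
by move=> z; exact: (cvg_pair (c1 z) (c2 z)).
Qed.

Lemma clamp_Omega_bar z : @Omega_bar R (clamp z).
Proof.
split; rewrite /= in_itv/=; first by rewrite andbT le_max lexx.
by rewrite le_max lexx /= ge_max ler01 /= ge_min lexx.
Qed.

Lemma clamp_id z : @Omega_bar R z -> clamp z = z.
Proof.
case: z => t x [/=]; rewrite !in_itv/= andbT => t0 /andP[x0 x1].
by rewrite /clamp/= (max_idPr t0) (min_idPr x1) (max_idPr x0).
Qed.

Lemma continuous_clamp (h : R * R -> R) : {within @Omega_bar R, continuous h} ->
  continuous (h \o clamp).
Proof.
move=> /subspace_continuousP hc z B hB.
have := @clamp_continuous z _ (hc _ (clamp_Omega_bar z) _ hB).
rewrite /nbhs/= => hz; apply: filterS hz => w; apply; exact: clamp_Omega_bar.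
Qed.

Lemma continuous_Omega_bar_measurable (h : R * R -> R) :
  {within @Omega_bar R, continuous h} -> measurable_fun (@Omega_bar R) h.
Proof.
move=> hc; have mO := @Omega_bar_measurable R.
apply: (@eq_measurable_fun _ _ _ _ _ (h \o clamp)).
  by move=> z; rewrite inE => Oz; rewrite /= clamp_id.
apply: measurable_funTS; apply: continuous_measurable_plane.
exact: continuous_clamp.
Qed.

Lemma continuous_Omega_bar_integrable (h : R * R -> R) T :
  {within @Omega_bar R, continuous h} -> mu2.-integrable (plane_strip T) (EFin \o h).
Proof.
move=> hc; have hcc := continuous_clamp hc.
have mS := @plane_strip_measurable R T.
have SO := @plane_strip_Omega_bar R T.
have mO := @Omega_bar_measurable R.
have cS : compact (plane_strip T) by apply: compact_setX; exact: segment_compact.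
have mh : measurable_fun (plane_strip T) h.
  exact: (measurable_funS mO SO (continuous_Omega_bar_measurable hc)).
have finS : (mu2 (plane_strip T) < +oo)%E.
  have -> : mu2 (plane_strip T) =
      (mu (`[0%R, T]%classic : set R) * mu (`[0%R, 1%R]%classic : set R))%E.
    exact: product_measure1E.
  apply: lte_mul_pinfty => //.
  - by rewrite ge0_fin_numE// lebesgue_measure_itv/=; case: ifP => _; rewrite -?EFinB ltry.
  - by rewrite lebesgue_measure_itv/=; case: ifP => _; rewrite -?EFinB ltry.
apply: (measurable_bounded_integrable mS finS mh).
have := @compact_bounded _ _ _ (continuous_compact (continuous_subspaceT hcc) cS).
move=> [M [Mr hM]]; exists M; split => // x Mx z Sz /=.
by apply: (hM x Mx); exists z => //=; rewrite clamp_id//; exact: SO.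
Qed.

Lemma continuous_mean_cvg (w : R -> R) : continuous w ->
  e^-1 * \int[mu]_(s in `[0, e]) w s @[e --> 0^'+] --> w 0.
Proof.
move=> cw; apply/cvgrPdist_le => eps eps0.
have /cvgrPdist_le /(_ eps eps0) [d /= d0 hd] := cw 0.
near=> e.
have e0 : 0 < e by [].
have ed : e < d by near: e; exact: nbhs_right_lt.
have mI : measurable (`[0, e]%classic : set (measurableTypeR R)) by exact: measurable_itv.
have int (u : R -> R) : continuous u -> mu.-integrable `[0, e] (EFin \o u).
  move=> cu; apply: continuous_compact_integrable; first exact: segment_compact.
  exact: continuous_subspaceT.
have me : fine (mu (`[0, e]%classic : set R)) = e.
  by rewrite lebesgue_measure_itv/= lte_fin e0/= subr0.
have cc (c : R) : \int[mu]_(s in `[0, e]) c = c * e by rewrite Rintegral_cst// me.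
have bound s : 0 <= s <= e -> `|w 0 - w s| <= eps.
  by move=> /andP[s0 se]; apply: hd => /=; rewrite sub0r normrN ger0_norm// (le_lt_trans se).
have up : \int[mu]_(s in `[0, e]) w s <= (w 0 + eps) * e.
  rewrite -cc; apply: le_Rintegral => //; [exact: int|by apply: int => ?; exact: cvg_cst|].
  by move=> s /=; rewrite in_itv/= => /bound; rewrite ler_norml => /andP[]; lra.
have lo : (w 0 - eps) * e <= \int[mu]_(s in `[0, e]) w s.
  rewrite -cc; apply: le_Rintegral => //; [by apply: int => ?; exact: cvg_cst|exact: int|].
  by move=> s /=; rewrite in_itv/= => /bound; rewrite ler_norml => /andP[]; lra.
set I := Rintegral _ _ _ in up lo *.
by rewrite distrC ler_distl [e^-1 * _]mulrC ler_pdivlMr// ler_pdivrMr// lo up.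
Unshelve. all: by end_near. Qed.

Lemma continuous_sum_seq (T : topologicalType) (I : Type) (s : seq I) (F : I -> T -> R) :
  (forall i, continuous (F i)) -> continuous (fun z => \sum_(i <- s) F i z).
Proof.
move=> cF; elim: s => [|i s ih].
  by under eq_fun do rewrite big_nil; move=> z; exact: cvg_cst.
under eq_fun do rewrite big_cons; move=> z.
by apply: cvgD; [exact: cF|exact: ih].
Qed.

Lemma continuous_enorm n (h : R -> R -> 'cV[R]_n) : continuous_Omega_bar h ->
  continuous (fun z : R * R => enorm (h (clamp z).1 (clamp z).2)).
Proof.
move=> hc z; apply: (@continuous_comp _ _ _
    (fun z => \sum_j h (clamp z).1 (clamp z).2 j ord0 ^+ 2) Num.sqrt); last first.
  exact: sqrt_continuous.
apply: continuous_sum_seq => j y; under eq_fun do rewrite expr2.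
have := continuous_clamp (hc j); move=> /(_ y) hy.
exact: (@cvgM _ _ _ _ _ _ _ _ hy hy).
Qed.

End clamp.

Section C0_stability.
Context {R : realType}.
Local Notation mu := (@lebesgue_measure R).
Local Notation mu2 := (mu \x mu)%E.

(** If G < 0 at some point of the closure, then G < 0 on the product of two
    nonempty open intervals inside Omega. *)
Lemma ae_Omega_closure (G : R * R -> R) : continuous G ->
  {ae mu, forall t, {ae mu, forall x, @Omega R (t, x) -> 0 <= G (t, x)}} ->
  forall z, @Omega_bar R z -> 0 <= G z.
Proof.
move=> cG hG [t x] [/=]; rewrite !in_itv/= andbT => t0 /andP[x0 x1].
rewrite leNgt; apply/negP => Gneg.
have oG : open [set z | G z < 0].
  by apply: (@open_comp _ _ G [set y | y < 0]) => [z _|]; [exact: cG|exact: open_lt].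
have [[U V] [/= Ut Vx] UV] : nbhs (t, x) [set z | G z < 0] by exact: open_nbhs_nbhs.
have [d /= d0 dU] := Ut; have [d' /= d'0 dV] := Vx.
have [t1 [/andP[t1a t1b] ht1]] := @ae_itv_exists R t (t + d) _ ltac:(lra) hG.
have ab : Num.max 0 (x - d') < Num.min 1 (x + d').
  by rewrite gt_max !lt_min; apply/andP; split; apply/andP; split; lra.
have [x1' [/andP[]]] := ae_itv_exists ab ht1.
rewrite gt_max lt_min => /andP[xa xb] /andP[xc xd] /(_ _)/wrap[|].
  by split; rewrite /= in_itv/= ?andbT ?xa//; lra.
rewrite leNgt => /negP; apply; apply: (UV (t1, x1')); split => /=.
  by apply: dU => /=; rewrite ltr0_norm; lra.
by apply: dV => /=; rewrite ltr_norml; apply/andP; split; lra.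
Qed.

Lemma continuous_pair_l (a : R) : continuous (fun y : R => (a, y) : R * R).
Proof. by move=> y; exact: (cvg_pair (@cvg_cst _ a _ _ _) cvg_id). Qed.

Lemma continuous_pair_r (a : R) : continuous (fun y : R => (y, a) : R * R).
Proof. by move=> y; exact: (cvg_pair cvg_id (@cvg_cst _ a _ _ _)). Qed.

Lemma clampE (t x : R) : 0 <= t -> 0 <= x <= 1 -> clamp (t, x) = (t, x).
Proof. by move=> t0 x01; apply: clamp_id; split; rewrite /= in_itv/= ?t0. Qed.

Lemma continuous_trace_t0 n (u : R -> R -> 'cV[R]_n) (x : R) : continuous_Omega_bar u ->
  0 <= x <= 1 -> trace_t0 u x = u 0 x.
Proof.
move=> cu x01; apply/colP => k; rewrite mxE; apply: cvg_lim => //.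
pose w s := (fun z : R * R => u z.1 z.2 k ord0) (clamp (s, x)).
have w0 : w 0 = u 0 x k ord0 by rewrite /w clampE.
have cw : continuous w.
  move=> s; apply: (@continuous_comp _ _ _ (fun s => (s, x) : R * R)
    ((fun z : R * R => u z.1 z.2 k ord0) \o clamp)); first exact: continuous_pair_r.
  exact: continuous_clamp (cu k) _.
rewrite -w0; apply: cvg_trans (continuous_mean_cvg cw); apply: near_eq_cvg.
near=> e; rewrite /mean_t0; congr (_ * _); apply: eq_Rintegral => s.
by rewrite inE/= in_itv/= => /andP[s0 _]; rewrite /w clampE.
Unshelve. all: by end_near. Qed.

Lemma Np_inftyP (u : R -> R) (c : R) :
  (Np +oo u <= c%:E)%E <-> {ae mu, forall x, `|u x| <= c}.
Proof.
rewrite /Np unlock /Lnorm muT_gt0; split.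
  by move/ess_supP; apply: ae_imply => x /=; rewrite lee_fin.
by move=> h; apply/ess_supP; apply: ae_imply h => x /=; rewrite lee_fin.
Qed.

(** The continuous function w provides the boundedness that makes the supremum
    an upper bound. *)
Lemma C0_norm_ub n (u : R -> 'cV[R]_n) (w : R -> R) : continuous w ->
  (forall x, 0 <= x <= 1 -> w x = enorm (u x)) ->
  forall x, 0 <= x <= 1 -> enorm (u x) <= C0_norm u.
Proof.
move=> cw wE x x01; apply: sup_ubound; last by exists x => //=; rewrite in_itv.
have := @compact_bounded _ _ _ (continuous_compact (continuous_subspaceT cw)
    (@segment_compact R 0 1)).
move=> [M [_ hM]]; exists (`|M| + 1) => _ [y /= yI <-].
have MM : M < `|M| + 1 by rewrite (le_lt_trans (ler_norm M))// ltrDl.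
rewrite in_itv/= in yI; rewrite -wE//; apply: le_trans (ler_norm _) _.
by apply: (hM _ MM); exists y => //=; rewrite in_itv.
Qed.

(** The bound for p = oo holds for almost every x in almost every slice; it
    extends to all points by continuity of v and i. The initial slice of the
    waves is bounded by the norm of the data because, by continuity, the trace
    at time 0 is the value at time 0. *)
Theorem C0_stability (N : nat) (L C : 'I_N -> R) (A : R -> 'M[R]_(N + N)) (alpha : R) :
  (forall k, 0 < L k) -> (forall k, 0 < C k) -> ess_bounded_mx A -> 0 < alpha ->
  {ae mu, forall t, 0 <= t -> loewner_ge (A t + (A t)^T) (alpha *: 1%:M)} ->
  C0_exp_stable L C A.
Proof.
move=> L0 C0 [M AM] alpha0 Adiss.
have p1 : (1 <= +oo :> \bar R)%E by exact: leey.
have [gamma [B [gamma0 B0 decay]]] := wave_Lp_decay L0 C0 alpha0 AM Adiss p1.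
exists gamma, B; split => // v i v0 i0 [cv ci [cv0 ci0 _] sol].
have data_int (u : R -> R) : {within `[0, 1], continuous u} -> mu.-integrable `[0, 1] (EFin \o u).
  by move=> cu; apply: continuous_compact_integrable => //; exact: segment_compact.
have [f [g [fm gm fg bd init]]] := network_decomposition L0 C0
  (fun k => continuous_Omega_bar_measurable (cv k))
      (fun k => continuous_Omega_bar_measurable (ci k))
  (fun k T => continuous_Omega_bar_integrable T (cv k))
      (fun k T => continuous_Omega_bar_integrable T (ci k))
  (fun k => data_int _ (cv0 k)) (fun k => data_int _ (ci0 k)) sol.
pose h t x := col_mx (i t x) (v t x).
have ch : continuous_Omega_bar h.
  move=> j; case: (splitP j) => k jk.
    have -> : j = lshift N k by exact: val_inj.
    by under eq_fun do rewrite col_mxEu; exact: ci.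
  have -> : j = rshift N k by exact: val_inj.
  by under eq_fun do rewrite col_mxEd; exact: cv.
have ce := continuous_enorm ch.
pose S := C0_norm (h 0).
have hS x : 0 <= x <= 1 -> enorm (h 0 x) <= S.
  apply: (@C0_norm_ub _ _ (fun x => enorm (h (clamp (0, x)).1 (clamp (0, x)).2))).
    move=> y; apply: (@continuous_comp _ _ _ (fun y => (0, y) : R * R)
      (fun z : R * R => enorm (h (clamp z).1 (clamp z).2))); last exact: ce.
    exact: continuous_pair_l.
  by move=> y y01; rewrite clampE.
have S0 : 0 <= S.
  have h00 := hS 0; rewrite lexx ler01 in h00.
  exact: le_trans (enorm_ge0 _) (h00 isT).
have init0 : {ae mu, forall x, 0 < x < 1 -> wave_slice L C f g 0 x = h 0 x}.
  apply: ae_imply (ae_and init (sol_initial sol)) => x [hx hx'] x01.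
  have x01' : 0 <= x <= 1 by case/andP: x01 => /ltW -> /ltW ->.
  have [Ev Ei] := hx x01; have [Tv Ti] := hx' x01.
  rewrite /wave_slice -Ev -Ei -Tv -Ti /h.
  by rewrite (continuous_trace_t0 cv x01') (continuous_trace_t0 ci x01').
have N0 : (Lp_norm +oo (wave_slice L C f g 0) <= S%:E)%E.
  rewrite Lp_normE; apply/Np_inftyP.
  apply: ae_imply (ae_and init0 (ae_and (ae_neq 0) (ae_neq 1))) => x [hx [x0 x1]].
  rewrite patchE mem_setE in_itv/=; case: ifPn => [x01|_]; last by rewrite normr0.
  rewrite ger0_norm ?enorm_ge0// hx; first exact: hS.
  by case/andP: x01 => ? ?; rewrite !lt_neqAle (eq_sym 0) x0 x1; apply/andP.
have slice_bound t : 0 <= t -> {ae mu, forall x, 0 <= x <= 1 ->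
    enorm (wave_slice L C f g t x) <= B * expR (- gamma * t) * S}.
  move=> t0; have Be0 : 0 <= B * expR (- gamma * t) by rewrite mulr_ge0 ?expR_ge0// ltW.
  have : (Lp_norm +oo (wave_slice L C f g t) <= (B * expR (- gamma * t) * S)%:E)%E.
    apply: (le_trans (decay f g fm gm bd t t0)).
    by rewrite [leRHS]EFinM lee_wpmul2l ?lee_fin.
  rewrite Lp_normE => /Np_inftyP; apply: ae_imply => x hx x01.
  by move: hx; rewrite patchE mem_setE in_itv/= x01 ger0_norm// enorm_ge0.
have pointwise z : @Omega_bar R z ->
    0 <= B * expR (- gamma * z.1) * S - enorm (h (clamp z).1 (clamp z).2).
  apply: (@ae_Omega_closure (fun z => B * expR (- gamma * z.1) * S - enorm
      (h (clamp z).1 (clamp z).2))).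
    have cexp : continuous (fun z : R * R => expR (- gamma * z.1)).
      move=> y; apply: (@continuous_comp _ _ _ (fun z : R * R => - gamma * z.1) (@expR R)).
        by apply: cvgMl_tmp; exact: cvg_fst.
      exact: continuous_expR.
    move=> y; apply: cvgB; last exact: ce.
    by apply: cvgMr_tmp; apply: cvgMl_tmp; exact: cexp.
  apply: ae_imply (ae_xsection (wave_eq fg)) => t ht.
  have [t0|t0] := ltP 0 t; last first.
    by apply: ae_all => x [/=]; rewrite in_itv/= andbT => /(le_lt_trans t0); rewrite ltxx.
  apply: ae_imply (ae_and ht (slice_bound t (ltW t0))) => x [hx hb] Ox.
  have [_ /=] := Ox; rewrite in_itv/= => /andP[x0 x1].
  have x01 : 0 <= x <= 1 by rewrite !ltW.
  have [-> ->] := clampE (ltW t0) x01; rewrite subr_ge0.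
  have [hv hi] := hx Ox; rewrite /= in hv hi.
  by rewrite /h hv hi; exact: hb.
move=> t t0; apply: ge_sup.
  by exists (enorm (h t 0)), 0 => //=; rewrite in_itv/= lexx ler01.
move=> _ [x /= + <-]; rewrite in_itv/= => x01.
have := pointwise (t, x); rewrite clampE//= subr_ge0; apply.
by split; rewrite /= in_itv/= ?t0.
Qed.

End C0_stability.

Theorem theorem3p6 (R : realType) (N : nat) (L C : 'I_N -> R)
    (A : R -> 'M[R]_(N + N)) (alpha : R)
    (hN : (1 <= N)%N)
    (hL : forall k, 0 < L k) (hC : forall k, 0 < C k)
    (hA_meas : measurable_mx A) (hA_bdd : ess_bounded_mx A)
    (halpha : 0 < alpha)
    (hA_diss : {ae @lebesgue_measure R, forall t, 0 <= t ->
                  loewner_ge (A t + (A t)^T) (alpha *: 1%:M)}) :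
  (forall p : \bar R, (1 <= p)%E -> Lp_exp_stable L C A p) /\
  ({within `[0, +oo[, continuous A} -> C0_exp_stable L C A).
Proof.
split=> [p p1|_]; first exact: Lp_stability hL hC hA_bdd halpha hA_diss p1.
exact: C0_stability hL hC hA_bdd halpha hA_diss.
Qed.
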